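(* Let $m_0, M_0, E_0>0$ and $H_0\in\mathbb{R}$ be given. There exists a constant $c_1>0$, depending only on $m_0,M_0,E_0,H_0$, such that the following holds. Let $f=f(t,x,v)\ge 0$ be a solution of the Landau equation with Coulomb potential ($\gamma=-3$) $$\partial_t f+v\cdot\nabla_x f=Q(f,f),\qquad f(0,x,v)=f_0(x,v),$$ such that for each $(t,x)$, writing $f(v)=f(t,x,v)$, $$m_0\le\int_{\mathbb{R}^3}f(v)\,dv\le M_0,\qquad \int_{\mathbb{R}^3}f(v)|v|^2\,dv\le E_0,\qquad \int_{\mathbb{R}^3}f(v)\log f(v)\,dv\le H_0 .$$ Then for each $(t,x)$ the entropy dissipation of $f=f(t,x,\cdot)$ satisfies $$D(f)\ \ge\ c_1\,\|f\|_{L^3_{-5/3}(\mathbb{R}^3)}-24M_0^2 .$$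
   Context: Repeated indices $i,j\in\{1,2,3\}$ are summed. The coefficient matrix is $a_{ij}(v)=\frac{1}{|v|}\left(\delta_{ij}-\frac{v_iv_j}{|v|^2}\right)$ on $\mathbb{R}^3$ (the case $\gamma=-3$ of $|v|^{\gamma+2}(\delta_{ij}-v_iv_j/|v|^2)$). The collision operator, acting in the velocity variable for fixed $(t,x)$, is $$Q(f,f)(v)=\partial_i\int_{\mathbb{R}^3}a_{ij}(v-w)\big(f(w)\partial_jf(v)-f(v)\partial_jf(w)\big)\,dw .$$ The unknown is $f:\mathbb{R}_{\ge0}\times\mathbb{R}^3\times\mathbb{R}^3\to\mathbb{R}_{\ge0}$. For fixed $(t,x)$ the entropy dissipation is $$D(f)=-\int_{\mathbb{R}^3}Q(f,f)\log f\,dv=\frac12\iint_{\mathbb{R}^3\times\mathbb{R}^3}a_{ij}(v-w)f(v)f(w)\left(\frac{\partial_if(v)}{f(v)}-\frac{\partial_if(w)}{f(w)}\right)\left(\frac{\partial_jf(v)}{f(v)}-\frac{\partial_jf(w)}{f(w)}\right)dv\,dw ,$$ which depends only on the velocity profile $f(t,x,\cdot)$. With $\langle v\rangle=\sqrt{1+|v|^2}$, the weighted norm is $\|f\|_{L^p_{-q}(X)}=\left(\int_X|f(v)|^p\langle v\rangle^{-pq}\,dv\right)^{1/p}$; so $\|f\|_{L^3_{-5/3}(\mathbb{R}^3)}=\left(\int_{\mathbb{R}^3}|f|^3\langle v\rangle^{-5}dv\right)^{1/3}$. *)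

(* Defs.v *)
From HB Require Import structures.
From mathcomp Require Import all_boot all_order all_algebra.
From mathcomp Require Import all_classical all_reals all_analysis.

Set Implicit Arguments.
Unset Strict Implicit.
Unset Printing Implicit Defensive.

Import Order.TTheory GRing.Theory Num.Theory.
Import numFieldNormedType.Exports.

Local Open Scope classical_set_scope.
Local Open Scope ring_scope.

(* R^3 is the product R * R * R, so that it carries both the library's normed
   module structure (whose norm is the sup norm, hence [enorm] below) and its
   product sigma-algebra and product measure. *)
Notation R3 R := (R * R * R)%type (only parsing).

(* [measurableTypeR R] is R with its Borel sigma-algebra. *)
Definition lebesgue3 {R : realType} :
    set (measurableTypeR R * measurableTypeR R * measurableTypeR R)%type
    -> \bar R :=
  (@lebesgue_measure R \x @lebesgue_measure R \x @lebesgue_measure R)%E.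

HB.instance Definition _ (R : realType) := Measure.on (@lebesgue3 R).

(* The library's sigma-finite instance on product measures is shadowed by the
   one for products of subprobabilities, hence this explicit proof. *)
Lemma sigma_finite_product d1 d2 (T1 : measurableType d1)
    (T2 : measurableType d2) (R : realType) (m1 : {measure set T1 -> \bar R})
    (m2 : {sigma_finite_measure set T2 -> \bar R}) :
  sigma_finite setT m1 -> sigma_finite setT (m1 \x m2)%E.
Proof.
move=> /sigma_finiteP[F [TF ndF Foo]].
have /sigma_finiteP[G [TG ndG Goo]] := sigma_finiteT m2.
exists (fun n => F n `*` G n).
  rewrite -setXTT TF TG predeqE => -[x y]; split.
    move=> [/= [n _ Fnx] [k _ Gky]]; exists (maxn n k) => //; split.
    - by move: x Fnx; exact/subsetPset/ndF/leq_maxl.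
    - by move: y Gky; exact/subsetPset/ndG/leq_maxr.
  by move=> [n _ []/= ? ?]; split; exists n.
move=> k; have [? ?] := Foo k; have [? ?] := Goo k.
split; first exact: measurableX.
by rewrite product_measure1E// lte_mul_pinfty// ge0_fin_numE.
Qed.

Lemma sigma_finite_lebesgue3 (R : realType) : sigma_finite setT (@lebesgue3 R).
Proof. by do 2 apply: sigma_finite_product; exact: sigma_finiteT. Qed.

HB.instance Definition _ (R : realType) :=
  Measure_isSigmaFinite.Build _ _ _ (@lebesgue3 R)
    (@sigma_finite_lebesgue3 R).

Section Space.
Context {R : realType}.
Implicit Types (v : R3 R) (i : 'I_3).

Definition coord3 v i : R := nth 0 [:: v.1.1; v.1.2; v.2] i.

Definition basis3 i : R3 R :=
  ((i == 0 :> nat)%N%:R, (i == 1 :> nat)%N%:R, (i == 2 :> nat)%N%:R).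

Definition enorm v : R := Num.sqrt (\sum_(i < 3) coord3 v i ^+ 2).

Definition bracket v : R := Num.sqrt (1 + enorm v ^+ 2).

Definition partial i (g : R3 R -> R) v : R := 'D_(basis3 i) g v.

Definition C1 (g : R3 R -> R) : Prop :=
  (forall v, differentiable g v) /\ (forall i, continuous (partial i g)).

(* ||g||_{L^p_{-q}(X)}, extended-real valued. *)
Definition wLnorm (p q : R) (X : set (R3 R)) (g : R3 R -> R) : \bar R :=
  ((\int[lebesgue3]_(v in X)
      ((`|g v| `^ p) * (bracket v `^ (- (p * q))))%:E) `^ p^-1)%E.

End Space.

Section Landau.
Context {R : realType}.
Implicit Types (v w x : R3 R) (i j : 'I_3).

(* Takes the value 0 at v = 0, a null set. *)
Definition landau_a i j v : R :=
  (enorm v)^-1 * ((i == j)%:R - coord3 v i * coord3 v j / enorm v ^+ 2).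

Definition landau_flux_integrand (g : R3 R -> R) i v w : R :=
  \sum_(j < 3) landau_a i j (v - w)
     * (g w * partial j g v - g v * partial j g w).

Definition landau_flux (g : R3 R -> R) i v : R :=
  \int[lebesgue3]_w landau_flux_integrand g i v w.

Definition landau_Q (g : R3 R -> R) v : R :=
  \sum_(i < 3) partial i (landau_flux g i) v.

(* [landau_Q] is only meaningful under this condition, integrals and
   derivatives being total functions. *)
Definition landau_Q_defined (g : R3 R -> R) : Prop :=
  (forall i v, lebesgue3.-integrable setT (EFin \o landau_flux_integrand g i v))
  /\ (forall i v, derivable (landau_flux g i) v (basis3 i)).

(* The value - \int Q(g,g) log g in its symmetrized form.  The integrand is
   nonnegative when g is, so the integral is defined in [0, +oo].  Where g
   vanishes the quotient is read as x / 0 = 0, and the factor g v * g w makes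
   the integrand 0 there. *)
Definition entropy_dissipation (g : R3 R -> R) : \bar R :=
  ((2^-1)%:E * \int[lebesgue3 \x lebesgue3]_z
     (\sum_(i < 3) \sum_(j < 3)
        landau_a i j (z.1 - z.2) * g z.1 * g z.2
        * (partial i g z.1 / g z.1 - partial i g z.2 / g z.2)
        * (partial j g z.1 / g z.1 - partial j g z.2 / g z.2))%:E)%E.

(* Nonnegative classical solutions on [0, +oo[ x R^3 x R^3; the values of f at
   negative times are irrelevant.  No decay in v is imposed beyond what makes
   Q(f,f) meaningful. *)
Record landau_solution (f0 : R3 R -> R3 R -> R) (f : R -> R3 R -> R3 R -> R)
    : Prop := LandauSolution {
  landau_ge0 : forall (t : R) x v, 0 <= t -> 0 <= f t x v ;
  landau_C1_v : forall (t : R) x, 0 <= t -> C1 (f t x) ;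
  landau_diff_x : forall (t : R) x v, 0 < t ->
    differentiable (fun y : R3 R => f t y v) x ;
  landau_derivable_t : forall (t : R) x v, 0 < t ->
    derivable (fun s : R => f s x v) t 1 ;
  landau_Qdef : forall (t : R) x, 0 < t -> landau_Q_defined (f t x) ;
  landau_eq : forall (t : R) x v, 0 < t ->
    derive1 (fun s => f s x v) t
      + \sum_(i < 3) coord3 v i * partial i (fun y : R3 R => f t y v) x
    = landau_Q (f t x) v ;
  landau_init : forall x v, f 0 x v = f0 x v ;
  landau_init_cont : forall x v, f t x v @[t --> 0^'+] --> f0 x v }.

End Landau.

(* Main.v *)
(* Only the velocity profile g >= 0 at a fixed (t, x) matters, with its C^1 regularity
   and its mass, energy and entropy bounds.  As D(g) >= 0, it suffices to show
   ||g||_{L^3_{-5/3}} <= C (1 + D(g)).  Write u = grad g / g.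

   Since a_ij(z) xi_i xi_j = |z x xi|^2 / |z|^3, D(g) = 1/2 \int g(v) d(v) dv with
   d(v) = \int g(w) |v - w|^-3 |(v - w) x (u(v) - u(w))|^2 dw.  For fixed v, integrate
   psi(w) g(w) (v - w) x (u(v) - u(w)) in w, with psi a compactly supported function chi
   or chi times a suitable affine function of w: Cauchy-Schwarz bounds it by
   <v>^(3/2) d(v)^(1/2), and integration by parts in w removes u(w).  The entropy bound
   keeps g from concentrating on a plane, so that the covariance of chi g is
   nondegenerate and |u|^2 + |v x u|^2 <= C (<v>^3 d(v) + <v>^2).  Hence
   \int g <v>^-3 (1 + |u|^2 + |v x u|^2) dv <= C (1 + D(g)).

   The left-hand side controls radial derivatives with weight <v>^-3 and tangential ones
   with weight <v>^-1.  A Loomis-Whitney inequality along one line direction and two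
   families of circles, applied to g^2 with weights and symmetrized over the six signed
   axes, then bounds \int g^3 <v>^-5 by the cube of that quantity. *)

Require Import Defs.
From HB Require Import structures.
From mathcomp Require Import all_boot all_order all_algebra.
From mathcomp Require Import all_classical all_reals all_analysis.
From mathcomp Require Import measurable_realfun ring lra.
Import Order.TTheory GRing.Theory Num.Theory.
Import numFieldNormedType.Exports.
Local Open Scope classical_set_scope.
Local Open Scope ring_scope.
Set Implicit Arguments.
Unset Strict Implicit.
Unset Printing Implicit Defensive.

(** * Lebesgue measure on R^3 *)

Local Notation M1 R := (measurableTypeR R).
Local Notation M2 R := (M1 R * M1 R)%type.
Local Notation M3 R := (M1 R * M1 R * M1 R)%type.

(** Why lines and circles: a Cartesian Loomis-Whitney inequality differentiates in three fixed
    directions, hence radially somewhere in each, while radial derivatives are controlled only with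
    the weight <v>^-3. One direction can carry that weight provided the other two are tangential.
    Polar coordinates about the origin are singular there; moving the centre to (-1, 0, 0) and
    localizing to v_1 > -1/2 removes the singularity and costs only a multiple of |u|, which is
    controlled too. The resulting weight degenerates away from the first axis, hence the six signed
    axes. Why g^2: for F ~ <v>^-4 g^2 the inequality bounds F^(3/2) ~ <v>^-6 g^3 times a Jacobian of
    order <v>, and Cauchy-Schwarz splits <v>^-4 g^2 |u| into the roots of <v>^-5 g^3 and of <v>^-3 g
    |u|^2. With J = \int g^3 <v>^-5 and K the weighted Fisher information this reads J^4 <= C J^3
    K^3. Dividing by J^3 requires J finite, and no decay of g is known: J is truncated in v, and the
    bound must not depend on the truncation. *)

Definition lebesgue2 {R : realType} : set (M2 R) -> \bar R :=
  (@lebesgue_measure R \x @lebesgue_measure R)%E.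

HB.instance Definition _ (R : realType) := Measure.on (@lebesgue2 R).

Lemma sigma_finite_lebesgue2 (R : realType) : sigma_finite setT (@lebesgue2 R).
Proof. by apply: sigma_finite_product; exact: sigma_finiteT. Qed.

HB.instance Definition _ (R : realType) :=
  Measure_isSigmaFinite.Build _ _ _ (@lebesgue2 R)
    (@sigma_finite_lebesgue2 R).

Section Integrals.
Context {R : realType}.
Local Notation leb := (@lebesgue_measure R).

Lemma lebesgue3_tonelli (F : M3 R -> \bar R) :
  measurable_fun [set: M3 R] F -> (forall v, 0 <= F v)%E ->
  (\int[lebesgue3]_v F v = \int[leb]_x \int[leb]_y \int[leb]_z F (x, y, z))%E.
Proof.
move=> mF F0.
transitivity (\int[@lebesgue2 R \x leb]_v F v)%E => //.
rewrite fubini_tonelli1//.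
rewrite (@fubini_tonelli1 _ _ _ _ R leb leb (fubini_F leb F))//.
  exact: measurable_fun_fubini_tonelli_F.
by move=> p; exact: integral_ge0.
Qed.

Lemma lebesgue3_tonelliC (F : M3 R -> \bar R) :
  measurable_fun [set: M3 R] F -> (forall v, 0 <= F v)%E ->
  (\int[lebesgue3]_v F v = \int[leb]_z \int[leb]_x \int[leb]_y F (x, y, z))%E.
Proof.
move=> mF F0.
transitivity (\int[@lebesgue2 R \x leb]_v F v)%E => //.
rewrite fubini_tonelli2//.
apply: eq_integral => z _.
rewrite /fubini_G (@fubini_tonelli1 _ _ _ _ R leb leb (fun p => F (p, z)))//.
exact: measurableT_comp.
Qed.
End Integrals.

Section ContinuousMeasurable.
Context {R : realType}.

Let cube (i : nat * int * int * int) : set (R3 R) :=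
  let: (n, a, b, c) := i in
  let I (k : int) : set R := `[k%:~R / n.+1%:R, (k + 1)%:~R / n.+1%:R[%classic in
  (I a `*` I b `*` I c).

(** Links the product topology to the product sigma-algebra: an open set is the union of the cubes
    [cube i] that it contains, and these are indexed by a countable type. *)
Lemma open_measurable3 (U : set (R3 R)) : open U -> measurable (U : set (M3 R)).
Proof.
move=> oU.
have -> : U = \bigcup_i (if asbool (cube i `<=` U) then cube i else set0).
  apply/seteqP; split => [v Uv|v [i _]]; last first.
    by case: asboolP => // + cv; apply.
  have /nbhs_ballP[e /= e0 eU] : nbhs v U by rewrite nbhsE; exists U.
  have [n nP] : exists n : nat, n.+1%:R^-1 < e.
    exists (Num.trunc e^-1); rewrite invf_plt ?posrE//.
    exact: truncnS_gt.
  have n0 : 0 < n.+1%:R :> R by rewrite ltr0n.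
  pose k (x : R) := Num.floor (x * n.+1%:R).
  have kP (x : R) : (k x)%:~R / n.+1%:R <= x < (k x + 1)%:~R / n.+1%:R.
    rewrite ler_pdivrMr// ltr_pdivlMr// floor_le/=.
    by rewrite floorD1_gt.
  exists (n, k v.1.1, k v.1.2, k v.2) => //; case: asboolP => [_|[]].
    by rewrite /cube; split; [split|]; rewrite /= in_itv/= kP.
  have near (x y : R) : `[(k x)%:~R / n.+1%:R, (k x + 1)%:~R / n.+1%:R[%classic y ->
      ball x e y.
    rewrite /= in_itv/= => /andP[y1 y2]; have /andP[x1 x2] := kP x.
    have E : (k x + 1)%:~R / n.+1%:R = (k x)%:~R / n.+1%:R + n.+1%:R^-1 :> R.
      by rewrite intrD mulrDl mul1r.
    rewrite E in x2 y2.
    rewrite /ball/= ltr_norml; move: x1 x2 y1 y2 nP {E}.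
    move: (n.+1%:R^-1) (_ / _) => d p x1 x2 y1 y2 nP.
    by apply/andP; split; lra.
  move=> [[x y] z] [[/= /near hx /near hy] /near hz].
  by apply: eU; case: v hx hy hz {Uv} => -[v1 v2] v3 hx hy hz; split => //; split.
apply: countable_bigcupT_measurable => [|i]; first exact: countableP.
case: asboolP => // _; case: i => [[[n a] b] c]; apply: measurableX => //.
exact: measurableX.
Qed.

Lemma continuous_measurable3 (g : R3 R -> R) : continuous g ->
  measurable_fun [set: M3 R] g.
Proof.
move=> /continuousP cg.
apply: (@measurability _ _ (M3 R) R _ _ _ (RGenOpens.measurableE R)).
move=> _ [_ [a [b ->]] <-]; rewrite setTI.
by apply: open_measurable3; apply: cg; exact: interval_open.
Qed.
End ContinuousMeasurable.

Section Symmetry.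
Context {R : realType}.
Local Notation leb := (@lebesgue_measure R).

(** Composing [cyc] and [refl1] moves the first axis to each of the six signed axes, so that
    estimates along an axis need proof for one axis only. *)
Definition cyc (v : R3 R) : R3 R := (v.2, v.1.1, v.1.2).
Definition refl1 (v : R3 R) : R3 R := (- v.1.1, v.1.2, v.2).

Lemma measurable_proj1 : measurable_fun [set: M3 R] (fun v : M3 R => v.1.1).
Proof. exact: (measurableT_comp measurable_fst measurable_fst). Qed.

Lemma measurable_proj2 : measurable_fun [set: M3 R] (fun v : M3 R => v.1.2).
Proof. exact: (measurableT_comp measurable_snd measurable_fst). Qed.

Lemma measurable_proj3 : measurable_fun [set: M3 R] (fun v : M3 R => v.2).
Proof. exact: measurable_snd. Qed.

Lemma measurable_cyc : measurable_fun [set: M3 R] (cyc : M3 R -> M3 R).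
Proof.
exact: (measurable_fun_pair (measurable_fun_pair measurable_proj3 measurable_proj1)
  measurable_proj2).
Qed.

Lemma measurable_refl1 : measurable_fun [set: M3 R] (refl1 : M3 R -> M3 R).
Proof.
exact: (measurable_fun_pair (measurable_fun_pair
  (measurableT_comp (@oppr_measurable R setT) measurable_proj1) measurable_proj2) measurable_proj3).
Qed.

Lemma lebesgue3_cyc (F : M3 R -> \bar R) :
  measurable_fun [set: M3 R] F -> (forall v, 0 <= F v)%E ->
  (\int[lebesgue3]_v F (cyc v) = \int[lebesgue3]_v F v)%E.
Proof.
move=> mF F0; rewrite (@lebesgue3_tonelliC _ (F \o cyc)); [|..| by move=> v /=]; last first.
  by apply: measurableT_comp => //; exact: measurable_cyc.
by rewrite lebesgue3_tonelli.
Qed.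

Lemma lebesgue3_refl1 (F : M3 R -> \bar R) :
  measurable_fun [set: M3 R] F -> (forall v, 0 <= F v)%E ->
  (\int[lebesgue3]_v F (refl1 v) = \int[lebesgue3]_v F v)%E.
Proof.
move=> mF F0; rewrite (@lebesgue3_tonelli _ (F \o refl1)); [|..| by move=> v /=]; last first.
  by apply: measurableT_comp => //; exact: measurable_refl1.
rewrite (lebesgue3_tonelli mF F0).
pose G x := (\int[leb]_y \int[leb]_z F (x, y, z))%E.
have mG : measurable_fun [set: M1 R] G.
  apply: (@measurable_fun_fubini_tonelli_F _ _ _ _ _ leb (fun p => \int[leb]_z F (p, z))%E).
    exact: (@measurable_fun_fubini_tonelli_F _ _ _ _ _ leb F).
  by move=> p; exact: integral_ge0.
have G0 x : (0 <= G x)%E.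
  by apply: integral_ge0 => y _; exact: integral_ge0.
transitivity (\int[leb]_(x in -%R @^-1` setT) (G \o -%R) x)%E.
  by rewrite preimage_setT.
rewrite -(@ge0_integral_pushforward _ _ (M1 R) (M1 R) R)//.
by apply: eq_measure_integral => //= A mA _; exact: lebesgue_measureN.
Qed.
End Symmetry.

(** * Cauchy-Schwarz for extended-real integrals *)

Section CauchySchwarz.
Context {R : realType} {d : measure_display} {T : measurableType d}.
Variable mu : {measure set T -> \bar R}.
Local Open Scope ereal_scope.

Lemma ereal_amgm (a b c : \bar R) (l : R) : (0 < l)%R -> 0 <= a -> 0 <= b ->
  0 <= c -> c * c <= a * b -> c + c <= l%:E * a + (l^-1)%:E * b.
Proof.
move=> l0; have li0 : (0 < l^-1)%R by rewrite invr_gt0.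
have [->|an] := eqVneq a +oo.
  by move=> *; rewrite gt0_muley ?lte_fin// addye ?leey// gt_eqF// (lt_le_trans _ (_ : 0 <= _))// ?ltNy0// mule_ge0// lee_fin ltW.
have [->|bn] := eqVneq b +oo.
  by move=> *; rewrite [X in _ <= _ + X]gt0_muley ?lte_fin// addey ?leey// gt_eqF// (lt_le_trans _ (_ : 0 <= _))// ?ltNy0// mule_ge0// lee_fin ltW.
case: a an => [a| |]//; case: b bn => [b| |]// _ _; rewrite !lee_fin => a0 b0.
move=> c0; case: c c0 => [c| |] // c0; move: c0.
rewrite -!EFinM -!EFinD !lee_fin => c0 h.
rewrite -subr_ge0.
have -> : (l * a + l^-1 * b - (c + c) = l^-1 * (l ^+ 2 * a + b - l * c *+ 2))%R.
  by field; rewrite gt_eqF.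
rewrite mulr_ge0 ?(ltW li0)//.
have [a00|ap] := eqVneq a 0%R.
  have -> : c = 0%R by apply/eqP; rewrite -sqrf_eq0 expr2 eq_le mulr_ge0// andbT (le_trans h)// a00 mul0r.
  by rewrite a00 !mulr0 mul0rn subr0 add0r.
have a1 : (0 < a)%R by rewrite lt_neqAle eq_sym ap.
rewrite -(pmulr_rge0 _ a1).
have -> : (a * (l ^+ 2 * a + b - l * c *+ 2) = (l * a - c) ^+ 2 + (a * b - c * c))%R by ring.
by rewrite addr_ge0 ?sqr_ge0// subr_ge0.
Qed.

(** The squared form needs neither integrability nor square roots of measurable functions. It comes
    from integrating [ereal_amgm] pointwise and optimizing the parameter [l]. *)
Lemma ge0_integral_cs (f g h : T -> \bar R) :
  measurable_fun [set: T] f -> measurable_fun [set: T] g -> measurable_fun [set: T] h ->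
  (forall x, 0 <= f x) -> (forall x, 0 <= g x) -> (forall x, 0 <= h x) ->
  (forall x, h x * h x <= f x * g x) ->
  (\int[mu]_x h x) * (\int[mu]_x h x) <= (\int[mu]_x f x) * (\int[mu]_x g x).
Proof.
move=> mf mg mh f0 g0 h0 hfg.
(* A factor of integral 0 vanishes almost everywhere and forces [h] to do so. This case stands apart
   because the optimal [l] divides by the integral of [f], and because the other factor may be
   infinite. *)
have null (k : T -> \bar R) : measurable_fun [set: T] k -> (forall x, 0 <= k x) ->
    (forall x, k x = 0 -> h x = 0) -> \int[mu]_x k x = 0 -> \int[mu]_x h x = 0.
  move=> mk k0 kh ik.
  have : ae_eq mu setT k (cst 0).
    apply/(ae_eq_integral_abs mu measurableT mk).
    by under eq_integral do rewrite gee0_abs//.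
  move=> ae; rewrite -(integral0 mu setT).
  apply: ae_eq_integral => //.
  by apply: filterS ae => x kx _; apply: kh; exact: kx.
have hsq x : h x * h x <= 0 -> h x = 0.
  move=> hh; apply/eqP; rewrite eq_le h0 andbT leNgt; apply/negP => hp.
  by move: hh; rewrite leNgt mule_gt0.
set A := \int[mu]_x f x; set B := \int[mu]_x g x; set H := \int[mu]_x h x.
have A0 : 0 <= A by exact: integral_ge0.
have B0 : 0 <= B by exact: integral_ge0.
have H0 : 0 <= H by exact: integral_ge0.
have [Ae|An] := eqVneq A 0.
  rewrite /H (null f)// ?mule0 ?mule_ge0// => x fx.
  by apply: hsq; rewrite (le_trans (hfg x))// fx mul0e.
have [Be|Bn] := eqVneq B 0.
  rewrite /H (null g)// ?mule0 ?mule_ge0// => x gx.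
  by apply: hsq; rewrite (le_trans (hfg x))// gx mule0.
have Ap : 0 < A by rewrite lt_neqAle eq_sym An.
have Bp : 0 < B by rewrite lt_neqAle eq_sym Bn.
have [->|Ay] := eqVneq A +oo; first by rewrite gt0_mulye ?leey.
have [->|By] := eqVneq B +oo; first by rewrite gt0_muley ?leey.
have key (l : R) : (0 < l)%R -> H + H <= l%:E * A + (l^-1)%:E * B.
  move=> l0.
  have li0 : (0 < l^-1)%R by rewrite invr_gt0.
  rewrite /H /A /B -ge0_integralD// -!ge0_integralZl_EFin//; try exact: ltW.
  rewrite -ge0_integralD//; first last.
  - by apply: emeasurable_funM => //.
  - by move=> x _; rewrite mule_ge0// lee_fin ltW.
  - by apply: emeasurable_funM => //.
  - by move=> x _; rewrite mule_ge0// lee_fin ltW.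
  apply: ge0_le_integral => //.
  - by move=> x _; rewrite adde_ge0.
  - exact: emeasurable_funD.
  - by apply: emeasurable_funD; apply: emeasurable_funM.
  - by move=> x _; apply: ereal_amgm.
case: A Ap Ay key A0 An => [a| |]//; case: B Bp By B0 Bn => [b| |]//.
rewrite !lte_fin => b0 _ _ _ a0 _ key _ _.
case: H H0 key => [r| |]//; last first.
  by move=> _ /(_ 1%R ltr01); rewrite -!EFinM -EFinD addye// leye_eq.
rewrite lee_fin => r0 key.
rewrite -!EFinM lee_fin.
have [->|rn] := eqVneq r 0%R; first by rewrite mul0r mulr_ge0// ltW.
have rp : (0 < r)%R by rewrite lt_neqAle eq_sym rn.
(* The optimal parameter [l = r / a] makes the first term of the bound equal to [r], leaving
   [r <= a * b / r]. *)
have := key (r / a)%R; rewrite divr_gt0// => /(_ isT).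
rewrite -!EFinM -!EFinD lee_fin mulrVK ?unitfE ?gt_eqF// lerD2l invf_div.
by rewrite mulrAC ler_pdivlMr.
Qed.

End CauchySchwarz.

(** * Gradients and integration by parts *)

Section Projections.
Context {R : realType} {V W : normedModType R}.

Let fst_linear : linear (@fst V W). Proof. by []. Qed.
Let snd_linear : linear (@snd V W). Proof. by []. Qed.

HB.instance Definition _ := GRing.isLinear.Build R (V * W)%type V *:%R (@fst V W) fst_linear.
HB.instance Definition _ := GRing.isLinear.Build R (V * W)%type W *:%R (@snd V W) snd_linear.

Lemma differentiable_fst (p : V * W) : differentiable (@fst V W) p.
Proof. by apply: linear_differentiable => q; exact: cvg_fst. Qed.

Lemma differentiable_snd (p : V * W) : differentiable (@snd V W) p.
Proof. by apply: linear_differentiable => q; exact: cvg_snd. Qed.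
End Projections.

Notation j0 := (ord0 : 'I_3).
Notation j1 := (lift ord0 ord0 : 'I_3).
Notation j2 := (lift ord0 (lift ord0 ord0) : 'I_3).

Lemma ord3_ind (P : 'I_3 -> Prop) : P j0 -> P j1 -> P j2 -> forall i, P i.
Proof.
move=> P0 P1 P2 [[|[|[|//]]] Hi].
- by rewrite (_ : Ordinal _ = j0)//; exact: val_inj.
- by rewrite (_ : Ordinal _ = j1)//; exact: val_inj.
- by rewrite (_ : Ordinal _ = j2)//; exact: val_inj.
Qed.

Lemma sum3E {V : nmodType} (F : 'I_3 -> V) : \sum_(i < 3) F i = F j0 + F j1 + F j2.
Proof. by rewrite !big_ord_recl big_ord0 addr0 addrA. Qed.

Section Gradients.
Context {R : realType}.
Implicit Types (g h : R3 R -> R) (dg dh : 'I_3 -> R3 R -> R) (v : R3 R) (i : 'I_3).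

(** The gradient is carried as data, so that gradients of sums, products and compositions are
    explicit formulas on which [ring] can work. *)
Record hasgrad g dg : Prop := HasGrad {
  hasgrad_diff : forall v, differentiable g v ;
  hasgrad_partial : forall i v, partial i g v = dg i v ;
  hasgrad_dcont : forall i, continuous (dg i) }.

Lemma C1_hasgrad g : C1 g -> hasgrad g (fun i => partial i g).
Proof. by case=> dg cg; split. Qed.

Lemma hasgrad_cont g dg : hasgrad g dg -> continuous g.
Proof. by move=> [dfg _ _] v; exact: differentiable_continuous. Qed.

Lemma hasgrad_ext g dg dg' : hasgrad g dg -> (forall i v, dg i v = dg' i v) ->
  hasgrad g dg'.
Proof.
move=> [? e c] ee; have -> // : dg' = dg.
by apply/funext => i; apply/funext => v; rewrite ee.
Qed.

Lemma hasgrad_cst (c : R) : hasgrad (fun=> c) (fun _ _ => 0).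
Proof. by split=> *; [exact: differentiable_cst|exact: derive_cst|exact: cst_continuous]. Qed.

Lemma differentiable_coord3 i v : differentiable (coord3^~ i) v.
Proof.
by elim/ord3_ind: i; [
  exact: (@differentiable_comp _ _ _ _ fst fst _ (differentiable_fst _) (differentiable_fst _))|
  exact: (@differentiable_comp _ _ _ _ fst snd _ (differentiable_fst _) (differentiable_snd _))|
  exact: differentiable_snd].
Qed.

Lemma coord3_continuous i : continuous (fun v => coord3 v i).
Proof. by move=> v; apply: differentiable_continuous; exact: differentiable_coord3. Qed.

Lemma coord3_lin (k : R) u v i : coord3 (k *: u + v) i = k * coord3 u i + coord3 v i.
Proof. by elim/ord3_ind: i. Qed.

Lemma coord3_basis i j : coord3 (basis3 i : R3 R) j = (i == j)%:R.
Proof. by elim/ord3_ind: i; elim/ord3_ind: j. Qed.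

Lemma is_derive_growth (f : R3 R -> R) v e (l : R) :
  (forall h : R, h != 0 -> h^-1 * (f (h *: e + v) - f v) = l) -> 'D_e f v = l.
Proof.
move=> H; rewrite /derive; apply: cvg_lim => //.
apply: (@cvg_near_cst _ R); near=> h; apply: H; near: h; exact: nbhs_dnbhs_neq.
Unshelve. all: by end_near. Qed.

Lemma hasgrad_coord j : hasgrad (fun v => coord3 v j) (fun i _ => (i == j)%:R).
Proof.
split=> [v|i v|i]; [exact: differentiable_coord3| |exact: cst_continuous].
apply: is_derive_growth => h h0; rewrite coord3_lin addrK coord3_basis.
by rewrite mulrA mulVf// mul1r.
Qed.

Lemma hasgradD g dg h dh : hasgrad g dg -> hasgrad h dh ->
  hasgrad (fun v => g v + h v) (fun i v => dg i v + dh i v).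
Proof.
move=> [g1 g2 g3] [h1 h2 h3]; split=> [v|i v|i].
- exact: differentiableD.
- rewrite /partial deriveD; [|exact: diff_derivable|exact: diff_derivable].
  by rewrite -g2 -h2.
- by move=> v; apply: cvgD; [exact: g3|exact: h3].
Qed.

Lemma hasgradM g dg h dh : hasgrad g dg -> hasgrad h dh ->
  hasgrad (fun v => g v * h v) (fun i v => dg i v * h v + g v * dh i v).
Proof.
move=> Hg Hh; have cg := hasgrad_cont Hg; have ch := hasgrad_cont Hh.
move: Hg Hh => [g1 g2 g3] [h1 h2 h3]; split=> [v|i v|i].
- exact: differentiableM.
- rewrite /partial deriveM; [|exact: diff_derivable|exact: diff_derivable].
  by rewrite -g2 -h2 addrC /GRing.scale/= mulrC.
- by move=> v; apply: cvgD; apply: cvgM; [exact: g3|exact: ch|exact: cg|exact: h3].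
Qed.

Lemma hasgradN g dg : hasgrad g dg -> hasgrad (fun v => - g v) (fun i v => - dg i v).
Proof.
move=> [g1 g2 g3]; split=> [v|i v|i].
- exact: differentiableN.
- by rewrite /partial deriveN -?g2//; exact: diff_derivable.
- by move=> v; apply: cvgN; exact: g3.
Qed.

Lemma hasgradV g dg : hasgrad g dg -> (forall v, g v != 0) ->
  hasgrad (fun v => (g v)^-1) (fun i v => - dg i v / g v ^+ 2).
Proof.
move=> Hg g0; have cg := hasgrad_cont Hg; move: Hg => [g1 g2 g3]; split=> [v|i v|i].
- exact: differentiableV.
- by rewrite /partial deriveV// -?g2 ?/GRing.scale/= ?mulNr 1?mulrC//; exact: diff_derivable.
- move=> v; apply: cvgM; first by apply: cvgN; exact: g3.
  by apply: cvgV; [rewrite expf_neq0|apply: cvgM; exact: cg].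
Qed.

Lemma hasgrad_comp (phi dphi : R -> R) g dg :
  (forall x : R, is_derive x (1 : R) phi (dphi x)) -> continuous dphi -> hasgrad g dg ->
  hasgrad (fun v => phi (g v)) (fun i v => dphi (g v) * dg i v).
Proof.
move=> dp cp Hg; have cg := hasgrad_cont Hg; move: Hg => [g1 g2 g3].
have dphiP x : differentiable phi x by apply/derivable1_diffP; have [] := dp x.
split=> [v|i v|i].
- exact: (@differentiable_comp _ _ _ _ g phi).
- rewrite -g2 /partial (@deriveE _ _ _ (phi \o g)); last exact: differentiable_comp.
  rewrite diff_comp//= deriveE// deriv1E; last by have [] := dp (g v).
  by rewrite derive1E derive_val mulrC.
- move=> v; apply: cvgM; last exact: g3.
  by apply: (@continuous_comp _ _ _ g dphi); [exact: cg|exact: cp].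
Qed.

Lemma diff_coords g v (a b c : R) : differentiable g v ->
  'd g v (a, b, c) = a * partial j0 g v + b * partial j1 g v + c * partial j2 g v.
Proof.
move=> dg; rewrite /partial !deriveE//.
have -> : (a, b, c) = a *: (basis3 j0 : R3 R) + b *: (basis3 j1 : R3 R) + c *: (basis3 j2 : R3 R).
  by rewrite /basis3/=; congr ((_, _), _); rewrite /= /GRing.scale/=; ring.
by rewrite !linearD !linearZ.
Qed.

Lemma hasgrad_curve g dg (x y z : R -> R) (t dx dy dz : R) : hasgrad g dg ->
  is_derive t 1 x dx -> is_derive t 1 y dy -> is_derive t 1 z dz ->
  is_derive t 1 (fun s => g (x s, y s, z s))
    (dx * dg j0 (x t, y t, z t) + dy * dg j1 (x t, y t, z t) + dz * dg j2 (x t, y t, z t)).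
Proof.
move=> [g1 g2 g3] hx hy hz.
have D (w : R -> R) dw : is_derive t 1 w dw -> differentiable w t.
  by move=> hw; apply/derivable1_diffP; have [] := hw.
have E (w : R -> R) dw : is_derive t 1 w dw -> 'd w t 1 = dw.
  by move=> hw; rewrite -deriveE ?derive_val//; exact: D hw.
have dxy : differentiable (fun s => (x s, y s)) t.
  by apply: differentiable_pair; [exact: D hx|exact: D hy].
have dxyz : differentiable (fun s => (x s, y s, z s)) t.
  by apply: differentiable_pair => //; exact: D hz.
have dgc : differentiable (g \o (fun s => (x s, y s, z s))) t.
  exact: differentiable_comp.
apply: DeriveDef; first exact: diff_derivable.
rewrite deriveE// diff_comp//= (diff_pair dxy (D _ _ hz)) (diff_pair (D _ _ hx) (D _ _ hy)) /=.
by rewrite diff_coords// (E _ _ hx) (E _ _ hy) (E _ _ hz) !g2.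
Qed.

End Gradients.

(** * Cutoffs of class C^1 and compact supports *)

Section PositivePart.
Context {R : realType}.

(** From exponent 2 on this is of class C^1, which makes it the building block of all cutoffs
    below. *)
Definition ppow (n : nat) (s : R) : R := Num.max s 0 ^+ n.

Lemma ppow_ge0 n s : 0 <= ppow n s.
Proof. by rewrite exprn_ge0// le_max lexx orbT. Qed.

Lemma ppow_le0 n s : s <= 0 -> ppow n.+1 s = 0.
Proof. by move=> s0; rewrite /ppow max_r// expr0n. Qed.

Lemma ppow_pos n s : 0 <= s -> ppow n s = s ^+ n.
Proof. by move=> s0; rewrite /ppow max_l. Qed.

Lemma ppow_continuous n : continuous (ppow n).
Proof.
move=> s; apply: (@continuous_comp _ _ _ (fun s : R => Num.max s 0) (fun s => s ^+ n)).
  by apply: continuous_max => //; exact: cst_continuous.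
exact: exprn_continuous.
Qed.

Lemma is_derive_ppow n (s : R) :
  is_derive s (1 : R) (ppow n.+2) (n.+2%:R * ppow n.+1 s).
Proof.
have [s0|s0|->] := ltgtP s 0.
- rewrite ppow_le0 ?ltW// mulr0.
  apply: (@near_eq_is_derive _ _ _ (cst 0)).
  by near=> x; rewrite /= ppow_le0// ltW//; near: x; exact: lt_nbhsl.
- apply: (@near_eq_is_derive _ _ _ (fun x : R => x ^+ n.+2)).
    by near=> x; rewrite ppow_pos// ltW//; near: x; exact: lt_nbhsr.
  rewrite ppow_pos ?ltW//.
  apply: DeriveDef; first exact: exprn_derivable.
  by rewrite exp_derive /GRing.scale/= mulr1 mulr_natl.
- rewrite ppow_le0// mulr0.
  (* At the junction the difference quotient is at most |h|^(n+1), hence tends to 0 from both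
     sides. *)
  suff H : h^-1 *: ((ppow n.+2 \o shift 0) (h *: (1 : R)) - ppow n.+2 0) @[h --> 0^'] --> (0 : R).
    by apply: DeriveDef; [exact: cvgP H|exact: cvg_lim H].
  apply/cvgr0Pnorm_le => e e0; near=> h.
  have p0 : ppow n.+2 (0 : R) = 0 by exact: ppow_le0.
  rewrite p0 subr0 /= addr0 /GRing.scale/= mulr1 /ppow.
  have h0 : h != 0 by near: h; exact: nbhs_dnbhs_neq.
  have h1 : `|h| <= 1 by near: h; exact: dnbhs0_le.
  have he : `|h| <= e by near: h; exact: dnbhs0_le.
  rewrite normrM normfV mulrC ler_pdivrMr ?normr_gt0// normrX.
  have -> : `|Num.max h 0| = Num.max h 0 by rewrite ger0_norm// le_max lexx orbT.
  have m0 : 0 <= Num.max h 0 by rewrite le_max lexx orbT.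
  have mh : Num.max h 0 <= `|h| by rewrite ge_max normr_ge0 ler_norm.
  rewrite exprSr ler_pM ?exprn_ge0//.
  rewrite exprSr (le_trans _ he)//.
  by rewrite -[leRHS]mul1r ler_pM ?exprn_ge0// exprn_ile1// (le_trans mh).
Unshelve. all: by end_near. Qed.

Lemma hasgrad_ppow n (g : R3 R -> R) dg : hasgrad g dg ->
  hasgrad (fun v => ppow n.+2 (g v)) (fun i v => n.+2%:R * ppow n.+1 (g v) * dg i v).
Proof.
apply: (@hasgrad_comp _ (ppow n.+2) (fun s => n.+2%:R * ppow n.+1 s)).
  exact: is_derive_ppow.
by move=> x; apply: cvgM; [exact: cvg_cst|exact: ppow_continuous].
Qed.
End PositivePart.

Section Boxed.
Context {R : realType}.
Implicit Types (g : R3 R -> R) (N : R).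
Local Notation leb := (@lebesgue_measure R).

(** Compact support in sup-norm form: a single large coordinate forces the value 0, which is what
    the fundamental theorem of calculus uses along each coordinate line. *)
Definition boxed N g := forall v i, N < `|coord3 v i| -> g v = 0.

Lemma boxedW N N' g : N <= N' -> boxed N g -> boxed N' g.
Proof. by move=> NN bg v i h; apply: (bg v i); exact: le_lt_trans h. Qed.

Lemma hasgrad_boxed N g dg i : hasgrad g dg -> boxed N g -> boxed N (dg i).
Proof.
move=> [g1 g2 g3] bg v j Nv; rewrite -g2 /partial.
rewrite (@near_eq_derive _ _ _ _ (cst 0)) ?derive_cst//.
near=> w; apply: (bg w j); near: w.
have : continuous (fun w : R3 R => `|coord3 w j|).
  move=> w; apply: (@continuous_comp _ _ _ (coord3^~ j) Num.norm).
    exact: coord3_continuous.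
  exact: norm_continuous.
by move=> /(_ v)/cvgr_gt; apply.
Unshelve. all: by end_near. Qed.

Definition box N : set (R3 R) := `[- N, N] `*` `[- N, N] `*` `[- N, N].

Lemma boxP N v : box N v <-> forall i, `|coord3 v i| <= N.
Proof.
rewrite /box; split=> [[[]]|H].
  by rewrite /= !in_itv/= -!ler_norml => h1 h2 h3; apply: ord3_ind.
by split; [split|]; rewrite /= in_itv/= -ler_norml; [exact: (H j0)|exact: (H j1)|exact: (H j2)].
Qed.

Lemma boxed_out N g v : boxed N g -> ~ box N v -> g v = 0.
Proof.
move=> bg; apply: contra_notP => gv; apply/boxP => i.
by rewrite leNgt; apply/negP => h; apply: gv; exact: bg h.
Qed.

Lemma box_compact N : compact (box N).
Proof.
by apply: compact_setX; [apply: compact_setX|]; exact: segment_compact.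
Qed.

Lemma measurable_box N : measurable (box N : set (M3 R)).
Proof. by apply: measurableX => //; exact: measurableX. Qed.

Lemma boxed_bounded N g : continuous g -> boxed N g ->
  exists2 K, 0 <= K & forall v, `|g v| <= K.
Proof.
(* [N] may be negative, whereas the extreme value theorem needs a nonempty box. *)
move=> cg /(@boxedW _ (Num.max N 0)) bg.
have {}bg : boxed (Num.max N 0) g by apply: bg; rewrite le_max lexx.
have cng : continuous (fun v => `|g v|).
  by move=> v; apply: (@continuous_comp _ _ _ g Num.norm); [exact: cg|exact: norm_continuous].
have b0 : box (Num.max N 0) !=set0.
  exists (0, 0, 0); apply/boxP => i.
  by rewrite (_ : coord3 _ i = 0) ?normr0 ?le_max ?lexx ?orbT//; elim/ord3_ind: i.
have [c _ cP] := compact_EVT_max b0 (@box_compact _) (continuous_subspaceT cng).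
exists `|g c| => // v; have [bv|nbv] := pselect (box (Num.max N 0) v).
  by apply: cP; exact: mem_set.
by rewrite (boxed_out bg nbv) normr0.
Qed.

Lemma lebesgue3_box N : 0 <= N -> lebesgue3 (box N) = ((N *+ 2) ^+ 3)%:E.
Proof.
move=> N0; rewrite /box.
transitivity ((@lebesgue2 R \x leb)%E (`[- N, N] `*` `[- N, N] `*` `[- N, N])) => //.
have E2 : (leb \x leb)%E (`[(- N)%R, N] `*` `[(- N)%R, N]) = (leb `[(- N)%R, N] * leb `[(- N)%R, N])%E.
  by rewrite product_measure1E.
have E3 : (@lebesgue2 R \x leb)%E (`[- N, N] `*` `[- N, N] `*` `[- N, N]) =
    (lebesgue2 (`[(- N)%R, N] `*` `[(- N)%R, N]) * leb `[(- N)%R, N])%E.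
  by rewrite product_measure1E//; exact: measurableX.
rewrite E3 [X in (X * _)%E]E2 lebesgue_measure_itv/= lte_fin.
have [|] := ltP (- N) N => h.
  by rewrite -EFinD opprK -!EFinM; congr EFin; ring.
have -> : N = 0 by lra.
by rewrite !mul0e mul0rn expr0n.
Qed.

Lemma integrable_boxed N (g : R3 R -> R) K : measurable_fun [set: M3 R] g ->
  boxed N g -> (forall v, `|g v| <= K) -> lebesgue3.-integrable setT (EFin \o g).
Proof.
move=> mg bg gK.
have {}bg : boxed (Num.max N 0) g by apply: boxedW bg; rewrite le_max lexx.
have N0 : 0 <= Num.max N 0 by rewrite le_max lexx orbT.
set N' := Num.max N 0 in bg N0.
have -> : EFin \o g = (EFin \o g) \_ (box N').
  apply/funext => v; rewrite patchE; case: ifPn => // /negP bv.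
  by rewrite /= (boxed_out bg)// => h; apply: bv; exact: mem_set.
apply/integrable_restrict => //; first exact: measurable_box.
apply/integrableP; split.
  apply/measurable_EFinP; apply: measurable_funS mg => //.
rewrite setTI; apply: (@le_lt_trans _ _ (\int[lebesgue3]_(x in box N') (cst K%:E x))%E).
  apply: ge0_le_integral => //; first exact: measurable_box.
  - by apply/measurable_EFinP; apply: measurableT_comp => //; apply: measurable_funS mg.
  - by move=> v _; rewrite lee_fin; exact: gK.
rewrite integral_cst; last exact: measurable_box.
by rewrite [X in (_ * X)%E](lebesgue3_box N0) -EFinM ltry.
Qed.

Lemma integrable_boxed_cont N (g : R3 R -> R) : continuous g ->
  boxed N g -> lebesgue3.-integrable setT (EFin \o g).
Proof.
move=> cg bg; have [K _ gK] := boxed_bounded cg bg.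
by apply: integrable_boxed bg gK; exact: continuous_measurable3.
Qed.

End Boxed.

(** * Fundamental theorem of calculus and integration by parts *)

Section FTC.
Context {R : realType}.
Local Notation leb := (@lebesgue_measure R).

Lemma ftc_is_derive (F F' : R -> R) a b : a < b ->
  (forall x : R, is_derive x (1 : R) F (F' x)) -> continuous F' ->
  (\int[leb]_(x in `[a, b]) (F' x)%:E = (F b)%:E - (F a)%:E)%E.
Proof.
move=> ab dF cF'.
have cF : continuous F.
  move=> x; apply: differentiable_continuous; apply/derivable1_diffP.
  by have [] := dF x.
apply: continuous_FTC2 => //.
- exact: continuous_subspaceT.
- split; last 2 first.
  + by apply: cvg_at_right_filter; exact: cF.
  + by apply: cvg_at_left_filter; exact: cF.
  by move=> x _; have [] := dF x.
- by move=> x _; rewrite derive1E derive_val.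
Qed.

Variables (F F' : R -> R) (N : R).
Hypotheses (dF : forall x : R, is_derive x (1 : R) F (F' x)) (cF' : continuous F').
Hypothesis (F0 : forall x, N < `|x| -> F x = 0).

Let F'0 x : N < `|x| -> F' x = 0.
Proof.
move=> Nx; have [_ <-] := dF x.
rewrite (@near_eq_derive _ _ _ _ (cst 0)) ?derive_cst//.
near=> w; apply: F0; near: w.
by have /cvgr_gt := @norm_continuous _ _ x; apply.
Unshelve. all: by end_near. Qed.

Let restrictE (G : R -> R) a : N < a -> (forall x, N < `|x| -> G x = 0) ->
  (\int[leb]_x (G x)%:E = \int[leb]_(x in `[(- a)%R, a]) (G x)%:E)%E.
Proof.
move=> Na G0; rewrite [RHS]integral_mkcond; apply: eq_integral => x _.
rewrite patchE; case: ifPn => // /negP xa; rewrite G0//.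
apply: (lt_le_trans Na); rewrite leNgt; apply/negP => h; apply: xa.
by apply/mem_set; rewrite /= in_itv/= -ler_norml ltW.
Qed.

Lemma integral_derive_boxed : (\int[leb]_x (F' x)%:E = 0)%E.
Proof.
(* Strictly beyond [N] and positive whatever the sign of [N], so that [F] vanishes at both ends of
   the interval. *)
pose a := `|N| + 1; have Na : N < a by rewrite /a (le_lt_trans (ler_norm _))// ltrDl.
have a0 : 0 < a by rewrite /a ltr_wpDl.
rewrite (restrictE Na)// ftc_is_derive//; last by lra.
by rewrite !F0 ?subee// ?normrN gtr0_norm.
Qed.

(** The one-dimensional input of Loomis-Whitney: a function is bounded by the integral of its
    derivative along any one of the three families of curves. *)
Lemma le_integral_derive_boxed y : ((F y)%:E <= \int[leb]_x `|F' x|%:E)%E.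
Proof.
have [yN|yN] := ltP N `|y|; first by rewrite F0//; exact: integral_ge0.
pose a := `|N| + 1; have Na : N < a by rewrite /a (le_lt_trans (ler_norm _))// ltrDl.
have ay : - a < y.
  by rewrite ltrNl (le_lt_trans _ Na)// (le_trans _ yN)// -normrN ler_norm.
have -> : ((F y)%:E = \int[leb]_(x in `[(- a)%R, y]) (F' x)%:E)%E.
  rewrite ftc_is_derive// [F (- a)]F0 ?sube0// normrN gtr0_norm//.
  by rewrite /a ltr_wpDl.
have mF' : measurable_fun [set: M1 R] F' by exact: continuous_measurable_fun.
apply: (le_trans (lee_abs _)).
apply: (le_trans (le_abse_integral _ _ _)) => //.
  by apply/measurable_EFinP; exact: measurable_funS mF'.
apply: ge0_subset_integral => //.
by apply/measurable_EFinP; exact: measurableT_comp.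
Qed.

End FTC.

Section IntegrationByParts.
Context {R : realType}.
Local Notation leb := (@lebesgue_measure R).
Implicit Types (g : R3 R -> R) (dg : 'I_3 -> R3 R -> R).

Lemma continuous_triple {T : topologicalType} (x y z : T -> R) :
  continuous x -> continuous y -> continuous z ->
  continuous (fun t => (x t, y t, z t)).
Proof. by move=> cx cy cz t; exact: (cvg_pair (cvg_pair (cx t) (cy t)) (cz t)). Qed.

Definition ordC (i : 'I_3) : 'I_3 := tnth [tuple j1; j2; j0] i.

Lemma coord3_cyc v i : coord3 (cyc v : R3 R) (ordC i) = coord3 v i.
Proof. by elim/ord3_ind: i. Qed.

Lemma cyc_basis i : cyc (basis3 i : R3 R) = basis3 (ordC i).
Proof. by elim/ord3_ind: i. Qed.

Lemma differentiable_cyc v : differentiable (cyc : R3 R -> R3 R) v.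
Proof.
apply: differentiable_pair; [apply: differentiable_pair|].
- exact: (differentiable_coord3 j2).
- exact: (differentiable_coord3 j0).
- exact: (differentiable_coord3 j1).
Qed.

Lemma hasgrad_cyc g dg : hasgrad g dg ->
  hasgrad (g \o cyc) (fun i v => dg (ordC i) (cyc v)).
Proof.
move=> [g1 g2 g3]; split=> [v|i v|i].
- by apply: differentiable_comp => //; exact: differentiable_cyc.
- rewrite -g2 /partial -cyc_basis /derive.
  by congr (lim (_ @ _)); apply/funext.
- move=> v; apply: (@continuous_comp _ _ _ cyc (dg (ordC i))).
    by apply: differentiable_continuous; exact: differentiable_cyc.
  exact: g3.
Qed.

Lemma boxed_cyc N g : boxed N g -> boxed N (g \o cyc).
Proof. by move=> bg v i h; apply: (bg _ (ordC i)); rewrite coord3_cyc. Qed.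

Lemma integral_cyc (F : M3 R -> \bar R) : measurable_fun [set: M3 R] F ->
  (\int[lebesgue3]_v F (cyc v) = \int[lebesgue3]_v F v)%E.
Proof.
move=> mF; rewrite integralE [RHS]integralE; congr (_ - _)%E.
- rewrite -[RHS](lebesgue3_cyc (measurable_funepos mF) (funepos_ge0 F)).
  by apply: eq_integral => v _; rewrite !funeposE.
- rewrite -[RHS](lebesgue3_cyc (measurable_funeneg mF) (funeneg_ge0 F)).
  by apply: eq_integral => v _; rewrite !funenegE.
Qed.

Lemma integral_partial_boxed N g dg i : hasgrad g dg -> boxed N g ->
  (\int[lebesgue3]_v (dg i v)%:E = 0)%E.
Proof.
(* The last coordinate is innermost in the product measure, so Fubini reduces this case to one
   dimension; the other two coordinates are rotated into it. *)
have base g' dg' : hasgrad g' dg' -> boxed N g' ->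
    (\int[lebesgue3]_v (dg' j2 v)%:E = 0)%E.
  move=> hg bg.
  transitivity (\int[@lebesgue2 R \x leb]_v (EFin \o dg' j2) v)%E => //.
  rewrite -integral12_prod_meas1; last first.
    apply: integrable_boxed_cont; first by case: hg.
    exact: hasgrad_boxed hg bg.
  rewrite integral0_eq// => -[x y] _.
  apply: (@integral_derive_boxed _ (fun z => g' (x, y, z)) _ N).
  - move=> z.
    have := hasgrad_curve hg (is_derive_cst x z 1) (is_derive_cst y z 1) (is_derive_id z (1 : R)).
    by rewrite !mul0r !add0r mul1r.
  - move=> z; apply: (@continuous_comp _ _ _ (fun z => (x, y, z)) (dg' j2)); last by case: hg => _ _; apply.
    by apply: continuous_triple; [exact: cst_continuous|exact: cst_continuous|move=> ?; exact: cvg_id].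
  - by move=> z Nz; apply: (bg _ j2).
move=> hg bg; elim/ord3_ind: i.
- rewrite -integral_cyc; last first.
    by apply/measurable_EFinP; apply: continuous_measurable3; case: hg.
  exact: (base _ _ (hasgrad_cyc hg) (boxed_cyc bg)).
- rewrite -integral_cyc; last first.
    by apply/measurable_EFinP; apply: continuous_measurable3; case: hg.
  rewrite -(@integral_cyc (fun v => (dg j1 (cyc v))%:E)); last first.
    apply/measurable_EFinP; apply: continuous_measurable3.
    by case: (hasgrad_cyc hg) => _ _ /(_ j0).
  exact: (base _ _ (hasgrad_cyc (hasgrad_cyc hg)) (boxed_cyc (boxed_cyc bg))).
- exact: base hg bg.
Qed.

Lemma integration_by_parts_boxed N g dg p dp i : hasgrad g dg -> hasgrad p dp ->
  boxed N p ->
  \int[lebesgue3]_v (p v * dg i v) = - \int[lebesgue3]_v (dp i v * g v).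
Proof.
move=> hg hp bp.
have bpg : boxed N (fun v => p v * g v) by move=> v k /bp ->; rewrite mul0r.
have := integral_partial_boxed i (hasgradM hp hg) bpg.
have bdp := hasgrad_boxed i hp bp.
have cp := hasgrad_cont hp; have cg := hasgrad_cont hg.
have I1 : lebesgue3.-integrable setT (EFin \o (fun v => p v * dg i v)).
  apply: (@integrable_boxed_cont _ N); last by move=> v k /bp ->; rewrite mul0r.
  by move=> v; apply: cvgM; [exact: cp|case: hg => _ _; apply].
have I2 : lebesgue3.-integrable setT (EFin \o (fun v => dp i v * g v)).
  apply: (@integrable_boxed_cont _ N); last by move=> v k /bdp ->; rewrite mul0r.
  by move=> v; apply: cvgM; [case: hp => _ _; apply|exact: cg].
under eq_integral do rewrite EFinD.
rewrite integralD// => h.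
apply/eqP; rewrite -addr_eq0 addrC /Rintegral -fineD.
- by rewrite h.
- exact: integrable_fin_num.
- exact: integrable_fin_num.
Qed.
End IntegrationByParts.

(** * A Loomis-Whitney inequality along circles *)

Section IteratedIntegrals.
Context {R : realType}.
Local Notation leb := (@lebesgue_measure R).
Local Open Scope ereal_scope.
Variable F : M3 R -> \bar R.
Hypotheses (mF : measurable_fun [set: M3 R] F) (F0 : forall v, 0 <= F v).

Lemma lebesgue3_tonelli_yzx :
  \int[lebesgue3]_v F v = \int[leb]_y \int[leb]_z \int[leb]_x F (x, y, z).
Proof.
rewrite -lebesgue3_cyc// (@lebesgue3_tonelli _ (F \o cyc))//; last by move=> v /=.
by apply: measurableT_comp => //; exact: measurable_cyc.
Qed.

Lemma lebesgue3_tonelli_zyx :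
  \int[lebesgue3]_v F v = \int[leb]_z \int[leb]_y \int[leb]_x F (x, y, z).
Proof.
rewrite (lebesgue3_tonelliC mF F0); apply: eq_integral => z _.
rewrite (@fubini_tonelli _ _ _ _ _ leb leb (fun p => F (p, z)))//.
exact: measurableT_comp.
Qed.
End IteratedIntegrals.

Section SphericalSubstitution.
Context {R : realType}.
Local Notation leb := (@lebesgue_measure R).

(** The substitution [s = (x + 1)^2 + c]. As [k] vanishes below -1/2, only the increasing branch
    matters. Where [s < c], [Num.sqrt] returns 0, the argument of [k] is -1, and the integrand is 0
    as it should be. *)
Lemma integral_sqrt_subst (k : R -> R) (N c : R) : 0 <= N ->
  continuous k -> (forall x, x < - 2^-1 -> k x = 0) -> (forall x, N < x -> k x = 0) ->
  (\int[leb]_s (k (Num.sqrt (s - c) - 1))%:E =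
   \int[leb]_x (k x * (2 * (x + 1)))%:E)%E.
Proof.
move=> N0 ck k0 kN.
pose f (x : R) : R := (x + 1) ^+ 2 + c.
pose G (s : R) : R := k (Num.sqrt (s - c) - 1).
have cG : continuous G.
  move=> s; apply: (@continuous_comp _ _ _ (fun s => Num.sqrt (s - c) - 1) k); last exact: ck.
  apply: cvgB; last exact: cvg_cst.
  apply: (@continuous_comp _ _ _ (fun s => s - c) Num.sqrt); last exact: sqrt_continuous.
  by apply: cvgB; [exact: cvg_id|exact: cvg_cst].
have df (x : R) : is_derive x (1 : R) f (2 * (x + 1)).
  apply: is_derive_eq.
  by rewrite /GRing.scale/=; ring.
have f'E : f^`()%classic = (fun x => 2 * (x + 1)).
  by apply/funext => x; rewrite derive1E derive_val.
have cf' : continuous (fun x : R => 2 * (x + 1)).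
  by move=> x; apply: cvgM; [exact: cvg_cst|apply: cvgD; [exact: cvg_id|exact: cvg_cst]].
have cf : continuous f.
  move=> x; apply: differentiable_continuous; apply/derivable1_diffP.
  by have [] := df x.
(* On this interval [x + 1 >= 1/2], so [f] is strictly increasing; outside it, and outside its
   image, both integrands vanish. *)
pose a : R := - 2^-1; pose b : R := N + 1.
have ab : a <= b by rewrite /a /b; lra.
have incf : {in `[a, b] &, {homo f : x y / x < y}}.
  move=> x y; rewrite !in_itv/= /a /b /f => /andP[x1 _] /andP[y1 _] xy.
  by rewrite ltrD2r ltrXn2r ?nnegrE//; lra.
have := @integration_by_substitution_increasing R f G a b ab incf.
rewrite f'E => /(_ _ _ _ _ _) H.
have {}H := H (fun x _ => cf' x) (cvgP _ (cvg_at_right_filter (cf' a)))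
  (cvgP _ (cvg_at_left_filter (cf' b))).
transitivity (\int[leb]_(s in `[f a, f b]) (G s)%:E)%E.
  rewrite [RHS]integral_mkcond; apply: eq_integral => s _.
  rewrite patchE; case: ifPn => // /negP sab.
  have [sa|sa] := ltP s (f a).
    rewrite /G k0// ltrBlDr (_ : - 2^-1 + 1 = Num.sqrt (2^-1 ^+ 2)); last first.
      by rewrite sqrtr_sqr ger0_norm; lra.
    by rewrite ltr_sqrt; [move: sa; rewrite /f /a => sa; lra|lra].
  rewrite /G kN// ltrBrDr.
  have sb : f b < s.
    by rewrite ltNge; apply/negP => sb; apply: sab; apply/mem_set; rewrite /= in_itv/= sa.
  rewrite (lt_trans (_ : N + 1 < N + 1 + 1)) ?ltrDl//.
  rewrite -[N + 1 + 1]ger0_norm -?sqrtr_sqr; last by lra.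
  rewrite ltr_sqrt; first by move: sb; rewrite /f /b => sb; lra.
  have -> : s - c = (s - f b) + (b + 1) ^+ 2 by rewrite /f; ring.
  by rewrite ltr_wpDr ?sqr_ge0// subr_gt0.
rewrite H; last 2 first.
- split; [by move=> x _; have [] := df x| | ].
  + by apply: cvg_at_right_filter; exact: cf.
  + by apply: cvg_at_left_filter; exact: cf.
- exact: continuous_subspaceT.
rewrite integral_mkcond; apply: eq_integral => x _.
rewrite patchE; case: ifPn => [|/negP xab].
  rewrite inE/= in_itv/= => /andP[xa xb].
  have -> : ((G \o f) * (fun x : R => 2 * (x + 1))) x = G (f x) * (2 * (x + 1)) by [].
  rewrite /G /f addrK sqrtr_sqr ger0_norm ?addrK//.
  by move: xa; rewrite /a; lra.
have [xa|xa] := ltP x a; first by rewrite k0 ?mul0r.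
rewrite kN ?mul0r//.
have xb : b < x.
  by rewrite ltNge; apply/negP => xb; apply: xab; apply/mem_set; rewrite /= in_itv/= xa.
by move: xb; rewrite /b; lra.
Qed.

(* Inverts (x, y, z) |-> ((x + 1)^2 + y^2 + z^2, y, z): in these coordinates the
   curves along which one of them varies are lines and arcs of circles about (-1, 0, 0). *)
Definition sph (v : R3 R) : R3 R :=
  (Num.sqrt (v.1.1 - (v.1.2 ^+ 2 + v.2 ^+ 2)) - 1, v.1.2, v.2).

Lemma sph_continuous : continuous sph.
Proof.
have c1 : continuous (fun v : R3 R => v.1.1) := @coord3_continuous R j0.
have c2 : continuous (fun v : R3 R => v.1.2) := @coord3_continuous R j1.
have c3 : continuous (fun v : R3 R => v.2) := @coord3_continuous R j2.
apply: continuous_triple => // v.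
apply: cvgB; last exact: cvg_cst.
apply: (@continuous_comp _ _ _ (fun v : R3 R => v.1.1 - (v.1.2 ^+ 2 + v.2 ^+ 2)) Num.sqrt).
  by apply: cvgB; [exact: c1|apply: cvgD; apply: cvgM; [exact: c2|exact: c2|exact: c3|exact: c3]].
exact: sqrt_continuous.
Qed.

Lemma integral_sph (k : R3 R -> R) (N : R) y z : continuous k -> boxed N k ->
  (forall v, v.1.1 < - 2^-1 -> k v = 0) ->
  (\int[leb]_s (k (sph (s, y, z)))%:E =
   \int[leb]_x (k (x, y, z) * (2 * (x + 1)))%:E)%E.
Proof.
move=> ck bk k0.
apply: (@integral_sqrt_subst (fun x => k (x, y, z)) (Num.max N 0) (y ^+ 2 + z ^+ 2)).
- by rewrite le_max lexx orbT.
- move=> x; apply: (@continuous_comp _ _ _ (fun x => (x, y, z)) k); last exact: ck.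
  by apply: continuous_triple; [move=> ?; exact: cvg_id|exact: cst_continuous|exact: cst_continuous].
- by move=> x x0; exact: k0.
- move=> x; rewrite gt_max => /andP[xN x0]; apply: (bk _ j0).
  by rewrite /coord3/= gtr0_norm.
Qed.

End SphericalSubstitution.

(** The outer Cauchy-Schwarz step of Loomis-Whitney, in (y, z): the second factor of the majorant is
    a product of a function of y and one of z, so its integral factors. *)
Lemma integral_cs_product {R : realType} (a H : M2 R -> \bar R) (beta gamma : M1 R -> \bar R)
    (A B G T : \bar R) :
  measurable_fun [set: M2 R] a -> measurable_fun [set: M2 R] H ->
  measurable_fun [set: M1 R] beta -> measurable_fun [set: M1 R] gamma ->
  (forall p, 0 <= a p)%E -> (forall p, 0 <= H p)%E ->
  (forall z, 0 <= beta z)%E -> (forall y, 0 <= gamma y)%E ->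
  (forall p, H p * H p <= a p * (gamma p.1 * beta p.2))%E ->
  (\int[lebesgue2]_p a p = A)%E -> (\int[lebesgue2]_p H p = T)%E ->
  (\int[@lebesgue_measure R]_y gamma y = G)%E ->
  (\int[@lebesgue_measure R]_z beta z = B)%E ->
  (T * T <= A * (G * B))%E.
Proof.
move=> ma mH mb mg a0 H0 b0 g0 hH <- <- <- <-.
have mbg : measurable_fun [set: M2 R] (fun p : M2 R => gamma p.1 * beta p.2)%E.
  apply: emeasurable_funM.
    exact: (measurableT_comp mg measurable_fst).
  exact: (measurableT_comp mb measurable_snd).
have bg0 p : (0 <= gamma p.1 * beta p.2)%E by rewrite mule_ge0.
rewrite (le_trans (ge0_integral_cs _ ma mbg mH _ _ _ hH))//.
rewrite le_eqVlt; apply/orP; left; apply/eqP; congr (_ * _)%E.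
rewrite (@fubini_tonelli1 _ _ (M1 R) (M1 R) R (@lebesgue_measure R) (@lebesgue_measure R)
  (fun p => gamma p.1 * beta p.2)%E)//.
rewrite -ge0_integralZr ?integral_ge0//.
apply: eq_integral => y _.
exact: (ge0_integralZl _ measurableT mb (fun z _ => b0 z) (g0 y)).
Qed.

Section LoomisWhitney.
Context {R : realType}.
Local Notation leb := (@lebesgue_measure R).
Variables (N : R) (F : R3 R -> R) (dF : 'I_3 -> R3 R -> R).
Hypotheses (hF : hasgrad F dF) (bF : boxed N F) (F_ge0 : forall v, 0 <= F v).
Hypothesis (F0 : forall v, v.1.1 < - 2^-1 -> F v = 0).

(* Rotational derivatives about (-1, 0, 0), a centre outside the support of [F] by [F0]. *)
Definition rot2 (D : 'I_3 -> R3 R -> R) (v : R3 R) : R := (v.1.1 + 1) * D j1 v - v.1.2 * D j0 v.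
Definition rot3 (D : 'I_3 -> R3 R -> R) (v : R3 R) : R := (v.1.1 + 1) * D j2 v - v.2 * D j0 v.

Let X1 : continuous (fun v : R3 R => v.1.1) := @coord3_continuous R j0.
Let X2 : continuous (fun v : R3 R => v.1.2) := @coord3_continuous R j1.
Let X3 : continuous (fun v : R3 R => v.2) := @coord3_continuous R j2.

Let dF0 i v : v.1.1 < - 2^-1 -> dF i v = 0.
Proof.
move=> v0; have [_ <- _] := hF; rewrite /partial.
rewrite (@near_eq_derive _ _ _ _ (cst 0)) ?derive_cst//.
near=> w; apply: F0; near: w.
by have := X1; move=> /(_ v)/cvgr_lt; apply.
Unshelve. all: by end_near. Qed.

Let bdF i : boxed N (dF i). Proof. exact: hasgrad_boxed hF bF. Qed.
Let cdF i : continuous (dF i). Proof. by case: hF => _ _; apply. Qed.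

(** Equal to [v.1.1 + 1] wherever [F] is nonzero, yet bounded below everywhere, so that quotients by
    it are continuous on the whole space. *)
Let den (v : R3 R) : R := Num.max (v.1.1 + 1) 2^-1.

Let den_gt0 v : 0 < den v. Proof. by rewrite lt_max; apply/orP; right; lra. Qed.

Let denE v : - 2^-1 <= v.1.1 -> den v = v.1.1 + 1.
Proof. by move=> h; rewrite /den max_l//; lra. Qed.

Let cden : continuous den.
Proof.
move=> v; apply: (@continuous_max _ _ (fun v : R3 R => v.1.1 + 1) (cst 2^-1)).
  by apply: cvgD; [exact: X1|exact: cvg_cst].
exact: cvg_cst.
Qed.

(** Derivative of [F \o sph] in y at fixed (s, z): along such an arc dx/dy = - y / (x + 1), and
    [rot2] is what remains after clearing the denominator. [D3] is its analogue in z. *)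
Let D2 v := rot2 dF v / den v.
Let D3 v := rot3 dF v / den v.

Let cX11 : continuous (fun v : R3 R => v.1.1 + 1).
Proof. by move=> v; apply: cvgD; [exact: X1|exact: cvg_cst]. Qed.

Let crot2 : continuous (rot2 dF).
Proof.
by move=> v; apply: cvgB; apply: cvgM; [exact: cX11|exact: cdF|exact: X2|exact: cdF].
Qed.

Let crot3 : continuous (rot3 dF).
Proof.
by move=> v; apply: cvgB; apply: cvgM; [exact: cX11|exact: cdF|exact: X3|exact: cdF].
Qed.

Let cD (r : R3 R -> R) : continuous r -> continuous (fun v => r v / den v).
Proof.
move=> cr v; apply: cvgM; first exact: cr.
by apply: cvgV; [rewrite gt_eqF|exact: cden].
Qed.

Let mcont (g : R3 R -> R) : continuous g -> measurable_fun [set: M3 R] (fun v : M3 R => `|g v|%:E).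
Proof.
move=> cg; apply/measurable_EFinP; apply: measurableT_comp => //.
exact: continuous_measurable3.
Qed.

Lemma sqrt_curve (c : R) (t : R) : 0 < c - t ^+ 2 ->
  is_derive t (1 : R) (fun u : R => Num.sqrt (c - u ^+ 2) - 1) (- (t / Num.sqrt (c - t ^+ 2))).
Proof.
move=> ct.
have h1 : is_derive t (1 : R) (fun u : R => c - u ^+ 2) (- (2 * t)).
  by apply: is_derive_eq; rewrite /GRing.scale/=; ring.
have h2 : is_derive t (1 : R) (Num.sqrt \o (fun u : R => c - u ^+ 2))
    ((2 * Num.sqrt (c - t ^+ 2))^-1 * - (2 * t)).
  by apply: is_derive1_comp; exact: is_derive1_sqrt.
apply: is_derive_eq; rewrite subr0.
have s0 : Num.sqrt (c - t ^+ 2) != 0 by rewrite gt_eqF// sqrtr_gt0.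
by field.
Qed.

Lemma sqrt_small (a : R) : a < 2^-1 ^+ 2 -> Num.sqrt a - 1 < - 2^-1.
Proof.
move=> a4; rewrite ltrBlDr (_ : - 2^-1 + 1 = Num.sqrt (2^-1 ^+ 2)); last first.
  by rewrite sqrtr_sqr ger0_norm; lra.
by rewrite ltr_sqrt// exprn_gt0//; lra.
Qed.

Let is_derive_sph2 s z (y : R) :
  is_derive y (1 : R) (fun y => F (sph (s, y, z))) (D2 (sph (s, y, z))).
Proof.
(* The threshold is [x + 1 = 1/2]. Below it, negative radicands included, [F \o sph] is locally 0;
   above it the square root is differentiable. *)
have [t0|t0] := ltP (s - (y ^+ 2 + z ^+ 2)) (2^-1 ^+ 2).
  have x0 := sqrt_small t0.
  rewrite /D2 /rot2 !dF0//= !mulr0 subrr mul0r.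
  apply: (@near_eq_is_derive _ _ _ (cst 0)).
  near=> w; rewrite /= F0//= sqrt_small//; near: w.
  have : continuous (fun y : R => s - (y ^+ 2 + z ^+ 2)).
    move=> w; apply: cvgB; first exact: cvg_cst.
    by apply: cvgD; [exact: exprn_continuous|exact: cvg_cst].
  by move=> /(_ y)/cvgr_lt; apply.
have E (w : R) : s - (w ^+ 2 + z ^+ 2) = (s - z ^+ 2) - w ^+ 2 by ring.
have t1 : 0 < (s - z ^+ 2) - y ^+ 2.
  by rewrite -E (lt_le_trans _ t0)// exprn_gt0//; lra.
have := hasgrad_curve hF (sqrt_curve t1) (is_derive_id y (1 : R)) (is_derive_cst z y 1).
have -> : (fun y => F (sph (s, y, z))) = (fun w => F (Num.sqrt (s - z ^+ 2 - w ^+ 2) - 1, w, cst z w)).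
  by apply/funext => w; rewrite /sph/= E.
have -> //: D2 (sph (s, y, z)) =
  - (y / Num.sqrt (s - z ^+ 2 - y ^+ 2)) * dF j0 (Num.sqrt (s - z ^+ 2 - y ^+ 2) - 1, y, cst z y)
  + 1 * dF j1 (Num.sqrt (s - z ^+ 2 - y ^+ 2) - 1, y, cst z y)
  + 0 * dF j2 (Num.sqrt (s - z ^+ 2 - y ^+ 2) - 1, y, cst z y).
rewrite /D2 denE; last first.
  rewrite /= -lerBlDr opprK (_ : - 2^-1 + 1 = Num.sqrt (2^-1 ^+ 2)); last first.
    by rewrite sqrtr_sqr ger0_norm; lra.
  by rewrite ler_sqrt// (le_trans _ t0)// exprn_ge0//; lra.
rewrite /rot2 /sph /= subrK E.
have s0 : Num.sqrt (s - z ^+ 2 - y ^+ 2) != 0 by rewrite gt_eqF// sqrtr_gt0.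
by field.
Unshelve. all: by end_near. Qed.

Let is_derive_sph3 s y (z : R) :
  is_derive z (1 : R) (fun z => F (sph (s, y, z))) (D3 (sph (s, y, z))).
Proof.
have [t0|t0] := ltP (s - (y ^+ 2 + z ^+ 2)) (2^-1 ^+ 2).
  have x0 := sqrt_small t0.
  rewrite /D3 /rot3 !dF0//= !mulr0 subrr mul0r.
  apply: (@near_eq_is_derive _ _ _ (cst 0)).
  near=> w; rewrite /= F0//= sqrt_small//; near: w.
  have : continuous (fun z : R => s - (y ^+ 2 + z ^+ 2)).
    move=> w; apply: cvgB; first exact: cvg_cst.
    by apply: cvgD; [exact: cvg_cst|exact: exprn_continuous].
  by move=> /(_ z)/cvgr_lt; apply.
have E (w : R) : s - (y ^+ 2 + w ^+ 2) = (s - y ^+ 2) - w ^+ 2 by ring.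
have t1 : 0 < (s - y ^+ 2) - z ^+ 2.
  by rewrite -E (lt_le_trans _ t0)// exprn_gt0//; lra.
have := hasgrad_curve hF (sqrt_curve t1) (is_derive_cst y z 1) (is_derive_id z (1 : R)).
have -> : (fun z => F (sph (s, y, z))) = (fun w => F (Num.sqrt (s - y ^+ 2 - w ^+ 2) - 1, cst y w, w)).
  by apply/funext => w; rewrite /sph/= E.
have -> //: D3 (sph (s, y, z)) =
  - (z / Num.sqrt (s - y ^+ 2 - z ^+ 2)) * dF j0 (Num.sqrt (s - y ^+ 2 - z ^+ 2) - 1, cst y z, z)
  + 0 * dF j1 (Num.sqrt (s - y ^+ 2 - z ^+ 2) - 1, cst y z, z)
  + 1 * dF j2 (Num.sqrt (s - y ^+ 2 - z ^+ 2) - 1, cst y z, z).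
rewrite /D3 denE; last first.
  rewrite /= -lerBlDr opprK (_ : - 2^-1 + 1 = Num.sqrt (2^-1 ^+ 2)); last first.
    by rewrite sqrtr_sqr ger0_norm; lra.
  by rewrite ler_sqrt// (le_trans _ t0)// exprn_ge0//; lra.
rewrite /rot3 /sph /= subrK E.
have s0 : Num.sqrt (s - y ^+ 2 - z ^+ 2) != 0 by rewrite gt_eqF// sqrtr_gt0.
by field.
Unshelve. all: by end_near. Qed.

Let csph2 (s z : R) : continuous (fun y : R => (s, y, z)).
Proof. by apply: continuous_triple; [exact: cst_continuous|move=> ?; exact: cvg_id|exact: cst_continuous]. Qed.
Let csph3 (s y : R) : continuous (fun z : R => (s, y, z)).
Proof. by apply: continuous_triple; [exact: cst_continuous|exact: cst_continuous|move=> ?; exact: cvg_id]. Qed.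
Let cline (y z : R) : continuous (fun x : R => (x, y, z)).
Proof. by apply: continuous_triple; [move=> ?; exact: cvg_id|exact: cst_continuous|exact: cst_continuous]. Qed.

Let cDsph (r : R3 R -> R) : continuous r -> continuous (fun v => r (sph v)).
Proof. by move=> cr v; apply: (@continuous_comp _ _ _ sph r); [exact: sph_continuous|exact: cr]. Qed.

Lemma LW_bound1 (x y z : R) : ((F (x, y, z))%:E <= \int[leb]_x `|dF j0 (x, y, z)|%:E)%E.
Proof.
apply: (@le_integral_derive_boxed _ (fun x => F (x, y, z)) _ N).
- move=> t.
  have := hasgrad_curve hF (is_derive_id t (1 : R)) (is_derive_cst y t 1) (is_derive_cst z t 1).
  by rewrite !mul0r !addr0 mul1r.
- move=> t; apply: (@continuous_comp _ _ _ (fun x => (x, y, z)) (dF j0)); [exact: cline|exact: cdF].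
- by move=> t; exact: (bF (v := (t, y, z)) (i := j0)).
Qed.

Lemma LW_bound2 (s y z : R) : ((F (sph (s, y, z)))%:E <= \int[leb]_y `|D2 (sph (s, y, z))|%:E)%E.
Proof.
apply: (@le_integral_derive_boxed _ (fun y => F (sph (s, y, z))) _ N).
- exact: is_derive_sph2.
- move=> t; apply: (@continuous_comp _ _ _ (fun y => (s, y, z)) (fun v => D2 (sph v))); [exact: csph2|].
  by apply: cDsph; exact: cD.
- by move=> t Nt; apply: (bF (i := j1)).
Qed.

Lemma LW_bound3 (s y z : R) : ((F (sph (s, y, z)))%:E <= \int[leb]_z `|D3 (sph (s, y, z))|%:E)%E.
Proof.
apply: (@le_integral_derive_boxed _ (fun z => F (sph (s, y, z))) _ N).
- exact: is_derive_sph3.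
- move=> t; apply: (@continuous_comp _ _ _ (fun z => (s, y, z)) (fun v => D3 (sph v))); [exact: csph3|].
  by apply: cDsph; exact: cD.
- by move=> t Nt; apply: (bF (i := j2)).
Qed.

Variable h : R3 R -> R.
Hypotheses (ch : continuous h) (h_ge0 : forall v, 0 <= h v).
Hypothesis (hF3 : forall v, h v * h v <= F v * (F v * F v)).

Let h0 v : F v = 0 -> h v = 0.
Proof.
move=> Fv; have := hF3 v; rewrite Fv !mul0r => hh.
by apply/eqP; rewrite -sqrf_eq0 expr2 eq_le hh mulr_ge0.
Qed.

Let bh : boxed N h. Proof. by move=> v i Nv; apply: h0; exact: bF Nv. Qed.
Let h00 v : v.1.1 < - 2^-1 -> h v = 0. Proof. by move=> v0; apply: h0; exact: F0. Qed.

Local Open Scope ereal_scope.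

(* [a], [b], [c] dominate [F \o sph] and depend only on (y, z), (s, z), (s, y). *)
Let a (p : M2 R) : \bar R := \int[leb]_x `|dF j0 (x, p.1, p.2)|%:E.
Let b (p : M2 R) : \bar R := \int[leb]_y `|D2 (sph (p.1, y, p.2))|%:E.
Let c (p : M2 R) : \bar R := \int[leb]_z `|D3 (sph (p.1, p.2, z))|%:E.
Let beta (z : M1 R) : \bar R := \int[leb]_s b (s, z).
Let gamma (y : M1 R) : \bar R := \int[leb]_s c (s, y).

Let cD2 : continuous (fun v => D2 (sph v)). Proof. by apply: cDsph; exact: cD. Qed.
Let cD3 : continuous (fun v => D3 (sph v)). Proof. by apply: cDsph; exact: cD. Qed.

Let mtriple (k : R3 R -> R) (f : R3 R -> R3 R) : continuous k -> continuous f ->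
  measurable_fun [set: M3 R] (fun v : M3 R => `|k (f v)|%:E).
Proof.
move=> ck cf; apply: (mcont (g := fun v => k (f v))) => v.
by apply: (@continuous_comp _ _ _ f k); [exact: cf|exact: ck].
Qed.

Let ma : measurable_fun [set: M2 R] a.
Proof.
apply: (@measurable_fun_fubini_tonelli_F _ _ (M2 R) (M1 R) R leb
  (fun v : M3 R => `|dF j0 (v.2, v.1.1, v.1.2)|%:E)) => //.
by apply: mtriple; [exact: cdF|exact: (continuous_triple X3 X1 X2)].
Qed.

Let mb : measurable_fun [set: M2 R] b.
Proof.
apply: (@measurable_fun_fubini_tonelli_F _ _ (M2 R) (M1 R) R leb
  (fun v : M3 R => `|D2 (sph (v.1.1, v.2, v.1.2))|%:E)) => //.
by apply: (mtriple (k := fun v => D2 (sph v))); [exact: cD2|exact: (continuous_triple X1 X3 X2)].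
Qed.

Let mc : measurable_fun [set: M2 R] c.
Proof.
apply: (@measurable_fun_fubini_tonelli_F _ _ (M2 R) (M1 R) R leb
  (fun v : M3 R => `|D3 (sph (v.1.1, v.1.2, v.2))|%:E)) => //.
by apply: (mtriple (k := fun v => D3 (sph v))); [exact: cD3|exact: (continuous_triple X1 X2 X3)].
Qed.

Let a0 p : 0 <= a p. Proof. exact: integral_ge0. Qed.
Let b0 p : 0 <= b p. Proof. exact: integral_ge0. Qed.
Let c0 p : 0 <= c p. Proof. exact: integral_ge0. Qed.
Let beta0 z : 0 <= beta z. Proof. exact: integral_ge0. Qed.
Let gamma0 y : 0 <= gamma y. Proof. exact: integral_ge0. Qed.

Let mbeta : measurable_fun [set: M1 R] beta.
Proof. exact: (@measurable_fun_fubini_tonelli_G _ _ (M1 R) (M1 R) R leb b). Qed.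

Let mgamma : measurable_fun [set: M1 R] gamma.
Proof. exact: (@measurable_fun_fubini_tonelli_G _ _ (M1 R) (M1 R) R leb c). Qed.

Let H (p : M2 R) : \bar R := \int[leb]_s (h (sph (s, p.1, p.2)))%:E.

Let mh : measurable_fun [set: M3 R] (fun v : M3 R => (h (sph v))%:E).
Proof. by apply/measurable_EFinP; apply: continuous_measurable3; exact: cDsph. Qed.

Let mH : measurable_fun [set: M2 R] H.
Proof.
apply: (@measurable_fun_fubini_tonelli_F _ _ (M2 R) (M1 R) R leb
  (fun v : M3 R => (h (sph (v.2, v.1.1, v.1.2)))%:E)) => //.
  apply/measurable_EFinP; apply: continuous_measurable3 => v.
  apply: (@continuous_comp _ _ _ (fun v : R3 R => (v.2, v.1.1, v.1.2)) (fun v => h (sph v))).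
    exact: (continuous_triple X3 X1 X2).
  exact: cDsph.
by move=> v; rewrite lee_fin.
Qed.

Let H0 p : 0 <= H p. Proof. by apply: integral_ge0 => s _; rewrite lee_fin. Qed.

(** The inner Cauchy-Schwarz step, in s at fixed (y, z). Each of [a], [b], [c] bounds [F \o sph], so
    the square of [h \o sph] is at most their product; [a] does not depend on s and leaves the
    integral. *)
Let le_H p : H p * H p <= a p * (gamma p.1 * beta p.2).
Proof.
have meas1 (k : R3 R -> R) : continuous k ->
    measurable_fun [set: M1 R] (fun s : M1 R => (k (s, p.1, p.2))%:E).
  move=> ck; apply/measurable_EFinP; apply: continuous_measurable_fun => s.
  apply: (@continuous_comp _ _ _ (fun s => (s, p.1, p.2)) k); [exact: cline|exact: ck].
have mb' : measurable_fun [set: M1 R] (fun s : M1 R => b (s, p.2)).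
  by apply: measurableT_comp => //; exact: pair2_measurable.
have mc' : measurable_fun [set: M1 R] (fun s : M1 R => c (s, p.1)).
  by apply: measurableT_comp => //; exact: pair2_measurable.
have -> : a p * (gamma p.1 * beta p.2) =
    (\int[leb]_s (a p * c (s, p.1))) * \int[leb]_s b (s, p.2).
  by rewrite ge0_integralZl// muleA.
apply: ge0_integral_cs => //.
- exact: emeasurable_funM.
- by apply: (meas1 (fun v => h (sph v))); exact: cDsph.
- by move=> s; rewrite mule_ge0.
- by move=> s; rewrite lee_fin.
- move=> s; rewrite -EFinM (le_trans (_ : _ <= (F (sph (s, p.1, p.2)) *
      (F (sph (s, p.1, p.2)) * F (sph (s, p.1, p.2))))%:E)) ?lee_fin//.
  rewrite /= !EFinM -muleA lee_pmul ?lee_fin// ?mulr_ge0//.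
    exact: LW_bound1.
  rewrite lee_pmul ?lee_fin//.
  + exact: LW_bound3.
  + exact: LW_bound2.
Qed.

Let D2E v : (`|D2 v| * (2 * (v.1.1 + 1)) = 2 * `|rot2 dF v|)%R.
Proof.
have [v0|v0] := ltP v.1.1 (- 2^-1)%R.
  by rewrite /D2 /rot2 !dF0// !mulr0 subrr mul0r normr0 mul0r mulr0.
rewrite /D2 normrM normfV (gtr0_norm (den_gt0 v)) denE//.
by field; lra.
Qed.

Let D3E v : (`|D3 v| * (2 * (v.1.1 + 1)) = 2 * `|rot3 dF v|)%R.
Proof.
have [v0|v0] := ltP v.1.1 (- 2^-1)%R.
  by rewrite /D3 /rot3 !dF0// !mulr0 subrr mul0r normr0 mul0r mulr0.
rewrite /D3 normrM normfV (gtr0_norm (den_gt0 v)) denE//.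
by field; lra.
Qed.

Let cnorm (k : R3 R -> R) : continuous k -> continuous (fun v => `|k v|%R).
Proof.
by move=> ck v; apply: (@continuous_comp _ _ _ k Num.norm); [exact: ck|exact: norm_continuous].
Qed.

Let int_beta : \int[leb]_z beta z = 2%:E * \int[lebesgue3]_v `|rot2 dF v|%:E.
Proof.
rewrite -ge0_integralZl//; last exact: mcont.
rewrite (@lebesgue3_tonelli_zyx _ (fun v => 2%:E * `|rot2 dF v|%:E)); last 2 first.
- by apply: emeasurable_funM => //; exact: mcont.
- by move=> v; rewrite mule_ge0.
apply: eq_integral => z _.
rewrite /beta /b (@fubini_tonelli _ _ (M1 R) (M1 R) R leb leb
  (fun q => `|D2 (sph (q.1, q.2, z))|%:E))//; last first.
  apply: (@measurableT_comp _ _ _ _ _ _ (fun v : M3 R => `|D2 (sph v)|%:E) setT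
    (fun q : M2 R => (q, z))); first exact: mcont.
  exact: pair2_measurable.
apply: eq_integral => y _ /=.
rewrite (@integral_sph _ (fun v => `|D2 v|%R) N).
- by apply: eq_integral => x _; rewrite -EFinM -[in RHS]D2E.
- by apply: cnorm; exact: cD.
- by move=> v i Nv; rewrite /D2 /rot2 !(bdF _ Nv) !mulr0 subrr mul0r normr0.
- by move=> v v0; rewrite /D2 /rot2 !dF0// !mulr0 subrr mul0r normr0.
Qed.

Let int_gamma : \int[leb]_y gamma y = 2%:E * \int[lebesgue3]_v `|rot3 dF v|%:E.
Proof.
rewrite -ge0_integralZl//; last exact: mcont.
rewrite (@lebesgue3_tonelli_yzx _ (fun v => 2%:E * `|rot3 dF v|%:E)); last 2 first.
- by apply: emeasurable_funM => //; exact: mcont.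
- by move=> v; rewrite mule_ge0.
apply: eq_integral => y _.
rewrite /gamma /c (@fubini_tonelli _ _ (M1 R) (M1 R) R leb leb
  (fun q => `|D3 (sph (q.1, y, q.2))|%:E))//; last first.
  apply: (@measurableT_comp _ _ _ _ _ _ (fun v : M3 R => `|D3 (sph v)|%:E) setT
    (fun q : M2 R => (q.1, y, q.2))); first exact: mcont.
  by apply: measurable_fun_pair => //; apply: measurable_fun_pair.
apply: eq_integral => z _ /=.
rewrite (@integral_sph _ (fun v => `|D3 v|%R) N).
- by apply: eq_integral => x _; rewrite -EFinM -[in RHS]D3E.
- by apply: cnorm; exact: cD.
- by move=> v i Nv; rewrite /D3 /rot3 !(bdF _ Nv) !mulr0 subrr mul0r normr0.
- by move=> v v0; rewrite /D3 /rot3 !dF0// !mulr0 subrr mul0r normr0.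
Qed.

Let pairwise_yz (G : M2 R -> \bar R) : measurable_fun [set: M2 R] G -> (forall p, 0 <= G p) ->
  \int[lebesgue2]_p G p = \int[leb]_y \int[leb]_z G (y, z).
Proof. by move=> mG G0; exact: (@fubini_tonelli1 _ _ _ _ _ leb leb G). Qed.

Let int_a : \int[lebesgue2]_p a p = \int[lebesgue3]_v `|dF j0 v|%:E.
Proof.
rewrite pairwise_yz// (@lebesgue3_tonelli_yzx _ (fun v => `|dF j0 v|%:E))//.
exact: mcont.
Qed.

Let int_H : \int[lebesgue2]_p H p = 2%:E * \int[lebesgue3]_v (h v * (v.1.1 + 1))%:E.
Proof.
have h1 v : (0 <= h v * (v.1.1 + 1))%R.
  have [v0|v0] := ltP v.1.1 (- 2^-1)%R; first by rewrite h00 ?mul0r.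
  by rewrite mulr_ge0//; lra.
have mh1 : measurable_fun [set: M3 R] (fun v : M3 R => (h v * (v.1.1 + 1))%:E).
  apply/measurable_EFinP; apply: continuous_measurable3 => v.
  by apply: cvgM; [exact: ch|exact: cX11].
rewrite pairwise_yz// -ge0_integralZl//; last by move=> v _; rewrite lee_fin.
rewrite (@lebesgue3_tonelli_yzx _ (fun v => 2%:E * (h v * (v.1.1 + 1))%:E)); last 2 first.
- exact: emeasurable_funM.
- by move=> v; rewrite mule_ge0// lee_fin.
apply: eq_integral => y _; apply: eq_integral => z _.
rewrite /H (@integral_sph _ h N)//.
by apply: eq_integral => x _; rewrite -EFinM; congr EFin => /=; ring.
Qed.

(** Here [h] plays the part of F^(3/2). In the coordinates (s, y, z) the Jacobian [2 * (x + 1)]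
    becomes the weight on the left and cancels the denominators of [D2] and [D3] on the right; the
    factor [a] is integrated over (y, z) with no Jacobian. The factors 2 balance: two on each
    side. *)
Lemma loomis_whitney_sph :
  (\int[lebesgue3]_v (h v * (v.1.1 + 1))%:E) * (\int[lebesgue3]_v (h v * (v.1.1 + 1))%:E)
  <= (\int[lebesgue3]_v `|dF j0 v|%:E) *
     ((\int[lebesgue3]_v `|rot2 dF v|%:E) * (\int[lebesgue3]_v `|rot3 dF v|%:E)).
Proof.
have := integral_cs_product ma mH mbeta mgamma a0 H0 beta0 gamma0 le_H int_a int_H int_gamma int_beta.
move: (\int[lebesgue3]_v (h v * (v.1.1 + 1))%:E) (\int[lebesgue3]_v `|dF j0 v|%:E)
  (\int[lebesgue3]_v `|rot2 dF v|%:E) (\int[lebesgue3]_v `|rot3 dF v|%:E) => t p q r.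
rewrite (muleACA 2%:E t) (muleACA 2%:E r) (muleCA p) -EFinM (muleC r).
by rewrite lee_pmul2l// lte_fin mulr_gt0.
Qed.

End LoomisWhitney.

(** * The weighted Sobolev inequality *)

Section Weights.
Context {R : realType}.
Implicit Types (g : R3 R -> R) (v : R3 R).

Definition bsq v : R := 1 + (v.1.1 ^+ 2 + v.1.2 ^+ 2 + v.2 ^+ 2).

Lemma bsq_ge1 v : 1 <= bsq v.
Proof. by rewrite /bsq lerDl !addr_ge0 ?sqr_ge0. Qed.

Lemma bsq_gt0 v : 0 < bsq v. Proof. exact: lt_le_trans (bsq_ge1 v). Qed.

Lemma enorm_sq v : enorm v ^+ 2 = v.1.1 ^+ 2 + v.1.2 ^+ 2 + v.2 ^+ 2.
Proof. by rewrite /enorm sqr_sqrtr ?sum3E// !addr_ge0 ?sqr_ge0. Qed.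

Lemma bracketE v : bracket v = Num.sqrt (bsq v).
Proof. by rewrite /bracket enorm_sq. Qed.

Lemma bracket_sq v : bracket v ^+ 2 = bsq v.
Proof. by rewrite bracketE sqr_sqrtr// ltW// bsq_gt0. Qed.

Lemma bracket_gt0 v : 0 < bracket v.
Proof. by rewrite bracketE sqrtr_gt0 bsq_gt0. Qed.

Lemma bracket_ge1 v : 1 <= bracket v.
Proof. by rewrite bracketE -[leLHS]sqrtr1; apply: ler_wsqrtr; exact: bsq_ge1. Qed.

Lemma coord3_le_bracket v i : `|coord3 v i| <= bracket v.
Proof.
rewrite -(ler_pXn2r (n := 2))// ?nnegrE ?normr_ge0 ?ltW ?bracket_gt0//.
rewrite bracket_sq real_normK ?num_real// /bsq.
have h1 := sqr_ge0 v.1.1; have h2 := sqr_ge0 v.1.2; have h3 := sqr_ge0 v.2.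
by elim/ord3_ind: i; rewrite /coord3 /=; lra.
Qed.

Lemma hasgrad_bsq : hasgrad bsq (fun i v => 2 * coord3 v i).
Proof.
have h i := @hasgrad_coord R i.
apply: hasgrad_ext (hasgradD (hasgrad_cst 1) (hasgradD (hasgradD
  (hasgradM (h j0) (h j0)) (hasgradM (h j1) (h j1))) (hasgradM (h j2) (h j2)))) _.
by elim/ord3_ind => v /=; rewrite /coord3/=; ring.
Qed.

Lemma bsq_continuous : continuous bsq. Proof. exact: hasgrad_cont hasgrad_bsq. Qed.

Lemma bracket_continuous : continuous (@bracket R).
Proof.
have -> : (@bracket R) = (fun v => Num.sqrt (bsq v)) by apply/funext => v; exact: bracketE.
move=> v; apply: (@continuous_comp _ _ _ bsq Num.sqrt).
  exact: bsq_continuous.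
exact: sqrt_continuous.
Qed.

(* The partial derivatives vanish where the nonnegative [g] does, so that
   [g v * lgrad g i v] recovers them everywhere. *)
Definition lgrad g i v : R := partial i g v / g v.

(** A zero of a nonnegative function is a minimum; Fermat's rule is applied along the three
    coordinate lines. *)
Lemma hasgrad_min g dg i v : hasgrad g dg -> (forall v, 0 <= g v) ->
  g v = 0 -> dg i v = 0.
Proof.
move=> hg g0 gv.
have key (f df : R -> R) (t : R) : (forall t : R, is_derive t (1 : R) f (df t)) ->
    (forall t, f t >= 0) -> f t = 0 -> df t = 0.
  move=> fdf f0 ft.
  have /(@derive_val _ _ _ _ _ _ _) <- := fdf t.
  have [_ ->//] : is_derive t 1 f 0.
  apply: (@derive1_at_min _ f (t - 1) (t + 1)).
  - by lra.
  - by move=> u _; have [] := fdf u.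
  - by rewrite in_itv/=; apply/andP; split; lra.
  - by move=> u _; rewrite ft.
move: gv; case: v => -[x y] z gv; elim/ord3_ind: i.
- apply: (key (fun t => g (t, y, z)) (fun t => dg j0 (t, y, z))) => // t.
  have := hasgrad_curve hg (is_derive_id t (1 : R)) (is_derive_cst y t 1) (is_derive_cst z t 1).
  by rewrite !mul0r !addr0 mul1r.
- apply: (key (fun t => g (x, t, z)) (fun t => dg j1 (x, t, z))) => // t.
  have := hasgrad_curve hg (is_derive_cst x t 1) (is_derive_id t (1 : R)) (is_derive_cst z t 1).
  by rewrite !mul0r !addr0 add0r mul1r.
- apply: (key (fun t => g (x, y, t)) (fun t => dg j2 (x, y, t))) => // t.
  have := hasgrad_curve hg (is_derive_cst x t 1) (is_derive_cst y t 1) (is_derive_id t (1 : R)).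
  by rewrite !mul0r !add0r mul1r.
Qed.

Lemma partial_lgrad g dg i v : hasgrad g dg -> (forall v, 0 <= g v) ->
  dg i v = g v * lgrad g i v.
Proof.
move=> hg g0; rewrite /lgrad (hasgrad_partial hg).
have [gv|gv] := eqVneq (g v) 0; last by rewrite mulrC mulfVK.
by rewrite gv mul0r (hasgrad_min _ hg).
Qed.

(** This is |u|^2 + |v x u|^2 for v = (x, y, z) and u = (a, b, c), written with scalars so that
    [ring] and [lra] apply. *)
Definition aniso_form (x y z a b c : R) : R :=
  a ^+ 2 + b ^+ 2 + c ^+ 2
  + (x * b - y * a) ^+ 2 + (x * c - z * a) ^+ 2 + (y * c - z * b) ^+ 2.

Lemma aniso_form_ge0 x y z a b c : 0 <= aniso_form x y z a b c.
Proof. by rewrite !addr_ge0 ?sqr_ge0. Qed.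

Lemma aniso_form_cyc x y z a b c : aniso_form x y z b c a = aniso_form z x y a b c.
Proof. by rewrite /aniso_form; ring. Qed.

Lemma aniso_form_refl x y z a b c :
  aniso_form x y z (-1 * a) (1 * b) (1 * c) = aniso_form (- x) y z a b c.
Proof. by rewrite /aniso_form; ring. Qed.

Definition fisher g v : R := g v / bracket v ^+ 3 *
  (1 + aniso_form v.1.1 v.1.2 v.2 (lgrad g j0 v) (lgrad g j1 v) (lgrad g j2 v)).

Lemma fisher_ge0 g v : (forall v, 0 <= g v) -> 0 <= fisher g v.
Proof.
move=> g0; rewrite /fisher; apply: mulr_ge0; last by rewrite addr_ge0// aniso_form_ge0.
by rewrite divr_ge0// exprn_ge0// ltW// bracket_gt0.
Qed.

(** [k] may vanish: the real power of exponent -1 is measurable and agrees with the inverse at 0 as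
    well. *)
Lemma measurable_invr_ge0 (k : M3 R -> R) : measurable_fun [set: M3 R] k ->
  (forall v, 0 <= k v) -> measurable_fun [set: M3 R] (fun v => (k v)^-1).
Proof.
move=> mk k0.
have -> : (fun v => (k v)^-1) = (fun v => k v `^ (-1)).
  by apply/funext => v; rewrite powR_inv1.
exact: (measurableT_comp (@measurable_powR R (-1)) mk).
Qed.

Lemma measurable_lgrad g dg i : hasgrad g dg -> (forall v, 0 <= g v) ->
  measurable_fun [set: M3 R] (lgrad g i : M3 R -> R).
Proof.
move=> hg g0; apply: measurable_funM.
  apply: continuous_measurable3.
  have -> : partial i g = dg i by apply/funext => v; rewrite (hasgrad_partial hg).
  by case: hg.
apply: measurable_invr_ge0 => //.
by apply: continuous_measurable3; exact: hasgrad_cont hg.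
Qed.

Lemma measurable_fisher g dg : hasgrad g dg -> (forall v, 0 <= g v) ->
  measurable_fun [set: M3 R] (fisher g : M3 R -> R).
Proof.
move=> hg g0; have mu i := measurable_lgrad i hg g0.
have m1 := @measurable_proj1 R; have m2 := @measurable_proj2 R; have m3 := @measurable_proj3 R.
apply: measurable_funM.
  apply: measurable_funM; first by apply: continuous_measurable3; exact: hasgrad_cont hg.
  apply: measurable_invr_ge0; last by move=> v; rewrite exprn_ge0// ltW// bracket_gt0.
  by apply: measurable_funX; apply: continuous_measurable3; exact: bracket_continuous.
apply: measurable_funD; first exact: measurable_cst.
repeat apply: measurable_funD; apply: measurable_funX => //;
  by apply: measurable_funB; apply: measurable_funM.
Qed.
End Weights.

(** * Signed permutations of the axes *)

Section Isometries.
Context {R : realType}.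
Implicit Types (g : R3 R -> R).

(* Satisfied by the signed permutations of the coordinates. *)
Record symmetry (s s' : R3 R -> R3 R) : Prop := Symmetry {
  sym_cancel : forall v, s' (s v) = v ;
  sym_cont' : continuous s' ;
  sym_bsq : forall v, bsq (s v) = bsq v ;
  sym_integral : forall F : M3 R -> \bar R, measurable_fun [set: M3 R] F ->
    (forall v, 0 <= F v)%E ->
    (\int[lebesgue3]_v F (s v) = \int[lebesgue3]_v F v)%E ;
  sym_hasgrad : forall g dg, hasgrad g dg -> exists dg', hasgrad (g \o s) dg' ;
  sym_fisher : forall g dg, hasgrad g dg -> forall v, fisher (g \o s) v = fisher g (s v) }.

Lemma symmetry_id : symmetry id id.
Proof. by split=> //; [move=> v; exact: cvg_id|move=> g dg hg; exists dg]. Qed.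

Lemma symmetry_comp s1 s1' s2 s2' : symmetry s1 s1' -> symmetry s2 s2' ->
  measurable_fun [set: M3 R] (s1 : M3 R -> M3 R) ->
  symmetry (s1 \o s2) (s2' \o s1').
Proof.
move=> [a1 b1 c1 d1 e1 f1] [a2 b2 c2 d2 e2 f2] m1; split=> /=.
- by move=> v; rewrite a1 a2.
- by move=> v; apply: (@continuous_comp _ _ _ s1' s2'); [exact: b1|exact: b2].
- by move=> v; rewrite c1 c2.
- move=> F mF F0; rewrite (d2 (F \o s1))//; first exact: d1.
  + exact: measurableT_comp.
  + by move=> v /=.
- by move=> g dg /e1[dg' /e2].
- by move=> g dg hg v; have [dg' hg'] := e1 _ _ hg; rewrite (f2 _ _ hg') (f1 _ _ hg).
Qed.

Lemma bracket_bsq (v w : R3 R) : bsq v = bsq w -> bracket v = bracket w.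
Proof. by rewrite !bracketE => ->. Qed.

Lemma symmetry_cyc : symmetry cyc (cyc \o cyc).
Proof.
have ccyc : continuous (cyc : R3 R -> R3 R).
  by move=> v; apply: differentiable_continuous; exact: differentiable_cyc.
split.
- by case=> -[x y] z.
- by move=> v; apply: (@continuous_comp _ _ _ cyc cyc); exact: ccyc.
- by case=> -[x y] z; rewrite /bsq/=; ring.
- exact: lebesgue3_cyc.
- by move=> g dg hg; exists (fun i v => dg (ordC i) (cyc v)); exact: hasgrad_cyc.
- move=> g dg hg v; have hc := hasgrad_cyc hg.
  have E i : lgrad (g \o cyc) i v = lgrad g (ordC i) (cyc v).
    by rewrite /lgrad (hasgrad_partial hc) (hasgrad_partial hg).
  have [C0 C1 C2] : [/\ ordC j0 = j1, ordC j1 = j2 & ordC j2 = j0] by [].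
  rewrite /fisher !E C0 C1 C2 aniso_form_cyc (@bracket_bsq (cyc v) v)//.
  by rewrite /bsq /=; ring.
Qed.

Lemma hasgrad_refl1 g dg : hasgrad g dg ->
  hasgrad (g \o refl1) (fun i v => (if i == j0 then -1 else 1) * dg i (refl1 v)).
Proof.
move=> [g1 g2 g3].
have dr v : differentiable (refl1 : R3 R -> R3 R) v.
  apply: differentiable_pair; [apply: differentiable_pair|].
  - by apply: differentiableN; exact: (differentiable_coord3 j0).
  - exact: (differentiable_coord3 j1).
  - exact: (differentiable_coord3 j2).
have cr : continuous (refl1 : R3 R -> R3 R).
  by move=> v; exact: differentiable_continuous.
split=> [v|i v|i].
- exact: differentiable_comp.
- have -> : partial i (g \o refl1) v = 'D_(refl1 (basis3 i)) g (refl1 v).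
    rewrite /partial /derive; do 2 f_equal; apply/funext => h /=.
    congr (_ *: (g _ - _)); rewrite /refl1/=; congr ((_, _), _).
    by rewrite /= /GRing.scale/=; ring.
  rewrite deriveE// /refl1 diff_coords// !g2.
  by elim/ord3_ind: i; rewrite /basis3/=; ring.
- move=> v; apply: cvgM; first exact: cvg_cst.
  by apply: (@continuous_comp _ _ _ refl1 (dg i)); [exact: cr|exact: g3].
Qed.

Lemma symmetry_refl1 : symmetry refl1 refl1.
Proof.
split.
- by case=> -[x y] z; rewrite /refl1/= opprK.
- move=> v; apply: continuous_triple.
  + by move=> w; apply: cvgN; exact: (@coord3_continuous R j0).
  + exact: (@coord3_continuous R j1).
  + exact: (@coord3_continuous R j2).
- by case=> -[x y] z; rewrite /bsq/= sqrrN.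
- exact: lebesgue3_refl1.
- by move=> g dg hg; eexists; exact: hasgrad_refl1 hg.
- move=> g dg hg v; have hc := hasgrad_refl1 hg.
  have E i : lgrad (g \o refl1) i v = (if i == j0 then -1 else 1) * lgrad g i (refl1 v).
    by rewrite /lgrad (hasgrad_partial hc) (hasgrad_partial hg) mulrA.
  rewrite /fisher !E/= aniso_form_refl (@bracket_bsq (refl1 v) v)//.
  by rewrite /bsq /= sqrrN.
Qed.
End Isometries.

(** * Pointwise estimates for the test function along one axis *)

Section DirectionalSobolev.
Context {R : realType}.

Lemma max0_ge0 (x : R) : 0 <= Num.max x 0.
Proof. by rewrite le_max lexx orbT. Qed.

(** The factor 64 is 2^6, bounding [mu ^+ 6]; 800 comes from 2 p^2 + 2 r^2 s^2 <= 2 * 400 + 2 * 16 *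
    2 A <= 800 (1 + A) in [cutoff_bound]. *)
Definition sobC0 : R := 64 * 800.

(** The shape shared by the three derivatives of [trial] once every quantity is divided by its
    natural power of <v>: [i] is <v>^-1, [mu] and [psi] are the two normalized cutoffs, [p] collects
    the terms where a cutoff is differentiated (|p| <= 20), and [r * s] is the term with the
    derivative [s] of log g. *)
Lemma cutoff_bound (i mu psi G p r s A : R) : 0 <= psi -> 0 <= mu -> mu <= 2 ->
  p ^+ 2 <= 400 -> r ^+ 2 <= 16 -> s ^+ 2 <= 2 * A -> 0 <= A ->
  (mu ^+ 3 * psi ^+ 3 * i ^+ 4 * G ^+ 2 * (p + r * s)) ^+ 2
  <= sobC0 * (psi ^+ 6 * i ^+ 8 * G ^+ 4 * (1 + A)).
Proof.
move=> psi0 mu0 mu2 hp hr hs A0.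
have -> : (mu ^+ 3 * psi ^+ 3 * i ^+ 4 * G ^+ 2 * (p + r * s)) ^+ 2 =
  (psi ^+ 3 * i ^+ 4 * G ^+ 2) ^+ 2 * (mu ^+ 6 * (p + r * s) ^+ 2) by ring.
have -> : sobC0 * (psi ^+ 6 * i ^+ 8 * G ^+ 4 * (1 + A)) =
  (psi ^+ 3 * i ^+ 4 * G ^+ 2) ^+ 2 * (64 * (800 * (1 + A))).
  by rewrite /sobC0; move: (800 : R) => c; ring.
rewrite ler_wpM2l ?sqr_ge0//.
have h1 : mu ^+ 6 <= 64.
  by rewrite (_ : 64 = 2 ^+ 6) ?lerXn2r ?nnegrE//; ring.
rewrite ler_pM ?sqr_ge0 ?exprn_ge0//.
have h2 : (p + r * s) ^+ 2 <= 2 * p ^+ 2 + 2 * (r ^+ 2 * s ^+ 2).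
  rewrite -subr_ge0 (_ : _ - _ = (p - r * s) ^+ 2) ?sqr_ge0//; ring.
have h3 : r ^+ 2 * s ^+ 2 <= 16 * (2 * A) by rewrite ler_pM ?sqr_ge0.
lra.
Qed.

Variables (g : R3 R -> R) (dg : 'I_3 -> R3 R -> R) (N : R).
Hypotheses (hg : hasgrad g dg) (g0 : forall v, 0 <= g v) (N1 : 1 <= N).

(** Decay and truncation in one function: its positive part increases to <v>^-2 as [N] grows. [wcut]
    is the ratio to that limit, with values in [0, 1]. *)
Definition cut (v : R3 R) : R := (bsq v)^-1 - N^-1.
Definition wcut (v : R3 R) : R := Num.max (cut v) 0 * bsq v.

Lemma N_gt0 : 0 < N. Proof. exact: lt_le_trans N1. Qed.

Lemma hasgrad_cut : hasgrad cut (fun i v => - (2 * coord3 v i) / bsq v ^+ 2).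
Proof.
have b0 v : bsq v != 0 :> R by rewrite gt_eqF// bsq_gt0.
have := hasgradD (hasgradV hasgrad_bsq b0) (hasgrad_cst (- N^-1)).
by move=> /hasgrad_ext; apply => i v; rewrite addr0.
Qed.

Lemma wcut_ge0 v : 0 <= wcut v.
Proof. by rewrite mulr_ge0 ?max0_ge0// ltW// bsq_gt0. Qed.

Lemma wcut_le1 v : wcut v <= 1.
Proof.
rewrite /wcut -ler_pdivlMr ?bsq_gt0// ge_max div1r invr_ge0 (ltW (bsq_gt0 v)) andbT.
by rewrite /cut lerBlDr lerDl invr_ge0 ltW// N_gt0.
Qed.

Lemma cut_boxed (k : R3 R -> R) : (forall v, cut v <= 0 -> k v = 0) -> boxed N k.
Proof.
move=> hk v i Nv; apply: hk; rewrite /cut subr_le0 lef_pV2 ?posrE ?bsq_gt0 ?N_gt0//.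
rewrite -bracket_sq.
have Nb := le_trans (ltW Nv) (coord3_le_bracket v i); have b1 := bracket_ge1 v.
by nra.
Qed.

Let X1 (v : R3 R) : R := v.1.1 + 2^-1.
Let hX1 : hasgrad X1 (fun i _ => (i == j0)%:R).
Proof.
have := hasgradD (@hasgrad_coord R j0) (hasgrad_cst 2^-1).
by move=> /hasgrad_ext; apply => i v; rewrite addr0.
Qed.

(* [X1] localizes to a half-space away from (-1, 0, 0), [cut] truncates at <v>^2 = N. *)
Definition trial (v : R3 R) : R := ppow 4 (X1 v) * ppow 4 (cut v) * (g v * g v).
Definition dtrial i (v : R3 R) : R :=
  (4 * ppow 3 (X1 v) * (i == j0)%:R * ppow 4 (cut v)
   + ppow 4 (X1 v) * (4 * ppow 3 (cut v) * (- (2 * coord3 v i) / bsq v ^+ 2))) * (g v * g v)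
  + ppow 4 (X1 v) * ppow 4 (cut v) * (dg i v * g v + g v * dg i v).

Lemma hasgrad_trial : hasgrad trial dtrial.
Proof. exact: hasgradM (hasgradM (hasgrad_ppow 2 hX1) (hasgrad_ppow 2 hasgrad_cut)) (hasgradM hg hg). Qed.

(** This is [trial] to the power 3/2. The exponents fit the target weight: [X1] is of order at most
    <v> and [cut] of order at most <v>^-2, so [cubed v * (v.1.1 + 1)] is of order at most <v>^(6 -
    12 + 1) g^3 = <v>^-5 g^3. *)
Definition cubed (v : R3 R) : R := ppow 6 (X1 v) * ppow 6 (cut v) * g v ^+ 3.

Lemma cubed_sq v : cubed v * cubed v = trial v * (trial v * trial v).
Proof.
rewrite /cubed /trial /ppow.
by move: (Num.max (X1 v) 0) (Num.max (cut v) 0) (g v) => m e G; ring.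
Qed.

(* A truncation of g^3 <v>^-5, with finite integral, so that it can be absorbed. *)
Definition massJ (v : R3 R) : R := wcut v ^+ 6 * g v ^+ 3 / bracket v ^+ 5.

Let ib v : R := (bracket v)^-1.

Let common v : [/\ 0 < ib v, ib v <= 1, bracket v * ib v = 1,
  Num.max (cut v) 0 = wcut v * ib v ^+ 2 & (bsq v)^-1 = ib v ^+ 2].
Proof.
have b0 := bracket_gt0 v; have bn : bracket v != 0 by rewrite gt_eqF.
split.
- by rewrite invr_gt0.
- by rewrite invf_le1// bracket_ge1.
- exact: mulfV.
- by rewrite /wcut -bracket_sq /ib exprVn mulfK// expf_neq0.
- by rewrite -bracket_sq exprVn.
Qed.

Let mu v : R := Num.max (X1 v) 0 * ib v.

Let mu_bound v : 0 <= mu v /\ mu v <= 2.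
Proof.
have [i0 i1 bi _ _] := common v.
split; first by rewrite mulr_ge0 ?max0_ge0// ltW.
rewrite /mu -ler_pdivlMr// /ib invrK ge_max.
have b1 := bracket_ge1 v; have := coord3_le_bracket v j0.
rewrite /coord3/= => /(le_trans (ler_norm _)) hx.
by rewrite /X1; apply/andP; split; lra.
Qed.

Let xi i v : R := coord3 v i * ib v.

Let xi_bound i v : - 1 <= xi i v <= 1.
Proof.
have [i0 i1 bi _ _] := common v.
by rewrite -ler_norml normrM (gtr0_norm i0) -ler_pdivlMr// div1r invrK coord3_le_bracket.
Qed.

Let A v := aniso_form v.1.1 v.1.2 v.2 (lgrad g j0 v) (lgrad g j1 v) (lgrad g j2 v).

Let massJ_fisher v : sobC0 * (wcut v ^+ 6 * ib v ^+ 8 * g v ^+ 4 * (1 + A v)) =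
  massJ v * (sobC0 * fisher g v).
Proof.
rewrite /massJ /fisher -/(A v) -!exprVn -/(ib v).
by move: (wcut v) (ib v) (g v) (A v) sobC0 => w i G a c; ring.
Qed.

Let dtrialE i v : dtrial i v =
  Num.max (X1 v) 0 ^+ 3 * Num.max (cut v) 0 ^+ 3 * g v ^+ 2 *
   (4 * (i == j0)%:R * Num.max (cut v) 0
    - 8 * Num.max (X1 v) 0 * coord3 v i * (bsq v)^-1 ^+ 2
    + 2 * Num.max (X1 v) 0 * Num.max (cut v) 0 * lgrad g i v).
Proof.
rewrite /dtrial !(partial_lgrad _ _ hg g0) /ppow exprVn.
move: (Num.max (X1 v) 0) (Num.max (cut v) 0) (g v) ((i == j0)%:R) (coord3 v i) (bsq v ^- 2) (lgrad g i v).
by move=> m e G d x q l; ring.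
Qed.

Let muE v : Num.max (X1 v) 0 = mu v * bracket v.
Proof. by rewrite /mu -mulrA mulVf ?mulr1// gt_eqF// bracket_gt0. Qed.

Let xiE i v : coord3 v i = xi i v * bracket v.
Proof. by rewrite /xi -mulrA mulVf ?mulr1// gt_eqF// bracket_gt0. Qed.

Let A_ge0 v : 0 <= A v. Proof. exact: aniso_form_ge0. Qed.

Let p_bound (c k l x : R) : -1 <= x <= 1 -> 0 <= c <= 1 -> 0 <= k <= 1 -> 0 <= l <= 2 ->
  (4 * c * k - 8 * l * x) ^+ 2 <= 400.
Proof.
move=> /andP[x1 x2] /andP[c0 c1] /andP[k0 k1] /andP[l0 l1].
have : 0 <= c * k <= 1 by rewrite mulr_ge0//= mulr_ile1.
have : -2 <= l * x <= 2 by apply/andP; split; nra.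
rewrite -!mulrA; move: (c * k) (l * x) => u w /andP[? ?] /andP[? ?].
have h1 : -20 <= 4 * u - 8 * w by lra.
have h2 : 4 * u - 8 * w <= 20 by lra.
nra.
Qed.

Let r_bound v : (2 * mu v * wcut v) ^+ 2 <= 16.
Proof.
have [m0 m2] := mu_bound v; have w0 := wcut_ge0 v; have w1 := wcut_le1 v.
have : 0 <= mu v * wcut v <= 2 by rewrite mulr_ge0//= -[leRHS]mulr1 ler_pM.
by rewrite -(mulrA 2); move: (mu v * wcut v) => k /andP[? ?]; nra.
Qed.

Let mu_ib v : 0 <= mu v * ib v <= 2.
Proof.
have [i0 i1 _ _ _] := common v; have [m0 m2] := mu_bound v.
by rewrite mulr_ge0 ?(ltW i0)//= -[leRHS]mulr1 ler_pM// ltW.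
Qed.

(** Moving the centre of rotation from the origin to (-1, 0, 0) adds a component of u to one of v x
    u, hence the factor 2. *)
Let aniso_bounds (x y z a b c : R) : [/\ a ^+ 2 <= 2 * aniso_form x y z a b c,
  (x * b - y * a + b) ^+ 2 <= 2 * aniso_form x y z a b c &
  (x * c - z * a + c) ^+ 2 <= 2 * aniso_form x y z a b c].
Proof.
rewrite /aniso_form.
move: (x * b - y * a) (x * c - z * a) (y * c - z * b) => p q r.
have ha := sqr_ge0 a; have hb := sqr_ge0 b; have hc := sqr_ge0 c.
have hp := sqr_ge0 p; have hq := sqr_ge0 q; have hr := sqr_ge0 r.
have hpb := sqr_ge0 (p - b); have hqc := sqr_ge0 (q - c).
by split; [lra| |]; rewrite -subr_ge0; [move: hpb|move: hqc]; rewrite sqrrB sqrrD; lra.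
Qed.

Lemma dtrial0_bound v : dtrial j0 v ^+ 2 <= massJ v * (sobC0 * fisher g v).
Proof.
have [i0 i1 bi wE qE] := common v; have [m0 m2] := mu_bound v.
have xb := xi_bound j0 v; have w0 := wcut_ge0 v; have w1 := wcut_le1 v.
rewrite -massJ_fisher dtrialE wE qE muE xiE.
have [sA _ _] := aniso_bounds v.1.1 v.1.2 v.2 (lgrad g j0 v) (lgrad g j1 v) (lgrad g j2 v).
have := @cutoff_bound (ib v) (mu v) (wcut v) (g v) (4 * wcut v * ib v - 8 * (mu v * ib v) * xi j0 v)
  (2 * mu v * wcut v) (lgrad g j0 v) (A v) w0 m0 m2 _ (r_bound v) sA (A_ge0 v).
move=> H; apply: le_trans (H _); last by apply: p_bound; rewrite ?w0 ?w1 ?(ltW i0) ?i1 ?mu_ib.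
rewrite le_eqVlt; apply/orP; left; apply/eqP; congr (_ ^+ 2).
move: bi; move: (bracket v) (ib v) (mu v) (wcut v) (g v) (xi j0 v) (lgrad g j0 v) => b i m w G x l bi.
have b0 : b != 0 by apply: contra_eq_neq bi => ->; rewrite mul0r eq_sym oner_neq0.
have -> : i = b^-1 by rewrite -[LHS]mul1r -(mulVf b0) -mulrA bi mulr1.
by rewrite (_ : (ord0 == ord0) = true)//=; field.
Qed.

(** The lever arm of a rotation could cost a power of <v>. On g it is paid for by |v x u|^2. On
    [cut], which is radial about the origin, only the unit shift of the centre survives, leaving the
    plain j-th derivative. On [X1] it gives - v_j, of the admissible order <v>. *)
Let rot_bound v j s : j != j0 ->
  (v.1.1 + 1) * lgrad g j v - coord3 v j * lgrad g j0 v = s -> s ^+ 2 <= 2 * A v ->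
  ((v.1.1 + 1) * dtrial j v - coord3 v j * dtrial j0 v) ^+ 2 <= massJ v * (sobC0 * fisher g v).
Proof.
move=> jj0 sE sA.
have [i0 i1 bi wE qE] := common v; have [m0 m2] := mu_bound v.
have xb := xi_bound j v; have w0 := wcut_ge0 v; have w1 := wcut_le1 v.
rewrite -massJ_fisher !dtrialE.
have xb' : -1 <= - xi j v <= 1 by rewrite lerN2 lerNl andbC.
have := @cutoff_bound (ib v) (mu v) (wcut v) (g v) (4 * wcut v * (- xi j v) - 8 * (mu v * ib v) * xi j v)
  (2 * mu v * wcut v) s (A v) w0 m0 m2 _ (r_bound v) sA (A_ge0 v).
move=> H; apply: le_trans (H _); last first.
  move: (xi j v) (mu v * ib v) (mu_ib v) xb (wcut v) w0 w1
    => x k /andP[k0 k2] /andP[x1 x2] w w0 w1.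
  have : -1 <= w * x <= 1 by apply/andP; split; nra.
  have : -2 <= k * x <= 2 by apply/andP; split; nra.
  rewrite mulrN -!mulrA; move: (w * x) (k * x) => u t /andP[? ?] /andP[? ?].
  have h1 : -20 <= - (4 * u) - 8 * t by lra.
  have h2 : - (4 * u) - 8 * t <= 20 by lra.
  nra.
rewrite le_eqVlt; apply/orP; left; apply/eqP; congr (_ ^+ 2).
rewrite (negbTE jj0) eqxx wE qE muE -sE (xiE j).
have -> : coord3 v j0 = v.1.1 by [].
move: bi; move: (bracket v) (ib v) (mu v) (wcut v) (g v) (xi j v) (lgrad g j v) (lgrad g j0 v) v.1.1
  => b i m w G x l l0 t bi.
have b0 : b != 0 by apply: contra_eq_neq bi => ->; rewrite mul0r eq_sym oner_neq0.
have -> : i = b^-1 by rewrite -[LHS]mul1r -(mulVf b0) -mulrA bi mulr1.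
by rewrite /=; field.
Qed.

Lemma rot2_bound v : rot2 dtrial v ^+ 2 <= massJ v * (sobC0 * fisher g v).
Proof.
apply: (@rot_bound v j1 _ _ erefl) => //.
have [_ sA _] := aniso_bounds v.1.1 v.1.2 v.2 (lgrad g j0 v) (lgrad g j1 v) (lgrad g j2 v).
apply: le_trans sA; rewrite le_eqVlt; apply/orP; left; apply/eqP; congr (_ ^+ 2).
by rewrite mulrDl mul1r addrAC.
Qed.

Lemma rot3_bound v : rot3 dtrial v ^+ 2 <= massJ v * (sobC0 * fisher g v).
Proof.
apply: (@rot_bound v j2 _ _ erefl) => //.
have [_ _ sA] := aniso_bounds v.1.1 v.1.2 v.2 (lgrad g j0 v) (lgrad g j1 v) (lgrad g j2 v).
apply: le_trans sA; rewrite le_eqVlt; apply/orP; left; apply/eqP; congr (_ ^+ 2).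
by rewrite mulrDl mul1r addrAC.
Qed.

End DirectionalSobolev.

(** * Symmetrization, absorption and removal of the truncation *)

Section Sobolev.
Context {R : realType}.
Implicit Types (g : R3 R -> R) (N K : R).

Definition kap N (v : R3 R) : R := ppow 6 (v.1.1 + 2^-1) * ppow 6 (cut N v) * (v.1.1 + 1).

Lemma cut_continuous N : continuous (@cut R N). Proof. exact: hasgrad_cont (hasgrad_cut N). Qed.

Lemma wcut_continuous N : continuous (@wcut R N).
Proof.
move=> v; apply: cvgM; last exact: bsq_continuous.
apply: (@continuous_max _ _ (@cut R N) (cst 0)); [exact: cut_continuous|exact: cvg_cst].
Qed.

Lemma kap_continuous N : continuous (kap N).
Proof.
have X := @coord3_continuous R j0.
have Xc (c : R) : continuous (fun v : R3 R => v.1.1 + c).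
  by move=> v; apply: cvgD; [exact: X|exact: cvg_cst].
move=> v; apply: cvgM; last exact: Xc.
apply: cvgM.
  apply: (@continuous_comp _ _ _ (fun v : R3 R => v.1.1 + 2^-1) (ppow 6)); [exact: Xc|exact: ppow_continuous].
apply: (@continuous_comp _ _ _ (cut N) (ppow 6)); [exact: cut_continuous|exact: ppow_continuous].
Qed.

Lemma kap_ge0 N v : 0 <= kap N v.
Proof.
have [h|h] := ltP v.1.1 (- 2^-1); first by rewrite /kap (@ppow_le0 _ 5) ?mul0r//; lra.
by apply: mulr_ge0; [apply: mulr_ge0; exact: ppow_ge0|lra].
Qed.

Lemma expr_continuous g n : continuous g -> continuous (fun v => g v ^+ n).
Proof.
by move=> cg v; apply: (@continuous_comp _ _ _ g (fun x => x ^+ n)); [exact: cg|exact: exprn_continuous].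
Qed.

Lemma massJ_continuous g N : continuous g -> continuous (massJ g N).
Proof.
move=> cg v; apply: cvgM.
  apply: cvgM; last exact: expr_continuous.
  by apply: expr_continuous; exact: wcut_continuous.
apply: cvgV; first by rewrite gt_eqF// exprn_gt0// bracket_gt0.
by apply: expr_continuous; exact: bracket_continuous.
Qed.

Lemma massJ_ge0 g N v : (forall v, 0 <= g v) -> 0 <= massJ g N v.
Proof.
move=> g0; rewrite /massJ mulr_ge0 ?invr_ge0 ?exprn_ge0 ?(ltW (bracket_gt0 _))//.
by rewrite mulr_ge0 ?exprn_ge0// wcut_ge0.
Qed.

Lemma boxed_integral N N' (k : R3 R -> R) : 1 <= N -> continuous k -> (forall v, 0 <= k v) ->
  (forall v, cut N v <= 0 -> k v = 0) ->
  exists2 T : R, 0 <= T & (\int[lebesgue3]_v (k v)%:E = T%:E)%E.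
Proof.
move=> N1 ck k0 kc.
have Ik : lebesgue3.-integrable setT (EFin \o k).
  by apply: (@integrable_boxed_cont _ N) => //; exact: (cut_boxed N1).
exists (fine (\int[lebesgue3]_v (k v)%:E)%E).
  by apply: fine_ge0; apply: integral_ge0 => v _; rewrite lee_fin.
by rewrite fineK//; exact: integrable_fin_num.
Qed.

Lemma sqr_le_fin (x : \bar R) (B : R) : (0 <= x)%E -> (x * x <= B%:E)%E ->
  exists r : R, [/\ x = r%:E, 0 <= r & r ^+ 2 <= B].
Proof.
case: x => [r| |] //.
by rewrite lee_fin -EFinM lee_fin => r0 rB; exists r; rewrite expr2.
Qed.

Lemma sobC0_ge0 : 0 <= sobC0 :> R.
Proof. exact: (mulr_ge0 (ler0n _ _) (ler0n _ _)). Qed.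

Lemma eq_refl_le (x y : R) : x = y -> x <= y. Proof. by move=> ->. Qed.

(** Loomis-Whitney bounds T^2 by a product of three L^1 norms, and Cauchy-Schwarz bounds the square
    of each by the integrals of [massJ] and [sobC0 * fisher]. One more squaring avoids fractional
    powers. *)
Lemma directional_bound g dg N K J : hasgrad g dg -> (forall v, 0 <= g v) -> 1 <= N ->
  0 <= K -> (\int[lebesgue3]_v (fisher g v)%:E <= K%:E)%E ->
  (\int[lebesgue3]_v (massJ g N v)%:E = J%:E)%E ->
  exists T : R, [/\ 0 <= T, (\int[lebesgue3]_v (kap N v * g v ^+ 3)%:E = T%:E)%E &
    T ^+ 4 <= (J * (sobC0 * K)) ^+ 3].
Proof.
move=> hg g0 N1 K0 IK IJ.
have cg := hasgrad_cont hg.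
have hF := hasgrad_trial N hg.
have c0 := sobC0_ge0.
have bF : boxed N (trial g N).
  by apply: (cut_boxed N1) => v cv; rewrite /trial (@ppow_le0 _ 3 (cut N v))// mulr0 mul0r.
have F0 v : 0 <= trial g N v by apply: mulr_ge0; apply: mulr_ge0 => //; exact: ppow_ge0.
have Fh v : v.1.1 < - 2^-1 -> trial g N v = 0.
  by move=> h; rewrite /trial (@ppow_le0 _ 3) ?mul0r//; lra.
have ccub : continuous (cubed g N).
  have X := @coord3_continuous R j0.
  move=> v; apply: cvgM; last exact: expr_continuous.
  apply: cvgM.
    apply: (@continuous_comp _ _ _ (fun v : R3 R => v.1.1 + 2^-1) (ppow 6)); last exact: ppow_continuous.
    by apply: cvgD; [exact: X|exact: cvg_cst].
  by apply: (@continuous_comp _ _ _ (cut N) (ppow 6)); [exact: cut_continuous|exact: ppow_continuous].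
have cub0 v : 0 <= cubed g N v by apply: mulr_ge0; [apply: mulr_ge0; exact: ppow_ge0|exact: exprn_ge0].
have := loomis_whitney_sph hF bF F0 Fh ccub cub0 (fun v => eq_refl_le (cubed_sq g N v)).
have kE v : cubed g N v * (v.1.1 + 1) = kap N v * g v ^+ 3.
  by rewrite /cubed /kap mulrAC.
have [T T0 TE] : exists2 T : R, 0 <= T & (\int[lebesgue3]_v (kap N v * g v ^+ 3)%:E = T%:E)%E.
  apply: (@boxed_integral N N _ N1).
  - by move=> v; apply: cvgM; [exact: kap_continuous|exact: expr_continuous].
  - by move=> v; apply: mulr_ge0; [exact: kap_ge0|exact: exprn_ge0].
  - by move=> v cv; rewrite /kap (@ppow_le0 _ 5 (cut N v))// mulr0 !mul0r.
have -> : (\int[lebesgue3]_v (cubed g N v * (v.1.1 + 1))%:E = T%:E)%E.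
  by rewrite -TE; apply: eq_integral => v _; rewrite kE.
rewrite TE.
have PB (r : R3 R -> R) : continuous r ->
    (forall v, r v ^+ 2 <= massJ g N v * (sobC0 * fisher g v)) ->
    exists p : R, [/\ (\int[lebesgue3]_v `|r v|%:E = p%:E)%E, 0 <= p & p ^+ 2 <= J * (sobC0 * K)].
  move=> cr rb; apply: sqr_le_fin; first exact: integral_ge0.
  have mJ : measurable_fun [set: M3 R] (fun v : M3 R => (massJ g N v)%:E).
    by apply/measurable_EFinP; apply: continuous_measurable3; exact: massJ_continuous.
  have mf : measurable_fun [set: M3 R] (fun v : M3 R => (sobC0 * fisher g v)%:E).
    apply/measurable_EFinP; apply: measurable_funM => //; exact: measurable_fisher hg g0.
  have mr : measurable_fun [set: M3 R] (fun v : M3 R => `|r v|%:E).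
    by apply/measurable_EFinP; apply: measurableT_comp => //; exact: continuous_measurable3.
  apply: le_trans (ge0_integral_cs _ mJ mf mr _ _ _ _) _.
  - by move=> v; rewrite lee_fin massJ_ge0.
  - by move=> v; rewrite lee_fin mulr_ge0// fisher_ge0.
  - by move=> v; rewrite lee_fin.
  - by move=> v; rewrite -!EFinM lee_fin -normrM ger0_norm -?expr2 ?sqr_ge0.
  have J0 : 0 <= J.
    by rewrite -lee_fin -IJ; apply: integral_ge0 => v _; rewrite lee_fin massJ_ge0.
  rewrite IJ [leRHS]EFinM lee_wpmul2l ?lee_fin//.
  under eq_integral do rewrite EFinM.
  rewrite ge0_integralZl_EFin//; last 2 first.
  - by move=> v _; rewrite lee_fin fisher_ge0.
  - by apply/measurable_EFinP; exact: measurable_fisher hg g0.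
  by rewrite [leRHS]EFinM lee_wpmul2l ?lee_fin.
have dcont i : continuous (dtrial g dg N i) by case: hF.
have [X1c X2c X3c] := And3 (@coord3_continuous R j0) (@coord3_continuous R j1) (@coord3_continuous R j2).
have Xc : continuous (fun v : R3 R => v.1.1 + 1).
  by move=> v; apply: cvgD; [exact: X1c|exact: cvg_cst].
have [p1 [-> p10 p1B]] := PB _ (dcont j0) (dtrial0_bound hg g0 N1).
have c2 : continuous (rot2 (dtrial g dg N)).
  by move=> v; apply: cvgB; apply: cvgM; [exact: Xc|exact: dcont|exact: X2c|exact: dcont].
have c3 : continuous (rot3 (dtrial g dg N)).
  by move=> v; apply: cvgB; apply: cvgM; [exact: Xc|exact: dcont|exact: X3c|exact: dcont].
have [p2 [-> p20 p2B]] := PB _ c2 (rot2_bound hg g0 N1).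
have [p3 [-> p30 p3B]] := PB _ c3 (rot3_bound hg g0 N1).
rewrite -!EFinM lee_fin => TT; exists T; split => //.
rewrite (_ : T ^+ 4 = (T * T) ^+ 2); last by ring.
apply: (@le_trans _ _ ((p1 * (p2 * p3)) ^+ 2)).
  by rewrite lerXn2r ?nnegrE ?mulr_ge0.
have B0 : 0 <= J * (sobC0 * K) := le_trans (sqr_ge0 _) p1B.
move: (J * (sobC0 * K)) B0 p1B p2B p3B => B B0 p1B p2B p3B.
rewrite (_ : _ ^+ 2 = p1 ^+ 2 * (p2 ^+ 2 * p3 ^+ 2)); last by ring.
rewrite (_ : B ^+ 3 = B * (B * B)); last by ring.
by rewrite ler_pM ?mulr_ge0 ?sqr_ge0// ler_pM ?sqr_ge0.
Qed.

(** The previous bound is applied to [g \o s], whose Fisher and cubic integrals are those of [g];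
    undoing the change of variables moves the weight [kap] to another half-space. *)
Lemma symmetric_bound s s' g dg N K J : symmetry s s' -> (forall v, cut N (s' v) = cut N v) ->
  hasgrad g dg -> (forall v, 0 <= g v) -> 1 <= N ->
  0 <= K -> (\int[lebesgue3]_v (fisher g v)%:E <= K%:E)%E ->
  (\int[lebesgue3]_v (massJ g N v)%:E = J%:E)%E ->
  exists T : R, [/\ 0 <= T, (\int[lebesgue3]_v (kap N (s' v) * g v ^+ 3)%:E = T%:E)%E &
    T ^+ 4 <= (J * (sobC0 * K)) ^+ 3].
Proof.
move=> [s's cs' sb si sg sf] cs hg g0 N1 K0 IK IJ.
have cg := hasgrad_cont hg.
have [dg' hg'] := sg _ _ hg.
have bs v : bracket (s v) = bracket v by apply: bracket_bsq.
have IK' : (\int[lebesgue3]_v (fisher (g \o s) v)%:E <= K%:E)%E.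
  rewrite (_ : (\int[lebesgue3]_v _)%E = (\int[lebesgue3]_v (fisher g v)%:E)%E)//.
  rewrite -(si (fun v => (fisher g v)%:E)).
  - by apply: eq_integral => v _; rewrite (sf _ _ hg).
  - by apply/measurable_EFinP; exact: measurable_fisher hg g0.
  - by move=> v; rewrite lee_fin fisher_ge0.
have IJ' : (\int[lebesgue3]_v (massJ (g \o s) N v)%:E = J%:E)%E.
  rewrite -IJ -(si (fun v => (massJ g N v)%:E)).
  - apply: eq_integral => v _; congr EFin.
    by rewrite /massJ /wcut /cut sb bs.
  - by apply/measurable_EFinP; apply: continuous_measurable3; exact: massJ_continuous.
  - by move=> v; rewrite lee_fin massJ_ge0.
have [T [T0 TE TB]] := directional_bound hg' (fun v => g0 (s v)) N1 K0 IK' IJ'.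
exists T; split => //; rewrite -TE -(si (fun v => (kap N (s' v) * g v ^+ 3)%:E)).
- by apply: eq_integral => v _; rewrite s's.
- apply/measurable_EFinP; apply: continuous_measurable3 => v.
  apply: cvgM; last exact: expr_continuous.
  by apply: (@continuous_comp _ _ _ s' (kap N)); [exact: cs'|exact: kap_continuous].
- by move=> v; rewrite lee_fin mulr_ge0 ?kap_ge0 ?exprn_ge0.
Qed.

Let tt (u : R) : R := ppow 6 (u + 2^-1) * (u + 1).

Let tt_ge0 u : 0 <= tt u.
Proof.
have [h|h] := ltP u (- 2^-1); first by rewrite /tt (@ppow_le0 _ 5) ?mul0r//; lra.
by apply: mulr_ge0; [exact: ppow_ge0|lra].
Qed.

Let sq_le_norm (u w : R) : `|u| <= `|w| -> u ^+ 2 <= w ^+ 2.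
Proof. by move=> h; rewrite -(real_normK (num_real u)) -(real_normK (num_real w)) lerXn2r ?nnegrE. Qed.

(** For [c >= 0] the hypothesis gives [b <= 2 * c + 1 = 2 * (c + 2^-1)], because (2 c + 1)^2 >= 1 +
    3 c^2; then one factor [c + 2^-1] is enlarged to [c + 1]. *)
Let tt_max (b c : R) : 1 <= b -> b ^+ 2 <= 1 + 3 * c ^+ 2 -> b ^+ 7 <= 2 ^+ 7 * (tt c + tt (- c)).
Proof.
move=> b1 bc.
wlog c0 : c bc / 0 <= c.
  move=> H; have [/H|/ltW c0] := leP 0 c; first exact.
  by rewrite addrC -{2}(opprK c); apply: H; rewrite ?sqrrN ?oppr_ge0.
apply: (@le_trans _ _ (2 ^+ 7 * tt c)); last first.
  by rewrite ler_wpM2l ?exprn_ge0// lerDl tt_ge0.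
have bc2 : b <= 2 * (c + 2^-1) by nra.
rewrite /tt ppow_pos; last by lra.
apply: (@le_trans _ _ ((2 * (c + 2^-1)) ^+ 7)); first by rewrite lerXn2r ?nnegrE//; lra.
by rewrite exprMn ler_wpM2l ?exprn_ge0// exprSr ler_wpM2l ?exprn_ge0//; lra.
Qed.

Lemma bracket7_le (x y z b : R) : 1 <= b -> b ^+ 2 = 1 + (x ^+ 2 + y ^+ 2 + z ^+ 2) ->
  b ^+ 7 <= 2 ^+ 7 * (tt x + tt (- x) + (tt y + tt (- y)) + (tt z + tt (- z))).
Proof.
move=> b1 bE.
have P u : 0 <= tt u + tt (- u) by rewrite addr_ge0 ?tt_ge0.
have key c S : x ^+ 2 + y ^+ 2 + z ^+ 2 <= 3 * c ^+ 2 -> tt c + tt (- c) <= S -> b ^+ 7 <= 2 ^+ 7 * S.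
  move=> h1 h2; apply: le_trans (tt_max (c := c) b1 _) _; first by rewrite bE; lra.
  by rewrite ler_wpM2l ?exprn_ge0.
have Px := P x; have Py := P y; have Pz := P z.
have [xy|/ltW xy] := leP `|y| `|x|; have xy2 := sq_le_norm xy.
  have [xz|/ltW xz] := leP `|z| `|x|; have xz2 := sq_le_norm xz.
    by apply: (key x); lra.
  by apply: (key z); lra.
have [yz|/ltW yz] := leP `|z| `|y|; have yz2 := sq_le_norm yz.
  by apply: (key y); lra.
by apply: (key z); lra.
Qed.

Let cut_bsq N (v w : R3 R) : bsq v = bsq w -> cut N v = cut N w.
Proof. by rewrite /cut => ->. Qed.

Let has_integral (a : R3 R -> R) (A : R) : Prop :=
  [/\ (forall v, 0 <= a v), measurable_fun [set: M3 R] (a : M3 R -> R) &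
    (\int[lebesgue3]_v (a v)%:E = A%:E)%E].

Let has_integralD a b A B : has_integral a A -> has_integral b B ->
  has_integral (fun v => a v + b v) (A + B).
Proof.
move=> [a0 ma ia] [b0 mb ib]; split.
- by move=> v; rewrite addr_ge0.
- exact: measurable_funD.
under eq_integral do rewrite EFinD.
rewrite ge0_integralD//; first by rewrite ia ib.
- by move=> v _; rewrite lee_fin.
- exact/measurable_EFinP.
- by move=> v _; rewrite lee_fin.
- exact/measurable_EFinP.
Qed.

(** [J] is at most 2^7 times the sum of six directional integrals, so one of these satisfies J <=
    2^7 * 6 * T. With T^4 <= (J * sobC0 * K)^3 this leaves one power of [J] after division by J^3,
    which is legitimate because [J] is a real number. The bound does not involve [N]. *)
Lemma massJ_bound g dg N K J : hasgrad g dg -> (forall v, 0 <= g v) -> 1 <= N ->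
  0 <= K -> (\int[lebesgue3]_v (fisher g v)%:E <= K%:E)%E ->
  (\int[lebesgue3]_v (massJ g N v)%:E = J%:E)%E ->
  J <= (2 ^+ 7 * 6) ^+ 4 * sobC0 ^+ 3 * K ^+ 3.
Proof.
move=> hg g0 N1 K0 IK IJ.
have cg := hasgrad_cont hg.
have mcc := measurableT_comp (@measurable_cyc R) (@measurable_cyc R).
pose c2 := (cyc \o cyc : R3 R -> R3 R).
(* [S1] to [S6] cover the six signed axes. A symmetry is paired with its inverse and [cyc] with
   [cyc \o cyc], so the inverse of [cyc \o cyc] shows up as a fourfold iterate. *)
have S1 := @symmetry_id R; have S2 := @symmetry_refl1 R.
have S3 := @symmetry_cyc R; have S4 := symmetry_comp S3 S2 (@measurable_cyc R).
have S5 := symmetry_comp S3 S3 (@measurable_cyc R).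
have S6 := symmetry_comp S5 S2 mcc.
have B k k' (S : symmetry k k') : (forall v, bsq (k' v) = bsq v) ->
    exists T : R, [/\ 0 <= T, (\int[lebesgue3]_v (kap N (k' v) * g v ^+ 3)%:E = T%:E)%E &
    T ^+ 4 <= (J * (sobC0 * K)) ^+ 3].
  by move=> bk; apply: symmetric_bound S _ hg g0 N1 K0 IK IJ => v; exact: cut_bsq.
have bc v : bsq (cyc v) = bsq v :> R by rewrite /bsq/=; ring.
have br v : bsq (refl1 v) = bsq v :> R by rewrite /bsq/= sqrrN.
have [T1 [T10 E1 B1]] := B _ _ S1 (fun v => erefl).
have [T2 [T20 E2 B2]] := B _ _ S2 br.
have [T3 [T30 E3 B3]] := B _ _ S3 (fun v => etrans (bc _) (bc _)).
have [T4 [T40 E4 B4]] := B _ _ S4 (fun v => etrans (br _) (etrans (bc _) (bc _))).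
have [T5 [T50 E5 B5]] := B _ _ S5 (fun v => etrans (etrans (bc _) (bc _)) (etrans (bc _) (bc _))).
have [T6 [T60 E6 B6]] := B _ _ S6
  (fun v => etrans (br _) (etrans (etrans (bc _) (bc _)) (etrans (bc _) (bc _)))).
(* [wcut ^+ 6] contains <v>^12; divided by <v>^5 it leaves <v>^7, the power that [bracket7_le]
   distributes over the six half-spaces. *)
have pt v : massJ g N v <= 2 ^+ 7 * (kap N v * g v ^+ 3 + kap N (refl1 v) * g v ^+ 3
    + (kap N (cyc (cyc v)) * g v ^+ 3 + kap N (refl1 (cyc (cyc v))) * g v ^+ 3)
    + (kap N (cyc (cyc (cyc (cyc v)))) * g v ^+ 3
       + kap N (refl1 (cyc (cyc (cyc (cyc v))))) * g v ^+ 3)).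
  have kE u : bsq u = bsq v -> kap N u = tt u.1.1 * ppow 6 (cut N v).
    by move=> uv; rewrite /kap /tt (cut_bsq N uv) mulrAC.
  have b1 := bracket_ge1 v; have b0 := bracket_gt0 v.
  have := @bracket7_le v.1.1 v.1.2 v.2 _ b1 (bracket_sq v).
  rewrite (kE v erefl) (kE (refl1 v) (br _)) (kE (cyc (cyc v)) (etrans (bc _) (bc _))).
  rewrite (kE (refl1 (cyc (cyc v))) (etrans (br _) (etrans (bc _) (bc _)))).
  rewrite (kE (cyc (cyc (cyc (cyc v)))) (etrans (etrans (bc _) (bc _)) (etrans (bc _) (bc _)))).
  rewrite (kE (refl1 (cyc (cyc (cyc (cyc v)))))
    (etrans (br _) (etrans (etrans (bc _) (bc _)) (etrans (bc _) (bc _))))) /=.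
  rewrite /massJ ler_pdivrMr ?exprn_gt0// /wcut /ppow -bracket_sq.
  have G0 : 0 <= g v ^+ 3 by exact: exprn_ge0.
  have m0 : 0 <= Num.max (cut N v) 0 ^+ 6 by rewrite exprn_ge0// max0_ge0.
  rewrite exprMn -exprM (_ : bracket v ^+ (2 * 6) = bracket v ^+ 7 * bracket v ^+ 5); last first.
    by rewrite -exprD.
  have p50 : 0 <= bracket v ^+ 5 by rewrite exprn_ge0// ltW.
  move: (tt v.1.1) (tt (- v.1.1)) (tt v.1.2) (tt (- v.1.2)) (tt v.2) (tt (- v.2))
    (Num.max (cut N v) 0 ^+ 6) (g v ^+ 3) (bracket v ^+ 5) (bracket v ^+ 7) (2 ^+ 7 : R) m0 G0 p50
    => t1 t2 t3 t4 t5 t6 m G p5 p7 c m0 G0 p50 h.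
  rewrite (_ : m * (p7 * p5) * G = m * G * p5 * p7); last by ring.
  apply: (@le_trans _ _ (m * G * p5 * (c * (t1 + t2 + (t3 + t4) + (t5 + t6))))).
    by rewrite ler_wpM2l// !mulr_ge0.
  by rewrite le_eqVlt; apply/orP; left; apply/eqP; ring.
have sumE : J <= 2 ^+ 7 * (T1 + T2 + (T3 + T4) + (T5 + T6)).
  have cs (k : R3 R -> R3 R) : (forall v, 0 <= kap N (k v) * g v ^+ 3).
    by move=> v; apply: mulr_ge0; [exact: kap_ge0|exact: exprn_ge0].
  have ms (k : R3 R -> R3 R) : measurable_fun [set: M3 R] (k : M3 R -> M3 R) ->
      measurable_fun [set: M3 R] (fun v : M3 R => (kap N (k v) * g v ^+ 3)%:E).
    move=> mk; apply/measurable_EFinP; apply: measurable_funM; last first.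
      by apply: continuous_measurable3; exact: expr_continuous.
    by apply: measurableT_comp => //; apply: continuous_measurable3; exact: kap_continuous.
  have hi k T : measurable_fun [set: M3 R] (k : M3 R -> M3 R) ->
      (\int[lebesgue3]_v (kap N (k v) * g v ^+ 3)%:E = T%:E)%E ->
      has_integral (fun v => kap N (k v) * g v ^+ 3) T.
    by move=> mk ET; split => //; apply/measurable_EFinP; exact: ms.
  have mr := @measurable_refl1 R; have m4 := measurableT_comp mcc mcc.
  have [S0 mS IS] := has_integralD (has_integralD (has_integralD (hi id _ (@measurable_id _ _ _) E1) (hi _ _ mr E2))
    (has_integralD (hi _ _ mcc E3) (hi _ _ (measurableT_comp mr mcc) E4)))
    (has_integralD (hi _ _ m4 E5) (hi _ _ (measurableT_comp mr m4) E6)).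
  rewrite -lee_fin -IJ EFinM -IS -ge0_integralZl_EFin//; last 2 first.
  - by move=> v _; rewrite lee_fin.
  - exact/measurable_EFinP.
  apply: ge0_le_integral => //.
  - by move=> v _; rewrite lee_fin massJ_ge0.
  - by apply/measurable_EFinP; apply: continuous_measurable3; exact: massJ_continuous.
  - by apply: emeasurable_funM => //; exact/measurable_EFinP.
  - by move=> v _; rewrite -EFinM lee_fin; exact: pt.
have [J0|J0] := leP J 0.
  apply: (le_trans J0); apply: (mulr_ge0 (mulr_ge0 _ (exprn_ge0 3 sobC0_ge0)) (exprn_ge0 3 K0)).
  by rewrite exprn_ge0// mulr_ge0// exprn_ge0.
(* The absorption: J^4 <= C J^3 K^3 with [J > 0]. *)
have big T : 0 <= T -> T ^+ 4 <= (J * (sobC0 * K)) ^+ 3 -> J <= 2 ^+ 7 * 6 * T ->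
    J <= (2 ^+ 7 * 6) ^+ 4 * sobC0 ^+ 3 * K ^+ 3.
  move=> T0 TB JT.
  have c0 : 0 <= 2 ^+ 7 * 6 :> R by rewrite mulr_ge0 ?exprn_ge0.
  have : J ^+ 4 <= (2 ^+ 7 * 6 * T) ^+ 4 by rewrite lerXn2r ?nnegrE ?mulr_ge0// ltW.
  rewrite exprMn => /le_trans; move/(_ ((2 ^+ 7 * 6) ^+ 4 * (J * (sobC0 * K)) ^+ 3)).
  move: (2 ^+ 7 * 6 : R) (sobC0 : R) c0 TB => c d c0 TB; rewrite ler_wpM2l ?exprn_ge0// => /(_ isT).
  rewrite (_ : c ^+ 4 * (J * (d * K)) ^+ 3 = (c ^+ 4 * d ^+ 3 * K ^+ 3) * J ^+ 3); last by ring.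
  by rewrite exprS ler_pM2r// exprn_gt0.
have c0 : 0 < 2 ^+ 7 :> R by rewrite exprn_gt0.
have [h|h1] := leP J (2 ^+ 7 * 6 * T1); first exact: big h.
have [h|h2] := leP J (2 ^+ 7 * 6 * T2); first exact: big h.
have [h|h3] := leP J (2 ^+ 7 * 6 * T3); first exact: big h.
have [h|h4] := leP J (2 ^+ 7 * 6 * T4); first exact: big h.
have [h|h5] := leP J (2 ^+ 7 * 6 * T5); first exact: big h.
have [h|h6] := leP J (2 ^+ 7 * 6 * T6); first exact: big h.
exfalso; move: (2 ^+ 7 : R) c0 sumE h1 h2 h3 h4 h5 h6 => c c0.
rewrite -!mulrA !mulrDr ![c * (6 * _)]mulrCA.
move: (c * T1) (c * T2) (c * T3) (c * T4) (c * T5) (c * T6) => a1 a2 a3 a4 a5 a6.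
lra.
Qed.

Definition sobC : R := (2 ^+ 7 * 6) ^+ 4 * sobC0 ^+ 3.

(** Monotone convergence along [N = n + 1]: [wcut] increases to 1 and the bound on [massJ] is
    uniform in [N]. *)
Lemma weighted_sobolev g dg K : hasgrad g dg -> (forall v, 0 <= g v) ->
  0 <= K -> (\int[lebesgue3]_v (fisher g v)%:E <= K%:E)%E ->
  (\int[lebesgue3]_v (g v ^+ 3 / bracket v ^+ 5)%:E <= (sobC * K ^+ 3)%:E)%E.
Proof.
move=> hg g0 K0 IK.
have cg := hasgrad_cont hg.
pose f (n : nat) (v : M3 R) : \bar R := (massJ g n.+1%:R v)%:E.
have N1 n : 1 <= n.+1%:R :> R by rewrite ler1n.
have mf n : measurable_fun [set: M3 R] (f n).
  by apply/measurable_EFinP; apply: continuous_measurable3; exact: massJ_continuous.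
have f0 n v : [set: M3 R] v -> (0 <= f n v)%E by move=> _; rewrite lee_fin massJ_ge0.
have ndf v : [set: M3 R] v -> {homo f ^~ v : n m / (n <= m)%N >-> (n <= m)%E}.
  move=> _ n m nm; rewrite lee_fin /massJ.
  rewrite ler_pM2r ?invr_gt0 ?exprn_gt0 ?bracket_gt0//.
  rewrite ler_wpM2r ?exprn_ge0// lerXn2r ?nnegrE ?wcut_ge0//.
  have cnm : cut n.+1%:R v <= cut m.+1%:R v.
    by rewrite /cut lerD2l lerN2 lef_pV2 ?posrE ?ltr0n// ler_nat ltnS.
  by rewrite /wcut ler_pM2r ?bsq_gt0// ge_max !le_max lexx orbT andbT cnm.
have lf v : f n v @[n --> \oo] --> (g v ^+ 3 / bracket v ^+ 5)%:E.
  apply: cvg_EFin; first by near=> n.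
  have -> : fine \o f ^~ v = (fun n => (Num.max ((bsq v)^-1 - n.+1%:R^-1) 0 * bsq v) ^+ 6 * g v ^+ 3 / bracket v ^+ 5) by [].
  rewrite -[X in _ --> X]mul1r mulrA; apply: cvgM; last exact: cvg_cst.
  apply: cvgM; last exact: cvg_cst.
  pose Psi (x : R) : R := (Num.max ((bsq v)^-1 - x) 0 * bsq v) ^+ 6.
  have cPsi : continuous Psi.
    move=> x; apply: (@continuous_comp _ _ _ (fun x : R => Num.max ((bsq v)^-1 - x) 0 * bsq v) (fun x => x ^+ 6)).
      apply: cvgM; last exact: cvg_cst.
      apply: (@continuous_max _ _ (fun x : R => (bsq v)^-1 - x) (cst 0)); last exact: cvg_cst.
      by apply: cvgB; [exact: cvg_cst|exact: cvg_id].
    exact: exprn_continuous.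
  have P0 : Psi 0 = 1.
    rewrite /Psi subr0 max_l ?invr_ge0 ?(ltW (bsq_gt0 v))// mulVf ?expr1n//.
    by rewrite gt_eqF// bsq_gt0.
  by rewrite -[X in _ --> X]P0; exact: (cvg_comp _ _ (@cvg_harmonic R) (cPsi 0)).
have -> : (fun v => (g v ^+ 3 / bracket v ^+ 5)%:E) = (fun v => limn (f ^~ v)).
  by apply/funext => v; apply/esym/cvg_lim => //; exact: lf.
rewrite monotone_convergence//.
apply: lime_le.
  apply: ereal_nondecreasing_is_cvgn => n m nm; apply: ge0_le_integral => //.
  - by move=> v _; exact: f0.
  - by move=> v _; exact: ndf.
near=> n.
have [J J0 JE] : exists2 J : R, 0 <= J & (\int[lebesgue3]_v (massJ g n.+1%:R v)%:E = J%:E)%E.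
  apply: (@boxed_integral _ (n.+1%:R) _ (N1 n)).
  - exact: massJ_continuous.
  - by move=> v; exact: massJ_ge0.
  - by move=> v cv; rewrite /massJ /wcut max_r// mul0r expr0n/= !mul0r.
rewrite /f JE lee_fin; exact: massJ_bound hg g0 (N1 n) K0 IK JE.
Unshelve. all: by end_near. Qed.

End Sobolev.

(** * Nondegeneracy of the mass distribution *)

Section Nondegeneracy.
Context {R : realType}.
Local Notation leb := (@lebesgue_measure R).
Implicit Types (g : R3 R -> R).

Definition lform (a : R3 R) (v : R3 R) : R := a.1.1 * v.1.1 + a.1.2 * v.1.2 + a.2 * v.2.

Definition slab (a : R3 R) (c beta rho : R) : set (M3 R) :=
  [set v | [/\ `|v.1.1| <= rho, `|v.1.2| <= rho, `|v.2| <= rho & `|lform a v - c| < beta]].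

Lemma lform_continuous a : continuous (lform a).
Proof.
have X := @coord3_continuous R j0; have Y := @coord3_continuous R j1; have Z := @coord3_continuous R j2.
move=> v; apply: cvgD; first apply: cvgD.
- by apply: cvgM; [exact: cvg_cst|exact: X].
- by apply: cvgM; [exact: cvg_cst|exact: Y].
- by apply: cvgM; [exact: cvg_cst|exact: Z].
Qed.

Lemma measurable_slab a c beta rho : measurable (slab a c beta rho).
Proof.
have -> : slab a c beta rho = (box rho `&` (fun v => `|lform a v - c|) @^-1` `]-oo, beta[%classic).
  apply/seteqP; split => v /=.
    by case=> h1 h2 h3 h4; split; [apply/boxP; exact: ord3_ind|rewrite in_itv].
  move=> [/boxP h]; rewrite in_itv/= => hb.
  by split => //; [exact: (h j0)|exact: (h j1)|exact: (h j2)].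
apply: measurableI; first exact: measurable_box.
rewrite -[X in measurable X]setTI.
have mf : measurable_fun [set: M3 R] (fun v : M3 R => `|lform a v - c|).
  apply: measurableT_comp => //; apply: measurable_funB => //.
  by apply: continuous_measurable3; exact: lform_continuous.
by apply: mf.
Qed.

Lemma lebesgue3_indic (A : set (M3 R)) : measurable A ->
  (lebesgue3 A = \int[lebesgue3]_v (\1_A v : R)%:E)%E.
Proof. by move=> mA; rewrite (@integral_indic _ _ R lebesgue3 setT measurableT A mA) setIT. Qed.

Lemma integral_indic_itv (a b : R) : a <= b ->
  (\int[leb]_x (\1_(`[a, b]) x : R)%:E = (b - a)%:E)%E.
Proof.
move=> ab; transitivity (leb `[a, b]%classic); first by rewrite integral_indic// setIT.
rewrite lebesgue_measure_itv/= lte_fin.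
by have [|ba] := ltP a b; [rewrite -EFinB|rewrite (_ : b = a) ?subrr//; apply/eqP; rewrite eq_le ab ba].
Qed.

(** For given x and y the third coordinate is confined to an interval of length at most 2 beta /
    |a_3|, and (x, y) to a square of area 4 rho^2. *)
Lemma lebesgue3_slab_last a c beta rho : 0 <= beta -> 0 <= rho -> a.2 != 0 ->
  (lebesgue3 (slab a c beta rho) <= (8 * rho ^+ 2 * (beta / `|a.2|))%:E)%E.
Proof.
move=> b0 r0 a2.
rewrite (lebesgue3_indic (measurable_slab _ _ _ _)).
pose I := \1_(`[- rho, rho]) : R -> R.
have mI : measurable_fun [set: M1 R] (I : M1 R -> R) by exact: measurable_indic.
have I0 x : 0 <= I x by [].
rewrite lebesgue3_tonelli; last 2 first.
- apply/measurable_EFinP; apply: measurable_indic; exact: measurable_slab.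
- by move=> v; rewrite lee_fin.
set d := beta / `|a.2|.
have d0 : 0 <= d by rewrite divr_ge0.
have inner x y : (\int[leb]_z (\1_(slab a c beta rho) (x, y, z) : R)%:E <= (I x * I y * (2 * d))%:E)%E.
  pose z0 := (c - a.1.1 * x - a.1.2 * y) / a.2.
  apply: (@le_trans _ _ (\int[leb]_z ((I x * I y)%:E * (\1_(`[z0 - d, z0 + d]) z : R)%:E))%E).
    apply: ge0_le_integral => //.
    - apply/measurable_EFinP; apply: (measurableT_comp (f := \1_(slab a c beta rho) : M3 R -> R)).
        by apply: measurable_indic; exact: measurable_slab.
      exact: pair1_measurable.
    - by apply: emeasurable_funM => //; apply/measurable_EFinP; exact: measurable_indic.
    - move=> z _; rewrite -EFinM lee_fin indicE; case: (boolP (_ \in _)) => [|_]; last first.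
        by rewrite !mulr_ge0.
      rewrite inE /slab /lform /= => -[h1 h2 h3 h4].
      rewrite /I !indicE !mem_set ?mulr1//= in_itv/= -?ler_norml//.
      rewrite -ler_distlC /z0 /d ler_pdivlMr ?normr_gt0// -normrM mulrBl mulfVK//.
      apply/ltW; rewrite distrC -normrN; apply: le_lt_trans h4.
      by rewrite le_eqVlt; apply/orP; left; apply/eqP; rewrite -normrN; congr `| _ |; ring.
  rewrite ge0_integralZl_EFin//; last 2 first.
  - by apply/measurable_EFinP; exact: measurable_indic.
  - by rewrite mulr_ge0.
  rewrite integral_indic_itv; last by lra.
  rewrite -EFinM lee_fin (_ : z0 + d - (z0 - d) = 2 * d) //; ring.
have IE : (\int[leb]_x (I x)%:E = (2 * rho)%:E)%E.
  by rewrite integral_indic_itv; [congr EFin; ring|lra].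
apply: (@le_trans _ _ (\int[leb]_x ((I x)%:E * (\int[leb]_y ((I y)%:E * (2 * d)%:E))))%E).
  apply: ge0_le_integral => //.
  - by move=> x _; apply: integral_ge0 => y _; apply: integral_ge0 => z _; rewrite lee_fin.
  - have mS : measurable_fun [set: M3 R] (fun v : M3 R => (\1_(slab a c beta rho) v : R)%:E).
      by apply/measurable_EFinP; apply: measurable_indic; exact: measurable_slab.
    apply: (@measurable_fun_fubini_tonelli_F _ _ (M1 R) (M1 R) R leb
      (fun p => \int[leb]_z (\1_(slab a c beta rho) (p, z) : R)%:E)%E).
      apply: (@measurable_fun_fubini_tonelli_F _ _ (M2 R) (M1 R) R leb
        (fun v : M3 R => (\1_(slab a c beta rho) v : R)%:E)%E) => //.
    by move=> p; apply: integral_ge0 => z _; rewrite lee_fin.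
  - by apply: emeasurable_funM => //; exact/measurable_EFinP.
  - move=> x _; rewrite -ge0_integralZl//; last 3 first.
    + by apply: emeasurable_funM => //; exact/measurable_EFinP.
    + by move=> y _; rewrite mule_ge0// lee_fin ?mulr_ge0.
    + by rewrite lee_fin.
    apply: ge0_le_integral => //.
    + by move=> y _; apply: integral_ge0 => z _; rewrite lee_fin.
    + have mS : measurable_fun [set: M2 R] (fun p : M2 R => (\1_(slab a c beta rho) (x, p.1, p.2) : R)%:E).
        apply/measurable_EFinP; apply: (measurableT_comp (f := \1_(slab a c beta rho) : M3 R -> R)).
          by apply: measurable_indic; exact: measurable_slab.
        by apply: measurable_fun_pair => //; apply: measurable_fun_pair.
      apply: (@measurable_fun_fubini_tonelli_F _ _ (M1 R) (M1 R) R leb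
         (fun p => (\1_(slab a c beta rho) (x, p.1, p.2) : R)%:E)) => //.
    + by apply: emeasurable_funM => //; apply: emeasurable_funM => //; exact/measurable_EFinP.
    + by move=> y _; rewrite -!EFinM mulrA; exact: inner.
have mIe : measurable_fun [set: M1 R] (fun x : M1 R => (I x)%:E) by exact/measurable_EFinP.
have Ie0 x : [set: M1 R] x -> (0 <= (I x)%:E)%E by rewrite lee_fin.
have JE : (\int[leb]_y ((I y)%:E * (2 * d)%:E) = (2 * rho * (2 * d))%:E)%E.
  by rewrite (ge0_integralZr _ measurableT mIe Ie0) ?IE// lee_fin mulr_ge0.
rewrite JE (ge0_integralZr _ measurableT mIe Ie0) ?IE ?lee_fin ?mulr_ge0//.
by rewrite le_eqVlt; apply/orP; left; apply/eqP; ring.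
Qed.

Lemma lebesgue3_slab a c beta rho k : 0 <= beta -> 0 <= rho -> coord3 a k != 0 ->
  (lebesgue3 (slab a c beta rho) <= (8 * rho ^+ 2 * (beta / `|coord3 a k|))%:E)%E.
Proof.
have rot a' : lebesgue3 (slab a' c beta rho) = lebesgue3 (slab (cyc a') c beta rho).
  rewrite !(lebesgue3_indic (measurable_slab _ _ _ _)).
  rewrite -[RHS]lebesgue3_cyc; last 2 first.
  - by apply/measurable_EFinP; apply: measurable_indic; exact: measurable_slab.
  - by move=> v; rewrite lee_fin.
  apply: eq_integral => v _; rewrite !indicE; congr (_%:R%:E); congr nat_of_bool.
  apply/idP/idP; rewrite !inE /slab/= /lform/=.
    by move=> [? ? ? h]; split => //; apply: le_lt_trans h; rewrite le_eqVlt; apply/orP; left; apply/eqP; congr `| _ |; ring.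
  by move=> [? ? ? h]; split => //; apply: le_lt_trans h; rewrite le_eqVlt; apply/orP; left; apply/eqP; congr `| _ |; ring.
move=> b0 r0; elim/ord3_ind: k => ak.
- by rewrite rot rot; apply: lebesgue3_slab_last.
- by rewrite rot; apply: lebesgue3_slab_last.
- exact: lebesgue3_slab_last.
Qed.

Lemma gauss3_integral :
  (\int[lebesgue3]_v (expR (- (v.1.1 ^+ 2 + v.1.2 ^+ 2 + v.2 ^+ 2)) : R)%:E
   = (Num.sqrt pi ^+ 3)%:E)%E.
Proof.
pose G (x : R) : \bar R := (gauss_fun x)%:E.
have mG : measurable_fun [set: M1 R] (G : M1 R -> \bar R).
  by apply/measurable_EFinP; exact: measurable_gauss_fun.
have G0 x : (0 <= G x)%E by rewrite lee_fin gauss_fun_ge0.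
have IG : (\int[leb]_x G x = (Num.sqrt pi)%:E)%E by exact: integralT_gauss.
have E v : (expR (- (v.1.1 ^+ 2 + v.1.2 ^+ 2 + v.2 ^+ 2)) : R)%:E = (G v.1.1 * (G v.1.2 * G v.2))%E.
  by rewrite /G /gauss_fun -!EFinM -!expRD; congr (expR _)%:E; ring.
under eq_integral do rewrite E.
have s0 : (0 <= (Num.sqrt pi : R)%:E)%E by rewrite lee_fin sqrtr_ge0.
rewrite lebesgue3_tonelli; last 2 first.
- apply: emeasurable_funM; first exact: (measurableT_comp mG (@measurable_proj1 R)).
  apply: emeasurable_funM; first exact: (measurableT_comp mG (@measurable_proj2 R)).
  exact: (measurableT_comp mG (@measurable_proj3 R)).
- by move=> v; rewrite !mule_ge0.
have Gs0 x : [set: M1 R] x -> (0 <= G x)%E by [].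
have s20 : (0 <= (Num.sqrt pi ^+ 2 : R)%:E)%E by rewrite lee_fin sqr_ge0.
have in1 y : (\int[leb]_z (G y * G z) = G y * (Num.sqrt pi)%:E)%E.
  by rewrite (ge0_integralZl _ measurableT mG Gs0 (G0 y)) IG.
have in2 : (\int[leb]_y (G y * (Num.sqrt pi)%:E) = (Num.sqrt pi ^+ 2)%:E)%E.
  by rewrite (ge0_integralZr _ measurableT mG Gs0 s0) IG -EFinM.
transitivity (\int[leb]_x (G x * (Num.sqrt pi ^+ 2)%:E))%E; last first.
  by rewrite (ge0_integralZr _ measurableT mG Gs0 s20) IG -EFinM -exprS.
apply: eq_integral => x _ /=.
transitivity (\int[leb]_y (G x * (G y * (Num.sqrt pi)%:E)))%E.
  apply: eq_integral => y _ /=; rewrite -in1.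
  apply: (ge0_integralZl _ measurableT _ _ (G0 x)); first exact: emeasurable_funM.
  by move=> z _; rewrite mule_ge0.
rewrite -in2; apply: (ge0_integralZl _ measurableT _ _ (G0 x)); first exact: emeasurable_funM.
by move=> z _; rewrite mule_ge0.
Qed.

(** Convex duality between s log s and the exponential. With [a] = |v|^2 it bounds the negative part
    of g log g by the energy density plus a Gaussian. *)
Lemma entropy_young (s a : R) : 0 <= s -> - (s * ln s) <= s * a + expR (- a).
Proof.
rewrite le_eqVlt => /predU1P[<-|s0]; first by rewrite !mul0r oppr0 add0r expR_ge0.
have h := expR_ge1Dx (- a - ln s).
have E : expR (- a - ln s) = expR (- a) / s by rewrite expRD (expRN (ln s)) lnK.
rewrite E in h.
have : s * (1 + (- a - ln s)) <= expR (- a).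
  by rewrite mulrC -ler_pdivlMr// mulrC.
by nra.
Qed.

(** The entropy hypothesis bounds a difference of positive and negative parts. The negative part is
    finite, at most the energy plus pi^(3/2), so it can be moved to the other side. *)
Lemma pos_entropy_bound g (E0 H0 : R) : continuous g -> (forall v, 0 <= g v) ->
  (\int[lebesgue3]_v (g v * enorm v ^+ 2)%:E <= E0%:E)%E ->
  (\int[lebesgue3]_v (g v * ln (g v))%:E <= H0%:E)%E ->
  (\int[lebesgue3]_v (Num.max (g v * ln (g v)) 0)%:E <= (H0 + (E0 + Num.sqrt pi ^+ 3))%:E)%E.
Proof.
move=> cg g0 hE hH.
pose phi (v : M3 R) : \bar R := (g v * ln (g v))%:E.
have mg : measurable_fun [set: M3 R] (g : M3 R -> R) by exact: continuous_measurable3.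
have mphi : measurable_fun [set: M3 R] phi.
  by apply/measurable_EFinP; apply: measurable_funM => //; exact: measurableT_comp.
have mE : measurable_fun [set: M3 R] (fun v : M3 R => (g v * enorm v ^+ 2)%:E).
  apply/measurable_EFinP; apply: measurable_funM => //; apply: continuous_measurable3.
  have -> : (fun v : R3 R => enorm v ^+ 2) = (fun v => bsq v - 1).
    by apply/funext => v; rewrite enorm_sq /bsq [RHS]addrC addKr.
  by move=> v; apply: cvgB; [exact: bsq_continuous|exact: cvg_cst].
have mX : measurable_fun [set: M3 R] (fun v : M3 R => (expR (- (v.1.1 ^+ 2 + v.1.2 ^+ 2 + v.2 ^+ 2)) : R)%:E).
  apply/measurable_EFinP; apply: measurableT_comp => //; apply: measurableT_comp => //.
  have m1 := @measurable_proj1 R; have m2 := @measurable_proj2 R; have m3 := @measurable_proj3 R.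
  by apply: measurable_funD; [apply: measurable_funD|]; exact: measurable_funX.
have neg : (\int[lebesgue3]_v phi^\- v <= (E0 + Num.sqrt pi ^+ 3)%:E)%E.
  apply: (@le_trans _ _ (\int[lebesgue3]_v ((g v * enorm v ^+ 2)%:E
      + (expR (- (v.1.1 ^+ 2 + v.1.2 ^+ 2 + v.2 ^+ 2)) : R)%:E))%E).
    apply: ge0_le_integral => //.
    - exact: measurable_funeneg.
    - exact: emeasurable_funD.
    - move=> v _; rewrite funenegE ge_max; apply/andP; split.
        by rewrite -EFinN -EFinD lee_fin enorm_sq; exact: entropy_young.
      by rewrite -EFinD lee_fin addr_ge0 ?expR_ge0// mulr_ge0// sqr_ge0.
  rewrite ge0_integralD//.
  - by rewrite gauss3_integral EFinD leeD.
  by move=> v _; rewrite lee_fin mulr_ge0// sqr_ge0.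
have -> : (\int[lebesgue3]_v (Num.max (g v * ln (g v)) 0)%:E = \int[lebesgue3]_v phi^\+ v)%E.
  by apply: eq_integral => v _; rewrite funeposE EFin_max.
move: hH; rewrite integralE -/phi.
have n0 : (0 <= \int[lebesgue3]_v phi^\- v)%E by exact: integral_ge0.
move: neg n0; case: (\int[lebesgue3]_v phi^\- v)%E => [r| |]//.
rewrite !lee_fin => rE r0.
rewrite leeBlDr// => /le_trans; apply.
by rewrite -EFinD lee_fin lerD2l.
Qed.

(** On [box rho] one has <v>^2 <= 3 rho^2 + 1; the additional unit makes [chi] at least 1 there. *)
Definition chiN (rho : R) : R := 3 * rho ^+ 2 + 2.

Definition chi (rho : R) (v : R3 R) : R := ppow 2 (chiN rho - bsq v).

Lemma chi_ge1 rho v : box rho v -> 1 <= chi rho v.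
Proof.
move=> /boxP h; have sq i : coord3 v i ^+ 2 <= rho ^+ 2.
  have r0 : 0 <= rho := le_trans (normr_ge0 _) (h i).
  by rewrite -(real_normK (num_real (coord3 v i))) lerXn2r ?nnegrE.
have := sq j0; have := sq j1; have := sq j2; rewrite /coord3/= => h1 h2 h3.
have h4 : 1 <= chiN rho - bsq v by rewrite /chiN /bsq; lra.
by rewrite /chi ppow_pos ?exprn_ege1//; lra.
Qed.

Lemma chi_continuous rho : continuous (chi rho).
Proof.
move=> v; apply: (@continuous_comp _ _ _ (fun v : R3 R => chiN rho - bsq v) (ppow 2)).
  by apply: cvgB; [exact: cvg_cst|exact: bsq_continuous].
exact: ppow_continuous.
Qed.

Lemma max_coord3 (a : R3 R) : exists k, a.1.1 ^+ 2 + a.1.2 ^+ 2 + a.2 ^+ 2 <= 3 * coord3 a k ^+ 2.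
Proof.
have [xy|/ltW xy] := leP (a.1.2 ^+ 2) (a.1.1 ^+ 2).
  have [xz|/ltW xz] := leP (a.2 ^+ 2) (a.1.1 ^+ 2).
    by exists j0; rewrite /coord3/=; lra.
  by exists j2; rewrite /coord3/=; lra.
have [yz|/ltW yz] := leP (a.2 ^+ 2) (a.1.2 ^+ 2).
  by exists j1; rewrite /coord3/=; lra.
by exists j2; rewrite /coord3/=; lra.
Qed.

Lemma le_integralZ (k B : R) (u : M3 R -> R) : 0 <= k -> (forall v, 0 <= u v) ->
  measurable_fun [set: M3 R] (fun v : M3 R => (u v)%:E) ->
  (\int[lebesgue3]_v (u v)%:E <= B%:E)%E -> (\int[lebesgue3]_v (k * u v)%:E <= (k * B)%:E)%E.
Proof.
move=> k0 u0 mu hB; under eq_integral do rewrite EFinM.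
rewrite ge0_integralZl_EFin//; first by rewrite [leRHS]EFinM lee_wpmul2l ?lee_fin.
by move=> v _; rewrite lee_fin.
Qed.

(** [rho] and [lam] are chosen before g, the direction [a] and the offset [c]: the covariance of chi
    g is bounded below uniformly over all profiles obeying the mass, energy and entropy bounds. *)
Lemma nondegenerate (m0 E0 H0 : R) : 0 < m0 -> 0 < E0 ->
  exists rho lam : R, [/\ 0 < rho, 0 < lam & forall g, continuous g -> (forall v, 0 <= g v) ->
    (m0%:E <= \int[lebesgue3]_v (g v)%:E)%E ->
    (\int[lebesgue3]_v (g v * enorm v ^+ 2)%:E <= E0%:E)%E ->
    (\int[lebesgue3]_v (g v * ln (g v))%:E <= H0%:E)%E ->
    forall (a : R3 R) (c : R),
      ((lam * (a.1.1 ^+ 2 + a.1.2 ^+ 2 + a.2 ^+ 2))%:E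
        <= \int[lebesgue3]_v (chi rho v * g v * (lform a v - c) ^+ 2)%:E)%E].
Proof.
move=> m00 E00.
(* The mass [m0] is budgeted: [rho] leaves at most m0 / 4 outside the box, [l] makes the part where
   g exceeds [L = expR l] at most C1 / l = m0 / 8, and [eps] makes the slab contribute at most L * 8
   rho^2 * eps = m0 / 8. The remaining m0 / 2 must come from the quadratic term, which fixes
   [lam]. *)
pose C1 := `|H0| + (E0 + Num.sqrt pi ^+ 3).
have C10 : 0 < C1 by rewrite /C1 ltr_wpDl// ltr_pwDl// exprn_ge0// sqrtr_ge0.
pose l := 8 * C1 / m0; have l0 : 0 < l by rewrite divr_gt0// mulr_gt0.
pose L := expR l; have L0 : 0 < L by exact: expR_gt0.
pose rho := 2 * (1 + E0 / m0).
have Em0 : 0 < E0 / m0 by rewrite divr_gt0.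
have rho0 : 0 < rho by rewrite /rho; lra.
have rhoE : E0 / rho ^+ 2 <= m0 / 4.
  rewrite ler_pdivrMr ?exprn_gt0//.
  have -> : E0 = m0 * (E0 / m0) by field; rewrite gt_eqF.
  rewrite /rho; move: (E0 / m0) Em0 => e e0; rewrite -subr_ge0.
  have -> : m0 / 4 * (2 * (1 + e)) ^+ 2 - m0 * e = m0 * (1 + e + e ^+ 2) by field.
  by rewrite mulr_ge0 ?ltW// addr_gt0 ?exprn_gt0// addr_gt0.
pose eps := m0 / (64 * L * rho ^+ 2).
have eps0 : 0 < eps.
  by apply: divr_gt0 => //; apply: mulr_gt0; [exact: mulr_gt0|exact: exprn_gt0].
exists rho, (eps ^+ 2 / 3 * (m0 / 2)); split => //.
  by apply: mulr_gt0; [apply: divr_gt0 => //; exact: exprn_gt0|exact: divr_gt0].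
move=> g cg g0 hm hE hH a c.
set na := a.1.1 ^+ 2 + a.1.2 ^+ 2 + a.2 ^+ 2.
have X0 v : 0 <= chi rho v * g v * (lform a v - c) ^+ 2.
  by rewrite mulr_ge0 ?sqr_ge0// mulr_ge0// ppow_ge0.
have na0 : 0 <= na by rewrite !addr_ge0 ?sqr_ge0.
have [->|nan] := eqVneq na 0.
  by rewrite mulr0; apply: integral_ge0 => v _; rewrite lee_fin.
have nap : 0 < na by rewrite lt_neqAle eq_sym nan.
(* Scaling the half-width of the slab by the dominant coefficient makes the volume bound independent
   of [a]; |a_k|^2 >= |a|^2 / 3 is the source of the 3 in [K] and in [lam]. *)
have [k ak] := max_coord3 a; rewrite -/na in ak.
have ak0 : coord3 a k != 0.
  by apply: contraTneq nap => ak0; move: ak; rewrite ak0 expr0n/= mulr0 leNgt.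
pose A := slab a c (eps * `|coord3 a k|) rho.
have mA : measurable A by exact: measurable_slab.
have volA : (lebesgue3 A <= (8 * rho ^+ 2 * eps)%:E)%E.
  have := @lebesgue3_slab a c (eps * `|coord3 a k|) rho k _ (ltW rho0) ak0.
  by rewrite mulfK ?normr_eq0//; apply; rewrite mulr_ge0// ltW.
pose K := 3 / (eps ^+ 2 * na).
have K0 : 0 < K by rewrite divr_gt0// mulr_gt0// exprn_gt0.
(* [g] is controlled by the integrand where the affine form is large, by the energy
   outside the box, by [L] on a thin slab, and by the entropy where it exceeds [L]. *)
pose T1 v := K * (chi rho v * g v * (lform a v - c) ^+ 2).
pose T2 v := (rho ^+ 2)^-1 * (g v * enorm v ^+ 2).
pose T3 (v : M3 R) : R := L * \1_A v.
pose T4 v := l^-1 * Num.max (g v * ln (g v)) 0.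
have pt v : g v <= T1 v + T2 v + T3 v + T4 v.
  have T10 : 0 <= T1 v by rewrite mulr_ge0 ?(ltW K0).
  have T20 : 0 <= T2 v by rewrite mulr_ge0 ?invr_ge0 ?sqr_ge0// mulr_ge0 ?sqr_ge0.
  have T30 : 0 <= T3 v by rewrite mulr_ge0 ?(ltW L0).
  have T40 : 0 <= T4 v by rewrite mulr_ge0 ?invr_ge0 ?(ltW l0) ?max0_ge0.
  have [bv|nbv] := pselect (box rho v).
    have [Av|nAv] := pselect (A v).
      have -> : T3 v = L by rewrite /T3 indicE mem_set// mulr1.
      have [gL|gL] := leP (g v) L; first lra.
      have lg : l <= ln (g v) by rewrite -(expRK l) ler_ln ?posrE ?expR_gt0 ?(lt_trans L0 gL)// ltW.
      suff : g v <= T4 v by lra.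
      rewrite /T4 mulrC ler_pdivlMr// le_max; apply/orP; left.
      by rewrite ler_wpM2l.
    have big : eps * `|coord3 a k| <= `|lform a v - c|.
      rewrite leNgt; apply/negP => h; apply: nAv; move/boxP: bv => bv.
      by split => //; [exact: (bv j0)|exact: (bv j1)|exact: (bv j2)].
    have big2 : eps ^+ 2 * na <= 3 * (lform a v - c) ^+ 2.
      rewrite -(real_normK (num_real (lform a v - c))).
      apply: (@le_trans _ _ (3 * (eps * `|coord3 a k|) ^+ 2)).
        have -> : (eps * `|coord3 a k|) ^+ 2 = eps ^+ 2 * coord3 a k ^+ 2 by rewrite [LHS]exprMn real_normK ?num_real.
        by rewrite mulrCA ler_wpM2l ?sqr_ge0.
      by rewrite ler_wpM2l// lerXn2r ?nnegrE// mulr_ge0// ltW.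
    suff : g v <= T1 v by lra.
    have c1 := chi_ge1 bv.
    have en0 : 0 < eps ^+ 2 * na by apply: mulr_gt0 => //; exact: exprn_gt0.
    rewrite /T1 /K mulrAC ler_pdivlMr//.
    move: (g v) (chi rho v) (g0 v) c1 (eps ^+ 2 * na) ((lform a v - c) ^+ 2) (sqr_ge0 (lform a v - c)) big2.
    move=> x y x0 y1 e z z0 ez.
    apply: (@le_trans _ _ (x * (3 * z))); first by rewrite ler_wpM2l.
    rewrite -subr_ge0 (_ : _ - _ = 3 * ((y - 1) * (x * z))); last by ring.
    by rewrite mulr_ge0// mulr_ge0 ?subr_ge0// mulr_ge0.
  suff : g v <= T2 v by lra.
  rewrite /T2 mulrC mulrAC -mulrA ler_peMr//.
  rewrite mulrC ler_pdivlMr ?exprn_gt0// mul1r enorm_sq.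
  move/boxP: nbv => /existsNP[i /negP]; rewrite -ltNge => hi.
  have : rho ^+ 2 <= coord3 v i ^+ 2.
    by rewrite -(real_normK (num_real (coord3 v i))) lerXn2r ?nnegrE ?(ltW rho0)// ltW.
  have h1 := sqr_ge0 v.1.1; have h2 := sqr_ge0 v.1.2; have h3 := sqr_ge0 v.2.
  by move: i {hi}; elim/ord3_ind; rewrite /coord3/= => h; clear -h h1 h2 h3; lra.
have mg : measurable_fun [set: M3 R] (g : M3 R -> R) by exact: continuous_measurable3.
have m1 : measurable_fun [set: M3 R] (fun v : M3 R => (chi rho v * g v * (lform a v - c) ^+ 2)%:E).
  apply/measurable_EFinP; apply: continuous_measurable3 => v.
  apply: cvgM; first by apply: cvgM; [exact: chi_continuous|exact: cg].
  apply: (@continuous_comp _ _ _ (fun v => lform a v - c) (fun x => x ^+ 2)); last exact: exprn_continuous.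
  by apply: cvgB; [exact: lform_continuous|exact: cvg_cst].
have m2 : measurable_fun [set: M3 R] (fun v : M3 R => (g v * enorm v ^+ 2)%:E).
  apply/measurable_EFinP; apply: measurable_funM => //; apply: continuous_measurable3.
  have -> : (fun v : R3 R => enorm v ^+ 2) = (fun v => bsq v - 1).
    by apply/funext => v; rewrite enorm_sq /bsq [RHS]addrC addKr.
  by move=> v; apply: cvgB; [exact: bsq_continuous|exact: cvg_cst].
have m3 : measurable_fun [set: M3 R] (fun v : M3 R => (\1_A v : R)%:E).
  by apply/measurable_EFinP; exact: measurable_indic.
have m4 : measurable_fun [set: M3 R] (fun v : M3 R => (Num.max (g v * ln (g v)) 0)%:E).
  apply/measurable_EFinP; apply: measurable_maxr => //.
  by apply: measurable_funM => //; exact: measurableT_comp.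
have I2 : (\int[lebesgue3]_v (T2 v)%:E <= ((rho ^+ 2)^-1 * E0)%:E)%E.
  by apply: le_integralZ => // [|v]; [rewrite invr_ge0 sqr_ge0|rewrite mulr_ge0 ?sqr_ge0].
have I3 : (\int[lebesgue3]_v (T3 v)%:E <= (L * (8 * rho ^+ 2 * eps))%:E)%E.
  by apply: le_integralZ => //; [exact: ltW|rewrite -lebesgue3_indic].
have I4 : (\int[lebesgue3]_v (T4 v)%:E <= (l^-1 * C1)%:E)%E.
  apply: le_integralZ => //; [by rewrite invr_ge0 ltW|by move=> v; exact: max0_ge0|].
  apply: le_trans (pos_entropy_bound cg g0 hE hH) _.
  by rewrite lee_fin lerD2r ler_norm.
have [Xy|Xn] := eqVneq (\int[lebesgue3]_v (chi rho v * g v * (lform a v - c) ^+ 2)%:E)%E +oo%E.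
  by rewrite Xy leey.
have Xge : (0 <= \int[lebesgue3]_v (chi rho v * g v * (lform a v - c) ^+ 2)%:E)%E.
  by apply: integral_ge0 => v _; rewrite lee_fin.
have [X XE] : exists X : R, (\int[lebesgue3]_v (chi rho v * g v * (lform a v - c) ^+ 2)%:E = X%:E)%E.
  by move: Xn Xge; case: (\int[lebesgue3]_v _)%E => [r _ _| |]//; exists r.
have I1 : (\int[lebesgue3]_v (T1 v)%:E <= (K * X)%:E)%E by apply: le_integralZ => //; [exact: ltW|rewrite XE].
have T20 v : 0 <= T2 v by rewrite mulr_ge0 ?invr_ge0 ?sqr_ge0// mulr_ge0 ?sqr_ge0.
have T10 v : 0 <= T1 v by rewrite mulr_ge0 ?(ltW K0).
have T30 v : 0 <= T3 v by rewrite mulr_ge0 ?(ltW L0).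
have T40 v : 0 <= T4 v by rewrite mulr_ge0 ?invr_ge0 ?(ltW l0) ?max0_ge0.
have mT (q : R) (u : M3 R -> R) : measurable_fun [set: M3 R] (fun v : M3 R => (u v)%:E) ->
    measurable_fun [set: M3 R] (fun v : M3 R => (q * u v)%:E).
  by move=> /measurable_EFinP mu; apply/measurable_EFinP; exact: measurable_funM.
have tot : (m0%:E <= (K * X)%:E + ((rho ^+ 2)^-1 * E0)%:E + (L * (8 * rho ^+ 2 * eps))%:E + (l^-1 * C1)%:E)%E.
  apply: (le_trans hm).
  apply: (@le_trans _ _ (\int[lebesgue3]_v ((T1 v)%:E + (T2 v)%:E + (T3 v)%:E + (T4 v)%:E))%E).
    apply: ge0_le_integral => //.
    - by move=> v _; rewrite lee_fin.
    - exact/measurable_EFinP.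
    - by do 3 (apply: emeasurable_funD; last exact: mT); exact: mT.
    - by move=> v _; rewrite -!EFinD lee_fin; exact: pt.
  rewrite ge0_integralD//; last 4 first.
  - by move=> v _; rewrite -!EFinD lee_fin !addr_ge0.
  - by do 2 (apply: emeasurable_funD; last exact: mT); exact: mT.
  - by move=> v _; rewrite lee_fin.
  - exact: mT.
  rewrite ge0_integralD//; last 4 first.
  - by move=> v _; rewrite -!EFinD lee_fin !addr_ge0.
  - by apply: emeasurable_funD; exact: mT.
  - by move=> v _; rewrite lee_fin.
  - exact: mT.
  rewrite ge0_integralD//; last 4 first.
  - by move=> v _; rewrite lee_fin.
  - exact: mT.
  - by move=> v _; rewrite lee_fin.
  - exact: mT.
  by rewrite !leeD.
move: tot; rewrite -!EFinD lee_fin XE lee_fin => tot.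
have e1 : (rho ^+ 2)^-1 * E0 <= m0 / 4 by rewrite mulrC.
have e2 : L * (8 * rho ^+ 2 * eps) = m0 / 8.
  have aux (m s r : R) : 0 < s -> 0 < r -> s * (8 * r ^+ 2 * (m / (64 * s * r ^+ 2))) = m / 8.
    by move=> ? ?; field; rewrite !gt_eqF.
  exact: aux.
have e3 : l^-1 * C1 = m0 / 8.
  have aux (m s : R) : 0 < m -> 0 < s -> (8 * s / m)^-1 * s = m / 8.
    by move=> ? ?; field; rewrite !gt_eqF.
  exact: aux.
have KX : m0 / 2 <= K * X by move: tot; rewrite e2 e3; clear -e1; lra.
have -> : eps ^+ 2 / 3 * (m0 / 2) * na = K^-1 * (m0 / 2).
  have aux (e m n : R) : 0 < e -> n != 0 -> e ^+ 2 / 3 * (m / 2) * n = (3 / (e ^+ 2 * n))^-1 * (m / 2).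
    by move=> e0 n0; field; rewrite n0 gt_eqF.
  exact: aux.
by rewrite (mulrC K^-1) ler_pdivrMr// (mulrC X).
Qed.
End Nondegeneracy.

(** * Bounding the logarithmic gradient by the dissipation *)

Section LandauForm.
Context {R : realType}.
Implicit Types (g : R3 R -> R) (v w z : R3 R).

Definition landau_form z (a : 'I_3 -> R) : R :=
  \sum_(i < 3) \sum_(j < 3) landau_a i j z * a i * a j.

Definition cross (x a : 'I_3 -> R) i j : R := x i * a j - x j * a i.

(** Lagrange's identity for |z x a|^2. Multiplied out by |z|^3 it also holds at z = 0, where
    [landau_a] is 0 by convention. *)
Lemma landau_form_cross z a : enorm z ^+ 3 * landau_form z a =
  cross (coord3 z) a j0 j1 ^+ 2 + cross (coord3 z) a j0 j2 ^+ 2 + cross (coord3 z) a j1 j2 ^+ 2.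
Proof.
have [r0|r0] := eqVneq (enorm z) 0.
  have z0 i : coord3 z i = 0.
    have := enorm_sq z; rewrite r0 expr0n/= => /esym/eqP.
    rewrite !paddr_eq0 ?addr_ge0 ?sqr_ge0// !sqrf_eq0 => /andP[/andP[/eqP h0 /eqP h1] /eqP h2].
    by elim/ord3_ind: i.
  by rewrite r0 /cross !z0 !mul0r expr0n/= !mul0r subrr !expr0n/= !addr0.
have E i j : enorm z ^+ 3 * landau_a i j z = (i == j)%:R * enorm z ^+ 2 - coord3 z i * coord3 z j.
  by rewrite /landau_a; field; rewrite r0.
transitivity (\sum_(i < 3) \sum_(j < 3) (enorm z ^+ 3 * landau_a i j z) * a i * a j).
  by rewrite /landau_form mulr_sumr; apply: eq_bigr => i _; rewrite mulr_sumr; apply: eq_bigr => j _; rewrite !mulrA.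
rewrite !sum3E !E enorm_sq /cross /coord3 /=; ring.
Qed.

Lemma landau_form_ge0 z a : 0 <= landau_form z a.
Proof.
have [r0|r0] := eqVneq (enorm z) 0.
  rewrite /landau_form big1// => i _; rewrite big1// => j _.
  by rewrite /landau_a r0 invr0 !mul0r.
have rp : 0 < enorm z ^+ 3 by rewrite exprn_gt0// lt_neqAle eq_sym r0 sqrtr_ge0.
by rewrite -(pmulr_rge0 _ rp) landau_form_cross !addr_ge0 ?sqr_ge0.
Qed.

Lemma cross_le_landau_form z a i j : cross (coord3 z) a i j ^+ 2 <= enorm z ^+ 3 * landau_form z a.
Proof.
rewrite landau_form_cross.
have C k l : cross (coord3 z) a k l ^+ 2 = cross (coord3 z) a l k ^+ 2 by rewrite /cross; ring.
have D k : cross (coord3 z) a k k ^+ 2 = 0 by rewrite /cross subrr expr0n.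
have h1 := sqr_ge0 (cross (coord3 z) a j0 j1); have h2 := sqr_ge0 (cross (coord3 z) a j0 j2).
have h3 := sqr_ge0 (cross (coord3 z) a j1 j2).
by elim/ord3_ind: i; elim/ord3_ind: j; rewrite ?D ?(C j1 j0) ?(C j2 j0) ?(C j2 j1); lra.
Qed.

(** The product form separates v from w: powers of <v> leave the w-integral, and those of <w> are
    bounded on the support of the test function. *)
Lemma enorm_sub_le v w : enorm (v - w) <= 2 * bracket v * bracket w.
Proof.
rewrite -(ler_pXn2r (n := 2))// ?nnegrE ?sqrtr_ge0//; last first.
  by rewrite !mulr_ge0// ltW// bracket_gt0.
rewrite !exprMn !bracket_sq enorm_sq /bsq /=.
case: v w => -[a b] c [[a' b'] c'] /=.
have h : (a - a') ^+ 2 <= 2 * a ^+ 2 + 2 * a' ^+ 2 by have := sqr_ge0 (a + a'); lra.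
have h' : (b - b') ^+ 2 <= 2 * b ^+ 2 + 2 * b' ^+ 2 by have := sqr_ge0 (b + b'); lra.
have h'' : (c - c') ^+ 2 <= 2 * c ^+ 2 + 2 * c' ^+ 2 by have := sqr_ge0 (c + c'); lra.
have V : 0 <= a ^+ 2 + b ^+ 2 + c ^+ 2 by rewrite !addr_ge0 ?sqr_ge0.
have W : 0 <= a' ^+ 2 + b' ^+ 2 + c' ^+ 2 by rewrite !addr_ge0 ?sqr_ge0.
have VW := mulr_ge0 V W.
by lra.
Qed.

Lemma coord3_le_enorm z i : `|coord3 z i| <= enorm z.
Proof.
rewrite -(ler_pXn2r (n := 2))// ?nnegrE ?sqrtr_ge0// enorm_sq real_normK ?num_real//.
have h1 := sqr_ge0 z.1.1; have h2 := sqr_ge0 z.1.2; have h3 := sqr_ge0 z.2.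
by elim/ord3_ind: i; rewrite /coord3/=; lra.
Qed.

Lemma bracket_box N w : 0 <= N -> box N w -> bracket w ^+ 3 <= (1 + 3 * N ^+ 2) ^+ 2 /\ bracket w <= 1 + 3 * N ^+ 2.
Proof.
move=> N0 /boxP h; have sq i : coord3 w i ^+ 2 <= N ^+ 2.
  by rewrite -(real_normK (num_real (coord3 w i))) lerXn2r ?nnegrE.
have qN : bracket w ^+ 2 <= 1 + 3 * N ^+ 2.
  have := sq j0; have := sq j1; have := sq j2; rewrite bracket_sq /bsq /coord3/= => h1 h2 h3; lra.
have b1 := bracket_ge1 w; have b0 := bracket_gt0 w.
split; last by apply: le_trans qN; rewrite ler_eXnr.
apply: (@le_trans _ _ (bracket w ^+ 4)); first by rewrite (exprS _ 3) ler_peMl// exprn_ge0// ltW.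
by rewrite (exprM _ 2 2) lerXn2r ?nnegrE ?exprn_ge0 ?addr_ge0 ?mulr_ge0 ?sqr_ge0// ltW.
Qed.

End LandauForm.

(** * Testing the dissipation against compactly supported functions *)

Section TestFunctions.
Context {R : realType}.
Implicit Types (g psi : R3 R -> R) (v w : R3 R).

Definition dlgrad g v w : 'I_3 -> R := fun k => lgrad g k v - lgrad g k w.

Lemma normr_Rintegral_le (F : R3 R -> R) (h : M3 R -> \bar R) (K : R) :
  lebesgue3.-integrable setT (EFin \o F : M3 R -> \bar R) ->
  measurable_fun [set: M3 R] h -> (forall w, `|F w|%:E <= h w)%E ->
  (\int[lebesgue3]_w h w <= K%:E)%E -> `|\int[lebesgue3]_w F w| <= K.
Proof.
move=> iF mh Fh hK; rewrite -lee_fin.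
have fin : (\int[lebesgue3]_w (F w)%:E \is a fin_num)%E by exact: integrable_fin_num.
rewrite /Rintegral -abse_EFin fineK//.
apply: le_trans hK; apply: (le_trans (le_abse_integral _ _ _)) => //.
  exact: measurable_int iF.
apply: ge0_le_integral => //.
- exact: measurableT_comp (measurable_int _ iF).
- by move=> w _; apply: le_trans (Fh w); rewrite lee_fin.
Qed.

Lemma measurable_landau_form g dg : hasgrad g dg -> (forall v, 0 <= g v) ->
  measurable_fun [set: M3 R * M3 R] (fun z => landau_form (z.1 - z.2 : R3 R) (dlgrad g z.1 z.2)).
Proof.
move=> hg g0.
have mB : measurable_fun [set: M3 R * M3 R] (fun z => z.1 - z.2 : M3 R).
  have m1 := @measurable_proj1 R; have m2 := @measurable_proj2 R; have m3 := @measurable_proj3 R.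
  apply: measurable_fun_pair; first apply: measurable_fun_pair.
  - by apply: measurable_funB; apply: (measurableT_comp m1).
  - by apply: measurable_funB; apply: (measurableT_comp m2).
  - by apply: measurable_funB; apply: (measurableT_comp m3).
have mu k : measurable_fun [set: M3 R * M3 R] (fun z => dlgrad g z.1 z.2 k).
  by apply: measurable_funB; apply: (measurableT_comp (measurable_lgrad k hg g0)).
have mc k : measurable_fun [set: M3 R] ((fun v => coord3 v k) : M3 R -> R).
  by apply: continuous_measurable3; exact: coord3_continuous.
have me : measurable_fun [set: M3 R] (@enorm R : M3 R -> R).
  apply: continuous_measurable3.
  have -> : (@enorm R) = (fun v => Num.sqrt (bsq v - 1)).
    by apply/funext => v; rewrite /bsq [_ - 1]addrC addKr -enorm_sq sqrtr_sqr ger0_norm// sqrtr_ge0.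
  move=> v; apply: (@continuous_comp _ _ _ (fun v : R3 R => bsq v - 1) Num.sqrt); last exact: sqrt_continuous.
  by apply: cvgB; [exact: bsq_continuous|exact: cvg_cst].
have ma i j : measurable_fun [set: M3 R] (landau_a i j : M3 R -> R).
  apply: measurable_funM; first by apply: measurable_invr_ge0 => // v; exact: sqrtr_ge0.
  apply: measurable_funB => //; apply: measurable_funM; first exact: measurable_funM.
  by apply: measurable_invr_ge0 => [|v]; [exact: measurable_funX|exact: sqr_ge0].
apply: measurable_sum => i; apply: measurable_sum => j.
by apply: measurable_funM => //; apply: measurable_funM => //; exact: (measurableT_comp (ma i j) mB).
Qed.

Section Identity.
Variables (N : R) (g psi : R3 R -> R) (dg dpsi : 'I_3 -> R3 R -> R) (v : R3 R) (i j : 'I_3).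
Hypotheses (hg : hasgrad g dg) (g0 : forall w, 0 <= g w) (hpsi : hasgrad psi dpsi)
  (bpsi : boxed N psi).

Local Notation z := (fun w : R3 R => coord3 (v - w)).

Lemma coord3B k w : coord3 (v - w) k = coord3 v k - coord3 w k.
Proof. by elim/ord3_ind: k. Qed.

Lemma hasgrad_coord3B k : hasgrad (fun w => coord3 (v - w) k) (fun l _ => - (l == k)%:R).
Proof.
have -> : (fun w => coord3 (v - w) k) = (fun w => coord3 v k + - coord3 w k).
  by apply/funext => w; exact: coord3B.
by apply: hasgrad_ext (hasgradD (hasgrad_cst _) (hasgradN (hasgrad_coord k))) _ => l w; rewrite add0r.
Qed.

Let cz k : continuous (fun w => z w k). Proof. exact: hasgrad_cont (hasgrad_coord3B k). Qed.
Let cg : continuous g. Proof. exact: hasgrad_cont hg. Qed.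
Let cpsi : continuous psi. Proof. exact: hasgrad_cont hpsi. Qed.
Let cdg k : continuous (dg k). Proof. by case: hg. Qed.
Let cdpsi k : continuous (dpsi k). Proof. by case: hpsi. Qed.

Let main w := psi w * g w * cross (z w) (fun k => lgrad g k v) i j.
Let rest w := g w * (dpsi j w * z w i - dpsi i w * z w j).
Let pz k l w := psi w * z w k * dg l w.

(** [g w * lgrad g k w] is the derivative of g even at zeros of g, so u(w) enters only through grad
    g, ready for integration by parts. *)
Lemma cross_dlgrad w : psi w * g w * cross (z w) (dlgrad g v w) i j = main w - pz i j w + pz j i w.
Proof.
by rewrite /main /pz /cross /dlgrad !(partial_lgrad _ _ hg g0); ring.
Qed.

Let cmain : continuous main.
Proof.
move=> w; apply: cvgM; first by apply: cvgM; [exact: cpsi|exact: cg].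
by apply: cvgB; apply: cvgM; (exact: cz || exact: cvg_cst).
Qed.

Let cpz k l : continuous (pz k l).
Proof.
move=> w; apply: cvgM; last exact: cdg.
by apply: cvgM; [exact: cpsi|exact: cz].
Qed.

Let crest : continuous rest.
Proof.
move=> w; apply: cvgM; first exact: cg.
by apply: cvgB; apply: cvgM; (exact: cz || exact: cdpsi).
Qed.

Let bmain : boxed N main. Proof. by move=> w k /bpsi h; rewrite /main h !mul0r. Qed.
Let bpz k l : boxed N (pz k l). Proof. by move=> w m /bpsi h; rewrite /pz h !mul0r. Qed.
Let brest : boxed N rest.
Proof.
move=> w k h; rewrite /rest.
by rewrite (hasgrad_boxed j hpsi bpsi h) (hasgrad_boxed i hpsi bpsi h) !mul0r subrr mulr0.
Qed.

Let imain := integrable_boxed_cont cmain bmain.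
Let ipz k l := integrable_boxed_cont (@cpz k l) (@bpz k l).
Let irest := integrable_boxed_cont crest brest.

Lemma integral_pz k l : \int[lebesgue3]_w pz k l w =
  - \int[lebesgue3]_w ((dpsi l w * z w k - psi w * (l == k)%:R) * g w).
Proof.
have b : boxed N (fun w => psi w * z w k) by move=> w m /bpsi ->; rewrite mul0r.
rewrite (integration_by_parts_boxed l hg (hasgradM hpsi (hasgrad_coord3B k)) b).
by congr (- _); apply: eq_Rintegral => w _; rewrite mulrN.
Qed.

(* Only [w] is integrated by parts, against a compactly supported [psi], so that no
   decay of [g] is needed. *)
Lemma integral_cross_dlgrad :
  \int[lebesgue3]_w (psi w * g w * cross (z w) (dlgrad g v w) i j)
  = \int[lebesgue3]_w main w + \int[lebesgue3]_w rest w.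
Proof.
have cb k l : lebesgue3.-integrable setT
    (EFin \o (fun w => (dpsi l w * z w k - psi w * (l == k)%:R) * g w)).
  apply: (@integrable_boxed_cont _ N).
    move=> w; apply: cvgM; last exact: cg.
    apply: cvgB; apply: cvgM; [exact: cdpsi|exact: cz|exact: cpsi|exact: cvg_cst].
  by move=> w m h; rewrite (bpsi h) (hasgrad_boxed l hpsi bpsi h) !mul0r subrr mul0r.
under eq_Rintegral do rewrite cross_dlgrad.
have iB : lebesgue3.-integrable setT (EFin \o (fun w => main w - pz i j w)).
  apply: (@integrable_boxed_cont _ N).
    by move=> w; apply: cvgB; [exact: cmain|exact: cpz].
  by move=> w k h; rewrite (bmain h) (bpz i j h) subrr.
rewrite (RintegralD measurableT iB (ipz j i)) (RintegralB measurableT imain (ipz i j)).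
rewrite !integral_pz opprK -addrA; congr (_ + _).
apply: etrans (esym (RintegralB measurableT (cb i j) (cb j i))) _.
(* The Kronecker terms, from differentiating the factors v - w, are symmetric in [i] and [j] and
   cancel. *)
apply: eq_Rintegral => w _; rewrite /rest (eq_sym j i); ring.
Qed.

(** The integral of [main] is [T - S]. [T] contains u(v) - u(w), and Cauchy-Schwarz with |v - w|^3
    <= 8 <v>^3 <w>^3 gives T^2 <= 8 A^2 B^2 M0 <v>^3 d. [S] contains no u, and |S| <= 4 A B M0 <v>.
    The constants 16 and 32 come from (T - S)^2 <= 2 T^2 + 2 S^2. *)
Lemma test_bound (A M0 d : R) : 0 <= N -> 0 <= A -> 0 <= M0 ->
  (forall w, `|psi w| <= A) -> (forall k w, `|dpsi k w| <= A) ->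
  (\int[lebesgue3]_w (g w)%:E <= M0%:E)%E ->
  (\int[lebesgue3]_w (g w * landau_form (v - w) (dlgrad g v w))%:E <= d%:E)%E ->
  (\int[lebesgue3]_w main w) ^+ 2
    <= A ^+ 2 * ((1 + 3 * N ^+ 2) ^+ 2 * (16 * M0 + 32 * M0 ^+ 2)
                 * (bracket v ^+ 3 * d + bracket v ^+ 2)).
Proof.
move=> N0 A0 M00 psiA dpsiA hM hd; set B := 1 + 3 * N ^+ 2; set b := bracket v.
have b1 : 1 <= b := bracket_ge1 v; have b0 : 0 < b := bracket_gt0 v.
have B0 : 0 <= B by rewrite addr_ge0// mulr_ge0// sqr_ge0.
set T := \int[lebesgue3]_w (psi w * g w * cross (z w) (dlgrad g v w) i j).
set S := \int[lebesgue3]_w rest w.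
have mg : measurable_fun [set: M3 R] (g : M3 R -> R) by exact: continuous_measurable3.
have mQ : measurable_fun [set: M3 R] ((fun w => psi w * g w * cross (z w) (dlgrad g v w) i j) : M3 R -> R).
  apply: continuous_measurable3.
  under eq_fun do rewrite cross_dlgrad.
  by move=> w; apply: cvgD; [apply: cvgB; [exact: cmain|exact: cpz]|exact: cpz].
have iQ : lebesgue3.-integrable setT
    (EFin \o (fun w => psi w * g w * cross (z w) (dlgrad g v w) i j)).
  under eq_fun do rewrite /= cross_dlgrad.
  apply: (@integrable_boxed_cont _ N).
    by move=> w; apply: cvgD; [apply: cvgB; [exact: cmain|exact: cpz]|exact: cpz].
  by move=> w k h; rewrite (bmain h) (bpz i j h) (bpz j i h) subrr addr0.
have S2 : S ^+ 2 <= 16 * A ^+ 2 * B ^+ 2 * M0 ^+ 2 * b ^+ 2.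
  have -> : 16 * A ^+ 2 * B ^+ 2 * M0 ^+ 2 * b ^+ 2 = (4 * A * b * B * M0) ^+ 2 by ring.
  rewrite -(real_normK (num_real S)) lerXn2r ?nnegrE//; first by rewrite !mulr_ge0// ltW.
  apply: (@normr_Rintegral_le _ (fun w => (4 * A * b * B * g w)%:E) _ irest).
  - by apply/measurable_EFinP; exact: measurable_funM.
  - move=> w; rewrite lee_fin.
    have [bw|nbw] := pselect (box N w); last first.
      by rewrite (boxed_out brest nbw) normr0 !mulr_ge0// ltW.
    have [_ bB] := bracket_box N0 bw.
    have zk k : `|z w k| <= 2 * b * B.
      apply: le_trans (coord3_le_enorm _ _) _; apply: le_trans (enorm_sub_le _ _) _.
      by rewrite ler_wpM2l// mulr_ge0// ltW.
    rewrite normrM ger0_norm// mulrC ler_wpM2r//.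
    have p k l : `|dpsi k w * z w l| <= A * (2 * b * B) by rewrite normrM ler_pM.
    by apply: le_trans (ler_normB _ _) _; have := p j i; have := p i j; lra.
  - by apply: le_integralZ => //; [rewrite !mulr_ge0// ltW|exact/measurable_EFinP].
have T2 : T ^+ 2 <= 8 * A ^+ 2 * B ^+ 2 * M0 * (b ^+ 3 * d).
  pose h w : \bar R := `|psi w * g w * cross (z w) (dlgrad g v w) i j|%:E.
  pose F w : \bar R := (g w * landau_form (v - w) (dlgrad g v w))%:E.
  pose k0 := A ^+ 2 * (8 * b ^+ 3 * B ^+ 2).
  have k00 : 0 <= k0.
    by apply: mulr_ge0; [exact: sqr_ge0|apply: mulr_ge0; [apply: mulr_ge0 => //; apply: exprn_ge0; exact: ltW|exact: sqr_ge0]].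
  pose G w : \bar R := (k0 * g w)%:E.
  have mh : measurable_fun [set: M3 R] (h : M3 R -> \bar R).
    by apply/measurable_EFinP; exact: measurableT_comp.
  have mF : measurable_fun [set: M3 R] (F : M3 R -> \bar R).
    apply/measurable_EFinP; apply: measurable_funM => //.
    exact: (measurableT_comp (measurable_landau_form hg g0) (@pair1_measurable _ _ (M3 R) (M3 R) v)).
  have mG : measurable_fun [set: M3 R] (G : M3 R -> \bar R).
    by apply/measurable_EFinP; exact: measurable_funM.
  have F0 w : (0 <= F w)%E by rewrite lee_fin mulr_ge0// landau_form_ge0.
  have G0 w : (0 <= G w)%E by rewrite lee_fin mulr_ge0.
  have h0 w : (0 <= h w)%E by rewrite lee_fin.
  have hFG w : (h w * h w <= F w * G w)%E.
    rewrite -!EFinM lee_fin -expr2 real_normK ?num_real//.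
    have [bw|nbw] := pselect (box N w); last first.
      rewrite (boxed_out bpsi nbw) !mul0r expr0n/= mulr_ge0//; first by rewrite -lee_fin; exact: F0.
      by rewrite -lee_fin; exact: G0.
    have [bB _] := bracket_box N0 bw.
    have c := cross_le_landau_form (v - w) (dlgrad g v w) i j.
    have L0 := landau_form_ge0 (v - w) (dlgrad g v w).
    have e3 : enorm (v - w) ^+ 3 <= 8 * b ^+ 3 * B ^+ 2.
      apply: (@le_trans _ _ ((2 * b * bracket w) ^+ 3)).
        rewrite lerXn2r ?nnegrE ?sqrtr_ge0//; last exact: enorm_sub_le.
        by rewrite !mulr_ge0// ltW// bracket_gt0.
      rewrite !exprMn (_ : 2 ^+ 3 = 8); last by ring.
      by rewrite ler_wpM2l// mulr_ge0// exprn_ge0// ltW.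
    have p2 : psi w ^+ 2 <= A ^+ 2.
      by rewrite -(real_normK (num_real (psi w))) lerXn2r ?nnegrE.
    rewrite !exprMn /k0.
    have -> : g w * landau_form (v - w) (dlgrad g v w) * (A ^+ 2 * (8 * b ^+ 3 * B ^+ 2) * g w)
      = A ^+ 2 * g w ^+ 2 * ((8 * b ^+ 3 * B ^+ 2) * landau_form (v - w) (dlgrad g v w)) by ring.
    apply: ler_pM.
    - by apply: mulr_ge0; exact: sqr_ge0.
    - exact: sqr_ge0.
    - by apply: ler_wpM2r => //; exact: sqr_ge0.
    - by apply: le_trans c _; rewrite ler_wpM2r.
  have cs := ge0_integral_cs (@lebesgue3 R) mF mG mh F0 G0 h0 hFG.
  have Th : (`|T|%:E <= \int[lebesgue3]_w h w)%E.
    have [->|fin] := eqVneq (\int[lebesgue3]_w h w)%E +oo%E; first by rewrite leey.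
    have hf : (\int[lebesgue3]_w h w \is a fin_num)%E by rewrite ge0_fin_numE ?ltey// integral_ge0.
    rewrite -(fineK hf) lee_fin.
    by apply: (@normr_Rintegral_le _ h _ iQ) => //; rewrite fineK.
  have IG : (\int[lebesgue3]_w G w <= (k0 * M0)%:E)%E.
    by apply: le_integralZ => //; exact/measurable_EFinP.
  rewrite -lee_fin -(real_normK (num_real T)) expr2 EFinM.
  have T0 : (0 <= `|T|%:E)%E by rewrite lee_fin.
  apply: le_trans (lee_pmul T0 T0 Th Th) _; apply: le_trans cs _.
  have IF0 : (0 <= \int[lebesgue3]_w F w)%E by exact: integral_ge0.
  have IG0 : (0 <= \int[lebesgue3]_w G w)%E by exact: integral_ge0.
  apply: le_trans (lee_pmul IF0 IG0 hd IG) _.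
  by rewrite -EFinM lee_fin le_eqVlt; apply/orP; left; apply/eqP; rewrite /k0; ring.
have d0 : 0 <= d.
  rewrite -lee_fin; apply: le_trans hd; apply: integral_ge0 => w _.
  by rewrite lee_fin mulr_ge0// landau_form_ge0.
have E : \int[lebesgue3]_w main w = T - S by rewrite /T integral_cross_dlgrad addrK.
rewrite E.
have TS : (T - S) ^+ 2 <= 2 * T ^+ 2 + 2 * S ^+ 2 by have := sqr_ge0 (T + S); lra.
apply: (le_trans TS).
have AB : 0 <= A ^+ 2 * B ^+ 2 by rewrite mulr_ge0 ?sqr_ge0.
have X0 : 0 <= b ^+ 3 * d by rewrite mulr_ge0// exprn_ge0// ltW.
have Y0 : 0 <= b ^+ 2 by exact: sqr_ge0.
have P1 : 0 <= A ^+ 2 * B ^+ 2 * (M0 * b ^+ 2) by rewrite mulr_ge0// mulr_ge0.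
have P2 : 0 <= A ^+ 2 * B ^+ 2 * (M0 ^+ 2 * (b ^+ 3 * d)) by rewrite mulr_ge0// mulr_ge0// sqr_ge0.
rewrite -subr_ge0.
apply: (@le_trans _ _ (16 * (A ^+ 2 * B ^+ 2 * (M0 * b ^+ 2)) + 32 * (A ^+ 2 * B ^+ 2 * (M0 ^+ 2 * (b ^+ 3 * d))))).
  by rewrite addr_ge0// mulr_ge0.
by lra.
Qed.
End Identity.
End TestFunctions.

(** * Pointwise bound on the logarithmic gradient *)

Section PointwiseBound.
Context {R : realType}.
Implicit Types (g : R3 R -> R) (v w : R3 R).

Definition dchi (rho : R) (k : 'I_3) v : R := 2 * ppow 1 (chiN rho - bsq v) * - (2 * coord3 v k).

Lemma hasgrad_chi (rho : R) : hasgrad (chi rho) (dchi rho).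
Proof.
apply: (hasgrad_ext (hasgrad_ppow 0 (hasgradD (hasgrad_cst _) (hasgradN hasgrad_bsq)))) => k v.
by rewrite /dchi add0r.
Qed.

Lemma boxed_chi (rho : R) : boxed (chiN rho) (chi rho).
Proof.
move=> v i h; apply: ppow_le0; rewrite subr_le0.
have N1 : 1 <= chiN rho by rewrite /chiN; have := sqr_ge0 rho; lra.
apply: (@le_trans _ _ (chiN rho ^+ 2)); first by rewrite ler_eXnr.
apply: (@le_trans _ _ (coord3 v i ^+ 2)).
  by rewrite -(real_normK (num_real (coord3 v i))) lerXn2r ?nnegrE ?(le_trans ler01 N1)// ltW.
rewrite -bracket_sq -(real_normK (num_real (coord3 v i))) lerXn2r ?nnegrE//.
  by rewrite ltW// bracket_gt0.
exact: coord3_le_bracket.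
Qed.

Lemma chi_bounded (rho : R) : exists2 K, 0 <= K &
  (forall v, `|chi rho v| <= K) /\ (forall k v, `|dchi rho k v| <= K).
Proof.
have hc := hasgrad_chi rho; have cc := hasgrad_cont hc; have bc := @boxed_chi rho.
have [K K0 hK] := boxed_bounded cc bc.
have B k : exists2 K, 0 <= K & forall v, `|dchi rho k v| <= K.
  by apply: boxed_bounded (hasgrad_boxed k hc bc); case: hc => _ _; apply.
have [Ka Ka0 hKa] := B j0; have [Kb Kb0 hKb] := B j1; have [Kc Kc0 hKc] := B j2.
exists (K + Ka + Kb + Kc); first by rewrite !addr_ge0.
split=> [v|k v]; first by have := hK v; lra.
by elim/ord3_ind: k; [have := hKa v|have := hKb v|have := hKc v]; lra.
Qed.

(** A component of w x a is a linear form in w with coefficient vector a_j e_i - a_i e_j; this is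
    how nondegeneracy is applied to it. *)
Lemma lform_cross (a : 'I_3 -> R) i j : i != j -> exists2 a' : R3 R,
  a'.1.1 ^+ 2 + a'.1.2 ^+ 2 + a'.2 ^+ 2 = a i ^+ 2 + a j ^+ 2 &
  forall w, lform a' w = cross (coord3 w) a i j.
Proof.
move=> ij; exists (a j *: basis3 i - a i *: basis3 j : R3 R).
  by move: ij; elim/ord3_ind: i; elim/ord3_ind: j => //= _; rewrite /GRing.scale/=; ring.
move=> w; rewrite /lform /cross /coord3.
by move: ij; elim/ord3_ind: i; elim/ord3_ind: j => //= _; rewrite /GRing.scale/=; ring.
Qed.

Section Fixed.
Variables (rho lam M0 : R) (g : R3 R -> R) (dg : 'I_3 -> R3 R -> R).
Hypotheses (lam0 : 0 < lam) (hg : hasgrad g dg) (g0 : forall w, 0 <= g w) (M00 : 0 <= M0)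
  (gM : (\int[lebesgue3]_v (g v)%:E <= M0%:E)%E)
  (gN : forall (a : R3 R) (c : R), ((lam * (a.1.1 ^+ 2 + a.1.2 ^+ 2 + a.2 ^+ 2))%:E
     <= \int[lebesgue3]_v (chi rho v * g v * (lform a v - c) ^+ 2)%:E)%E).

Local Notation N := (chiN rho).

Let N0 : 0 <= N. Proof. by rewrite /chiN; have := sqr_ge0 rho; lra. Qed.
Let cg : continuous g. Proof. exact: hasgrad_cont hg. Qed.

Lemma integrable_chiM (p : R3 R -> R) : continuous p ->
  lebesgue3.-integrable setT (EFin \o (fun w => chi rho w * g w * p w)).
Proof.
move=> cp; apply: (@integrable_boxed_cont _ N).
  by move=> w; apply: cvgM; [apply: cvgM; [exact: chi_continuous|exact: cg]|exact: cp].
by move=> w k /boxed_chi ->; rewrite !mul0r.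
Qed.

Let I (p : R3 R -> R) := \int[lebesgue3]_w (chi rho w * g w * p w).

Lemma chi_integralD p q : continuous p -> continuous q -> I (fun w => p w + q w) = I p + I q.
Proof.
move=> cp cq; rewrite /I -RintegralD//; [|exact: integrable_chiM|exact: integrable_chiM].
by apply: eq_Rintegral => w _; rewrite mulrDr.
Qed.

Lemma chi_integralZ (k : R) p : continuous p -> I (fun w => k * p w) = k * I p.
Proof.
move=> cp; rewrite /I -RintegralZl//; last exact: integrable_chiM.
by apply: eq_Rintegral => w _; rewrite mulrCA.
Qed.

Lemma chi_integral_le p q : continuous p -> continuous q ->
  (forall w, box N w -> p w <= q w) -> I p <= I q.
Proof.
move=> cp cq pq; apply: le_Rintegral => //; [exact: integrable_chiM|exact: integrable_chiM|].
move=> w _; have [/pq h|h] := pselect (box N w).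
  by rewrite ler_wpM2l// mulr_ge0// ppow_ge0.
by rewrite (boxed_out (@boxed_chi rho) h) !mul0r.
Qed.

Lemma nondegenerate_chi_integral (a : R3 R) (c : R) :
  lam * (a.1.1 ^+ 2 + a.1.2 ^+ 2 + a.2 ^+ 2) <= I (fun w => (lform a w - c) ^+ 2).
Proof.
have cp : continuous (fun w : R3 R => (lform a w - c) ^+ 2).
  move=> w; apply: (@continuous_comp _ _ _ (fun v => lform a v - c) (fun x => x ^+ 2)).
    by apply: cvgB; [exact: lform_continuous|exact: cvg_cst].
  exact: exprn_continuous.
rewrite -lee_fin /I /Rintegral fineK ?gN//.
by have := integrable_fin_num measurableT (integrable_chiM cp).
Qed.

Let c1 : continuous (fun _ : R3 R => 1 : R). Proof. exact: cst_continuous. Qed.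
Let cc k : continuous (fun w : R3 R => coord3 w k). Proof. exact: coord3_continuous. Qed.

Let M := I (fun=> 1).

(** Nondegeneracy for the first coordinate with offset 0, together with w_1^2 <= N^2 on the support
    of [chi]. *)
Lemma chi_mass_ge : lam / N ^+ 2 <= M.
Proof.
have N1 : 0 < N by rewrite /chiN; have := sqr_ge0 rho; lra.
rewrite ler_pdivrMr ?exprn_gt0//.
have := @nondegenerate_chi_integral (1, 0, 0) 0.
rewrite expr0n/= expr1n !addr0 mulr1 => /le_trans; apply.
rewrite mulrC -chi_integralZ//; apply: chi_integral_le.
- move=> w; apply: (@continuous_comp _ _ _ (fun v => lform (1, 0, 0) v - 0) (fun x => x ^+ 2)).
    by apply: cvgB; [exact: lform_continuous|exact: cvg_cst].
  exact: exprn_continuous.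
- by move=> w; exact: cst_continuous.
- move=> w /boxP /(_ j0); rewrite /lform/= mul1r !mul0r !addr0 subr0 mulr1 /coord3/= => h.
  by rewrite -(real_normK (num_real w.1.1)) lerXn2r ?nnegrE.
Qed.

Let Mgt0 : 0 < M.
Proof.
apply: lt_le_trans chi_mass_ge; rewrite divr_gt0// exprn_gt0//.
by rewrite /chiN; have := sqr_ge0 rho; lra.
Qed.

(** The barycentre of chi g. Centring there gives [e] zero mean, so that the tests with [chi] and
    with [chi * e] isolate [E] and [e ^+ 2] respectively. *)
Definition chi_mean k := I (fun w => coord3 w k) / M.
Local Notation c := chi_mean.

Lemma chi_mean_le k : `|c k| <= N.
Proof.
have h s : s * s = 1 -> s * I (fun w => coord3 w k) <= N * M.
  move=> ss; rewrite -!chi_integralZ//; apply: chi_integral_le.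
  - by move=> w; apply: cvgM; [exact: cvg_cst|exact: cc].
  - by move=> w; exact: cst_continuous.
  move=> w /boxP /(_ k) hk; rewrite mulr1; apply: le_trans hk.
  have <- : `|s * coord3 w k| = `|coord3 w k|.
    rewrite normrM (_ : `|s| = 1) ?mul1r//; apply/eqP.
    by rewrite -(@eqrXn2 _ 2)// expr1n real_normK ?num_real// expr2 ss.
  exact: ler_norm.
rewrite /c normrM normfV (gtr0_norm Mgt0) ler_pdivrMr// ler_norml.
have := h 1 (mulr1 1); have := h (-1) (etrans (mulrNN 1 1) (mulr1 1)); rewrite mul1r mulN1r => h1 h2.
by apply/andP; split; [rewrite lerNl|].
Qed.

Section AtPoint.
Variables (v : R3 R) (i j : 'I_3).
Hypothesis (ij : i != j).

Local Notation a := (fun k => lgrad g k v).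
Let e w := cross (fun k => coord3 w k - c k) a i j.
Let E := cross (fun k => coord3 v k - c k) a i j.
Let de k (_ : R3 R) : R := (k == i)%:R * a j - (k == j)%:R * a i.

Let hasgrad_e : hasgrad e de.
Proof.
have h k (s : R) := hasgradM (hasgradD (hasgrad_coord k) (hasgrad_cst (- c k))) (hasgrad_cst s).
apply: (hasgrad_ext (hasgradD (h i (a j)) (hasgradN (h j (a i))))) => k w.
by rewrite /de; move: (a i) (a j) => x y; ring.
Qed.

Let ce : continuous e. Proof. exact: hasgrad_cont hasgrad_e. Qed.

Let cross_e w : cross (coord3 (v - w)) a i j = E - e w.
Proof. by rewrite /E /e /cross !coord3B; move: (a i) (a j) => x y; ring. Qed.

Let chi_integral_e : I e = 0.
Proof.
have Z k : I (fun w => coord3 w k + (- c k) * 1) = 0.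
  rewrite chi_integralD//; last by move=> w; exact: cst_continuous.
  by rewrite chi_integralZ// mulNr divfK ?subrr// gt_eqF.
have cZ k : continuous (fun w : R3 R => coord3 w k + (- c k) * 1).
  by move=> w; apply: cvgD; [exact: cc|exact: cvg_cst].
have -> : e = (fun w => a j * (coord3 w i + (- c i) * 1) + (- a i) * (coord3 w j + (- c j) * 1)).
  by apply/funext => w; rewrite /e /cross; ring.
rewrite chi_integralD ?chi_integralZ ?Z ?mulr0 ?addr0//.
- by move=> w; apply: cvgM; [exact: cvg_cst|exact: cZ].
- by move=> w; apply: cvgM; [exact: cvg_cst|exact: cZ].
Qed.

Variables (K d : R).
Hypotheses (K0 : 0 <= K) (chiK : forall w, `|chi rho w| <= K)
  (dchiK : forall k w, `|dchi rho k w| <= K)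
  (hd : (\int[lebesgue3]_w (g w * landau_form (v - w) (dlgrad g v w))%:E <= d%:E)%E).

Let Y := (1 + 3 * N ^+ 2) ^+ 2 * (16 * M0 + 32 * M0 ^+ 2)
                 * (bracket v ^+ 3 * d + bracket v ^+ 2).

Let Y0 : 0 <= Y.
Proof.
have d0 : 0 <= d.
  rewrite -lee_fin; apply: le_trans hd; apply: integral_ge0 => w _.
  by rewrite lee_fin mulr_ge0// landau_form_ge0.
have b0 : 0 <= bracket v by rewrite ltW// bracket_gt0.
apply: mulr_ge0; last by rewrite addr_ge0 ?mulr_ge0 ?exprn_ge0.
by apply: mulr_ge0; [exact: sqr_ge0|rewrite addr_ge0 ?mulr_ge0 ?sqr_ge0].
Qed.

(** Test function [chi]: since the component of (v - w) x u(v) is [E - e w] and [e] has zero mean,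
    the integral is [M * E]. *)
Let E_bound : (M * E) ^+ 2 <= K ^+ 2 * Y.
Proof.
have -> : M * E = \int[lebesgue3]_w (chi rho w * g w * cross (coord3 (v - w)) a i j).
  have -> : \int[lebesgue3]_w (chi rho w * g w * cross (coord3 (v - w)) a i j)
     = I (fun w => E * 1 + (-1) * e w).
    by apply: eq_Rintegral => w _; rewrite cross_e mulr1 mulN1r.
  rewrite chi_integralD.
  - by rewrite !chi_integralZ// chi_integral_e mulr0 addr0 mulrC.
  - by move=> w; exact: cst_continuous.
  - by move=> w; apply: cvgM; [exact: cvg_cst|exact: ce].
exact: (test_bound i j hg g0 (hasgrad_chi rho) (@boxed_chi rho)).
Qed.

Let n := a i ^+ 2 + a j ^+ 2.

(** Test function [chi * e]: the constant [E] drops out and minus the second moment of [e] remains,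
    which nondegeneracy bounds below by [lam * n]. The right side is only linear in [n], so one
    factor [n] can be divided out later. *)
Let e_bound : (lam * n) ^+ 2 <= (K * (2 * N + 1)) ^+ 2 * (2 * n) * Y.
Proof.
have [a' na' la'] := lform_cross (fun k => lgrad g k v) ij.
have n0 : 0 <= n by rewrite addr_ge0 ?sqr_ge0.
have Ie : lam * n <= I (fun w => e w ^+ 2).
  rewrite /n -na'; apply: le_trans (nondegenerate_chi_integral a' (cross c a i j)) _.
  rewrite le_eqVlt; apply/orP; left; apply/eqP; apply: eq_Rintegral => w _.
  by rewrite la' /e /cross; congr (_ * _ ^+ 2); move: (a i) (a j) => x y; ring.
have Ie0 : 0 <= I (fun w => e w ^+ 2) by apply: le_trans Ie; rewrite mulr_ge0// ltW.
apply: (@le_trans _ _ (I (fun w => e w ^+ 2) ^+ 2)).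
  by rewrite lerXn2r ?nnegrE// mulr_ge0// ltW.
have -> : I (fun w => e w ^+ 2) ^+ 2
   = (\int[lebesgue3]_w ((chi rho w * e w) * g w * cross (coord3 (v - w)) a i j)) ^+ 2.
  have -> : \int[lebesgue3]_w ((chi rho w * e w) * g w * cross (coord3 (v - w)) a i j)
     = I (fun w => E * e w + (-1) * (e w ^+ 2)).
    by apply: eq_Rintegral => w _; rewrite cross_e; ring.
  have ce2 : continuous (fun w => e w ^+ 2).
    by move=> w; apply: (@continuous_comp _ _ _ e (fun x => x ^+ 2)); [exact: ce|exact: exprn_continuous].
  rewrite chi_integralD.
  - by rewrite !chi_integralZ// chi_integral_e mulr0 add0r mulN1r sqrrN.
  - by move=> w; apply: cvgM; [exact: cvg_cst|exact: ce].
  - by move=> w; apply: cvgM; [exact: cvg_cst|exact: ce2].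
(* On the support |e| <= 2 N s and its derivatives are at most s, so [K * (2 * N + 1) * s] bounds
   both [chi * e] and its gradient. *)
pose s := `|a i| + `|a j|.
have s0 : 0 <= s by rewrite addr_ge0.
have s2 : s ^+ 2 <= 2 * n.
  rewrite /n -(real_normK (num_real (a i))) -(real_normK (num_real (a j))) /s.
  by move: `|a i| `|a j| => x y; have := sqr_ge0 (x - y); lra.
apply: (@le_trans _ _ ((K * (2 * N + 1) * s) ^+ 2 * Y)); last first.
  by rewrite exprMn ler_wpM2r// ler_wpM2l// sqr_ge0.
have bd : boxed N (fun w => chi rho w * e w) by move=> w k /boxed_chi ->; rewrite mul0r.
have hd' := hasgradM (hasgrad_chi rho) hasgrad_e.
have eB w : box N w -> `|e w| <= 2 * N * s.
  move=> /boxP bw; have hk k : `|coord3 w k - c k| <= 2 * N.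
    by apply: le_trans (ler_normB _ _) _; have := bw k; have := chi_mean_le k; lra.
  apply: le_trans (ler_normB _ _) _; rewrite (normrM (coord3 w i - _)) (normrM (coord3 w j - _)) /s mulrDr addrC.
  by apply: lerD; apply: ler_wpM2r.
have dB k w : `|de k w| <= s.
  apply: le_trans (ler_normB _ _) _; rewrite (normrM _%:R (a j)) (normrM _%:R (a i)) /s addrC.
  by apply: lerD; rewrite ler_piMl// normr_nat; case: (_ == _).
have A0 : 0 <= K * (2 * N + 1) * s by rewrite !mulr_ge0// addr_ge0// mulr_ge0.
have KNs : 0 <= K * (N * s) by rewrite !mulr_ge0.
have Ks : 0 <= K * s by rewrite mulr_ge0.
apply: (test_bound i j hg g0 hd' bd) => //.
- move=> w; have [bw|nbw] := pselect (box N w); last by rewrite (boxed_out bd nbw) normr0.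
  rewrite (normrM (chi rho w)); apply: (@le_trans _ _ (K * (2 * N * s))); first by rewrite ler_pM// eB.
  by lra.
- move=> k w; have [bw|nbw] := pselect (box N w); last first.
    by rewrite (boxed_out (hasgrad_boxed k hd' bd) nbw) normr0.
  apply: le_trans (ler_normD _ _) _; rewrite (normrM (dchi rho k w)) (normrM (chi rho w)).
  apply: (@le_trans _ _ (K * (2 * N * s) + K * s)); last by lra.
  by apply: lerD; apply: ler_pM => //; exact: eB.
Qed.

(** As v x u = (v - c) x u + c x u with |c_k| <= N, the left side is at most (1 + 4 N^2) n + 2 E^2.
    Then [e_bound] controls [n], while [E_bound] with [chi_mass_ge] controls [E]. *)
Lemma lgrad_pair_bound : a i ^+ 2 + a j ^+ 2 + cross (coord3 v) a i j ^+ 2 <=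
  ((1 + 4 * N ^+ 2) * (2 * (K * (2 * N + 1)) ^+ 2) + 2 * K ^+ 2 * N ^+ 4) / lam ^+ 2 * Y.
Proof.
have n0 : 0 <= n by rewrite addr_ge0 ?sqr_ge0.
have l2 : 0 < lam ^+ 2 by rewrite exprn_gt0.
set P := 2 * (K * (2 * N + 1)) ^+ 2.
have PY0 : 0 <= P * Y by rewrite mulr_ge0// mulr_ge0// sqr_ge0.
have nP : lam ^+ 2 * n <= P * Y.
  have [->|n00] := eqVneq n 0; first by rewrite mulr0.
  have np : 0 < n by rewrite lt_neqAle eq_sym n00.
  by rewrite -(ler_pM2r np); have := e_bound; rewrite /P; lra.
have EP : lam ^+ 2 * E ^+ 2 <= K ^+ 2 * N ^+ 4 * Y.
  have lM : lam <= N ^+ 2 * M.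
    have N1 : 0 < N by rewrite /chiN; have := sqr_ge0 rho; lra.
    by have := chi_mass_ge; rewrite ler_pdivrMr ?exprn_gt0// mulrC.
  have lM2 : lam ^+ 2 <= (N ^+ 2 * M) ^+ 2 by rewrite lerXn2r ?nnegrE ?mulr_ge0 ?sqr_ge0// ltW.
  apply: (le_trans (ler_wpM2r (sqr_ge0 E) lM2)).
  have N4 : 0 <= N ^+ 4 by rewrite exprn_ge0.
  by have := ler_wpM2l N4 E_bound; lra.
have cB : cross c a i j ^+ 2 <= 2 * N ^+ 2 * n.
  have sq k : c k ^+ 2 <= N ^+ 2.
    by rewrite -(real_normK (num_real (c k))) lerXn2r ?nnegrE// chi_mean_le.
  apply: (@le_trans _ _ ((c i ^+ 2 + c j ^+ 2) * n)).
    by rewrite /n /cross; have := sqr_ge0 (c i * a i + c j * a j); lra.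
  by rewrite ler_wpM2r//; have := sq i; have := sq j; lra.
have vE : cross (coord3 v) a i j = E + cross c a i j by rewrite /E /cross; ring.
have cv : cross (coord3 v) a i j ^+ 2 <= 2 * E ^+ 2 + 4 * N ^+ 2 * n.
  by rewrite vE; have := sqr_ge0 (E - cross c a i j); lra.
rewrite -/n mulrAC ler_pdivlMr// mulrC.
have := ler_wpM2l (ltW l2) cv.
have N2 : 0 <= N ^+ 2 by exact: sqr_ge0.
have := ler_wpM2l N2 nP.
by lra.
Qed.
End AtPoint.
End Fixed.
End PointwiseBound.

(** * From the dissipation to the weighted norm *)

Section Dissipation.
Context {R : realType}.
Implicit Types (g : R3 R -> R) (v w : R3 R).

Definition dissip g v : \bar R := (\int[lebesgue3]_w (g w * landau_form (v - w) (dlgrad g v w))%:E)%E.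

Lemma dissip_ge0 g v : (forall w, 0 <= g w) -> (0 <= dissip g v)%E.
Proof. by move=> g0; apply: integral_ge0 => w _; rewrite lee_fin mulr_ge0// landau_form_ge0. Qed.

Section Fixed.
Variables (g : R3 R -> R) (dg : 'I_3 -> R3 R -> R).
Hypotheses (hg : hasgrad g dg) (g0 : forall v, 0 <= g v).

Let G (z : M3 R * M3 R) : \bar R := (g z.2 * landau_form (z.1 - z.2 : R3 R) (dlgrad g z.1 z.2))%:E.

Let mg : measurable_fun [set: M3 R] (g : M3 R -> R).
Proof. by apply: continuous_measurable3; exact: hasgrad_cont hg. Qed.

Let mG : measurable_fun [set: M3 R * M3 R] G.
Proof.
apply/measurable_EFinP; apply: measurable_funM; last exact: measurable_landau_form hg g0.
exact: (measurableT_comp mg).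
Qed.

Let G0 z : (0 <= G z)%E. Proof. by rewrite lee_fin mulr_ge0// landau_form_ge0. Qed.

Lemma measurable_dissip : measurable_fun [set: M3 R] (dissip g : M3 R -> \bar R).
Proof.
exact: (@measurable_fun_fubini_tonelli_F _ _ (M3 R) (M3 R) R lebesgue3 G mG G0).
Qed.

Lemma entropy_dissipationE :
  (entropy_dissipation g = (2^-1)%:E * \int[lebesgue3]_v ((g v)%:E * dissip g v))%E.
Proof.
rewrite /entropy_dissipation; congr (_ * _)%E.
transitivity (\int[lebesgue3 \x lebesgue3]_z ((g z.1)%:E * G z))%E.
  apply: eq_integral => z _; rewrite -EFinM; congr EFin.
  rewrite /landau_form !mulr_sumr; apply: eq_bigr => i _.
  rewrite !mulr_sumr; apply: eq_bigr => j _; rewrite /dlgrad -![partial _ g _ / g _]/(lgrad g _ _).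
  by ring.
have mgz : measurable_fun [set: M3 R * M3 R] (fun z => (g z.1)%:E).
  by apply/measurable_EFinP; exact: (measurableT_comp mg).
rewrite fubini_tonelli1; last 2 first.
- exact: emeasurable_funM.
- by move=> z; rewrite mule_ge0// lee_fin.
apply: eq_integral => v _; rewrite /fubini_F /=.
rewrite ge0_integralZl//; last by rewrite lee_fin.
exact: (measurableT_comp mG (@pair1_measurable _ _ (M3 R) (M3 R) v)).
Qed.

Lemma entropy_dissipation_ge0 : (0 <= entropy_dissipation g)%E.
Proof.
rewrite entropy_dissipationE mule_ge0// ?lee_fin//.
by apply: integral_ge0 => v _; rewrite mule_ge0 ?lee_fin ?dissip_ge0.
Qed.

Variables (rho lam M0 K : R).
Hypotheses (lam0 : 0 < lam) (M00 : 0 <= M0) (K0 : 0 <= K)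
  (gM : (\int[lebesgue3]_v (g v)%:E <= M0%:E)%E)
  (gN : forall (a : R3 R) (c : R), ((lam * (a.1.1 ^+ 2 + a.1.2 ^+ 2 + a.2 ^+ 2))%:E
     <= \int[lebesgue3]_v (chi rho v * g v * (lform a v - c) ^+ 2)%:E)%E)
  (chiK : forall w, `|chi rho w| <= K) (dchiK : forall k w, `|dchi rho k w| <= K).

(** Three times the constant of [lgrad_pair_bound]: summing over the three pairs of indices covers
    |u|^2 twice and |v x u|^2 once. *)
Definition disC : R :=
  3 * (((1 + 4 * chiN rho ^+ 2) * (2 * (K * (2 * chiN rho + 1)) ^+ 2) + 2 * K ^+ 2 * chiN rho ^+ 4) / lam ^+ 2
   * ((1 + 3 * chiN rho ^+ 2) ^+ 2 * (16 * M0 + 32 * M0 ^+ 2))).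

Lemma disC_ge0 : 0 <= disC.
Proof.
have N0 : 0 <= chiN rho by rewrite /chiN; have := sqr_ge0 rho; lra.
rewrite /disC mulr_ge0// mulr_ge0//.
  rewrite divr_ge0 ?sqr_ge0// addr_ge0//.
    by rewrite !mulr_ge0// ?sqr_ge0// addr_ge0// mulr_ge0// sqr_ge0.
  by rewrite !mulr_ge0 ?sqr_ge0// exprn_ge0.
by rewrite mulr_ge0 ?sqr_ge0// addr_ge0 ?mulr_ge0 ?sqr_ge0.
Qed.

Lemma aniso_form_dissip_bound v d : (dissip g v <= d%:E)%E ->
  aniso_form v.1.1 v.1.2 v.2 (lgrad g j0 v) (lgrad g j1 v) (lgrad g j2 v)
    <= disC * (bracket v ^+ 3 * d + bracket v ^+ 2).
Proof.
move=> hd; have Y i j (ij : i != j) : lgrad g i v ^+ 2 + lgrad g j v ^+ 2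
    + cross (coord3 v) (fun k => lgrad g k v) i j ^+ 2
    <= disC / 3 * (bracket v ^+ 3 * d + bracket v ^+ 2).
  rewrite /disC (mulrC 3) mulfK// -mulrA.
  exact: (lgrad_pair_bound lam0 hg g0 M00 gM gN ij K0 chiK dchiK hd).
move: (Y j0 j1 isT) (Y j0 j2 isT) (Y j1 j2 isT).
rewrite mulrAC /aniso_form /cross /coord3 /=.
move: (lgrad g j0 v) (lgrad g j1 v) (lgrad g j2 v) (disC * _) v.1.1 v.1.2 v.2 => a b c D x y z h1 h2 h3.
by have := sqr_ge0 a; have := sqr_ge0 b; have := sqr_ge0 c; lra.
Qed.

(** The weight <v>^-3 in [fisher] exactly compensates the growth <v>^3 d + <v>^2 of the pointwise
    bound. *)
Lemma fisher_le_dissip v : ((fisher g v)%:E <= (1 + disC)%:E * ((g v)%:E * dissip g v + (g v)%:E))%E.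
Proof.
have C0 := disC_ge0.
have d0 := dissip_ge0 v g0.
have [gv|gv] := eqVneq (g v) 0; first by rewrite /fisher gv !mul0r mul0e adde0 mule0.
have gp : 0 < g v by rewrite lt_neqAle eq_sym gv g0.
have b1 := bracket_ge1 v; have b0 := bracket_gt0 v.
have [dy|dn] := eqVneq (dissip g v) +oo%E.
  by rewrite dy gt0_muley ?lte_fin// addye// gt0_muley ?leey// lte_fin ltr_pwDl.
have [d dE] : exists d : R, dissip g v = d%:E.
  by move: d0 dn; case: (dissip g v) => [r _ _| |]//; exists r.
have h := @aniso_form_dissip_bound v d; rewrite dE lexx in h; have {h} := h isT.
rewrite dE in d0 *; rewrite lee_fin in d0 => h.
suff : fisher g v <= (1 + disC) * (g v * d + g v) by [].
rewrite /fisher.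
set F := aniso_form _ _ _ _ _ _ in h *.
rewrite mulrAC ler_pdivrMr ?exprn_gt0//.
rewrite (_ : _ * bracket v ^+ 3 = g v * ((1 + disC) * (d + 1) * bracket v ^+ 3)); last by ring.
rewrite ler_pM2l//.
have b31 : 1 <= bracket v ^+ 3 by rewrite exprn_ege1.
have b23 : bracket v ^+ 2 <= bracket v ^+ 3 by rewrite ler_weXn2l.
have p1 := mulr_ge0 C0 d0.
have p2 : disC * bracket v ^+ 2 <= disC * bracket v ^+ 3 by rewrite ler_wpM2l.
have p3 : 0 <= d * bracket v ^+ 3 by rewrite mulr_ge0// exprn_ge0// ltW.
by lra.
Qed.

Lemma integral_fisher_le (D : R) : entropy_dissipation g = D%:E ->
  (\int[lebesgue3]_v (fisher g v)%:E <= ((1 + disC) * (2 * D + M0))%:E)%E.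
Proof.
move=> DE; have C0 := disC_ge0; have C1 : 0 <= 1 + disC by rewrite addr_ge0.
have mgd : measurable_fun [set: M3 R] (fun v : M3 R => (g v)%:E * dissip g v)%E.
  by apply: emeasurable_funM; [exact/measurable_EFinP|exact: measurable_dissip].
have mge : measurable_fun [set: M3 R] (fun v : M3 R => (g v)%:E) by exact/measurable_EFinP.
have gd0 v : (0 <= (g v)%:E * dissip g v)%E by rewrite mule_ge0 ?lee_fin ?dissip_ge0.
apply: (@le_trans _ _ (\int[lebesgue3]_v ((1 + disC)%:E * ((g v)%:E * dissip g v + (g v)%:E)))%E).
  apply: ge0_le_integral => //.
  - by move=> v _; rewrite lee_fin fisher_ge0.
  - by apply/measurable_EFinP; exact: measurable_fisher hg g0.
  - by apply: emeasurable_funM => //; exact: emeasurable_funD.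
  - by move=> v _; exact: fisher_le_dissip.
have sm := emeasurable_funD mgd mge.
have s0 v : [set: M3 R] v -> (0 <= (g v)%:E * dissip g v + (g v)%:E)%E.
  by move=> _; rewrite adde_ge0// lee_fin.
have C1e : (0 <= (1 + disC)%:E)%E by rewrite lee_fin.
rewrite (ge0_integralZl _ measurableT sm s0 C1e).
rewrite ge0_integralD//; last by move=> v _; rewrite lee_fin.
rewrite EFinM lee_wpmul2l ?lee_fin// EFinD leeD//.
have -> : (2 * D)%:E = (2%:E * entropy_dissipation g)%E by rewrite DE.
by rewrite entropy_dissipationE muleA -EFinM divff// mul1e.
Qed.

End Fixed.
End Dissipation.

Lemma sobC_ge0 (R : realType) : 0 <= sobC :> R.
Proof.
rewrite /sobC; apply: mulr_ge0; last by apply: exprn_ge0; exact: sobC0_ge0.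
by apply: exprn_ge0; apply: mulr_ge0; [apply: exprn_ge0|].
Qed.

Lemma wLnorm_sobolev (R : realType) (g : R3 R -> R) (dg : 'I_3 -> R3 R -> R) (K : R) :
  hasgrad g dg -> (forall v, 0 <= g v) -> 0 <= K ->
  (\int[lebesgue3]_v (fisher g v)%:E <= K%:E)%E ->
  (wLnorm 3 (5 / 3) setT g <= (sobC `^ 3^-1 * K)%:E)%E.
Proof.
move=> hg g0 K0 hK; rewrite /wLnorm.
have C0 : 0 <= sobC :> R by exact: sobC_ge0.
have E : (\int[lebesgue3]_v ((`|g v| `^ 3) * (bracket v `^ (- (3 * (5 / 3)))))%:E
   = \int[lebesgue3]_v (g v ^+ 3 / bracket v ^+ 5)%:E)%E.
  apply: eq_integral => v _; congr EFin.
  have -> : - (3 * (5 / 3)) = - 5%:R :> R by field.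
  by rewrite ger0_norm// powRN !powR_mulrn// ltW// bracket_gt0.
rewrite E.
have I0 : (0 <= \int[lebesgue3]_v (g v ^+ 3 / bracket v ^+ 5)%:E)%E.
  by apply: integral_ge0 => v _; rewrite lee_fin divr_ge0 ?exprn_ge0// ltW// bracket_gt0.
have SK : 0 <= sobC * K ^+ 3 by rewrite mulr_ge0// exprn_ge0.
have -> : sobC `^ 3^-1 * K = (sobC * K ^+ 3) `^ 3^-1.
  by rewrite powRM ?exprn_ge0// -[K ^+ 3]powR_mulrn// -powRrM divff// powRr1.
rewrite -poweR_EFin; apply: gt0_ler_poweR => //.
- by rewrite in_itv/= I0 leey.
- by rewrite in_itv/= lee_fin SK leey.
exact: weighted_sobolev hg g0 K0 hK.
Qed.

Theorem theorem1p1 (R : realType) (m0 M0 E0 H0 : R) :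
  0 < m0 -> 0 < M0 -> 0 < E0 ->
  exists2 c1 : R, 0 < c1 &
    forall (f0 : R3 R -> R3 R -> R) (f : R -> R3 R -> R3 R -> R),
      landau_solution f0 f ->
      (forall (t : R) (x : R3 R), 0 <= t ->
        [/\ (m0%:E <= \int[lebesgue3]_v (f t x v)%:E)%E,
            (\int[lebesgue3]_v (f t x v)%:E <= M0%:E)%E,
            (\int[lebesgue3]_v (f t x v * enorm v ^+ 2)%:E <= E0%:E)%E
          & (\int[lebesgue3]_v (f t x v * ln (f t x v))%:E <= H0%:E)%E]) ->
      forall (t : R) (x : R3 R), 0 <= t ->
        (c1%:E * wLnorm 3 (5 / 3) setT (f t x) - (24 * M0 ^+ 2)%:E
           <= entropy_dissipation (f t x))%E.
Proof.
move=> m0p M0p E0p.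
have [rho [lam [_ lam0 ND]]] := nondegenerate H0 m0p E0p.
have [K K0 [chiK dchiK]] := @chi_bounded R rho.
pose q := sobC `^ 3^-1 * (1 + disC rho lam M0 K).
have q0 : 0 <= q.
  by rewrite mulr_ge0 ?powR_ge0// addr_ge0// disC_ge0// ltW.
have s0 : 0 < 1 + 2 * q + q / (24 * M0).
  apply: ltr_wpDr; first by apply: divr_ge0 => //; apply: mulr_ge0 => //; exact: ltW.
  by apply: ltr_wpDr => //; exact: mulr_ge0.
(* With norm at most q (2 D + M0), this makes (D + 24 M0^2) / c1 dominate: the summand 2 q against D
   gives 2 q D, and q / (24 M0) against 24 M0^2 gives q M0; the 1 keeps the inverse well defined
   when q = 0. *)
exists (1 + 2 * q + q / (24 * M0))^-1; first by rewrite invr_gt0.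
move=> f0 f sol bnd t x t0; have [hm hM hE hH] := bnd t x t0.
have hg := C1_hasgrad (landau_C1_v sol x t0).
have g0 v : 0 <= f t x v := landau_ge0 sol x v t0.
have gN := ND _ (hasgrad_cont hg) g0 hm hE hH.
have D0 := entropy_dissipation_ge0 hg g0.
have [->|Dn] := eqVneq (entropy_dissipation (f t x)) +oo%E; first by rewrite leey.
have [D DE] : exists D : R, entropy_dissipation (f t x) = D%:E.
  by move: D0 Dn; case: (entropy_dissipation _) => [r _ _| |]//; exists r.
rewrite DE lee_fin in D0.
have IF := integral_fisher_le hg g0 lam0 (ltW M0p) K0 hM gN chiK dchiK DE.
have C0 : 0 <= 1 + disC rho lam M0 K by rewrite addr_ge0// disC_ge0// ltW.
have DM : 0 <= 2 * D + M0 by rewrite addr_ge0 ?mulr_ge0// ltW.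
have := wLnorm_sobolev hg g0 (mulr_ge0 C0 DM) IF.
rewrite mulrA -/q => W; rewrite DE leeBlDr//.
apply: (@le_trans _ _ ((1 + 2 * q + q / (24 * M0))^-1%:E * (q * (2 * D + M0))%:E)%E).
  by rewrite lee_wpmul2l// lee_fin invr_ge0 ltW.
rewrite -EFinM -EFinD lee_fin mulrC ler_pdivrMr//.
have M2 : 0 <= M0 ^+ 2 by exact: sqr_ge0.
have r0 : 0 <= q / (24 * M0) by rewrite divr_ge0// mulr_ge0// ltW.
have rE : 24 * M0 ^+ 2 * (q / (24 * M0)) = q * M0 by field; rewrite gt_eqF.
have p1 := mulr_ge0 D0 r0; have p2 := mulr_ge0 M2 q0.
rewrite -subr_ge0.
apply: (@le_trans _ _ (D + D * (q / (24 * M0)) + 24 * M0 ^+ 2 + 48 * (M0 ^+ 2 * q))).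
  by apply: addr_ge0; [apply: addr_ge0; [exact: addr_ge0|exact: mulr_ge0]|exact: mulr_ge0].
move: rE; move: (q / (24 * M0)) => r rE; lra.
Qed.
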